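(* Let $d,n\in\mathbb{N}$, $r>0$, $\hat\alpha=(\alpha_1,\dots,\alpha_d)\in(0,1]^d$, $A,B\in\mathbb{R}^{d\times d}$, $E\in\mathbb{R}^{d\times n}$, $C=(c_{ij})\in\mathbb{R}^{n\times d}$, $D=(d_{ij})\in\mathbb{R}^{n\times n}$, and let $\tau_k:[0,\infty)\to\mathbb{R}_{\ge0}$ ($k=1,2,3$) be continuous with $t-\tau_k(t)\ge -r$ for all $t\ge0$ and $\lim_{t\to\infty}(t-\tau_k(t))=\infty$. Suppose that $A$ is Metzler, $B,C,D,E$ are nonnegative, and $$\sum_{k=1}^d|c_{ik}|<1\quad\text{and}\quad \sum_{j=1}^n|d_{ij}|<1\qquad\text{for all } i=1,\dots,n.$$ Then the homogeneous system $$\begin{cases}{}^{C}D^{\hat\alpha}_{0^+}x(t)=Ax(t)+Bx(t-\tau_1(t))+Ey(t-\tau_2(t)), & t\in(0,\infty),\\ y(t)=Cx(t)+Dy(t-\tau_3(t)), & t\in[0,\infty),\\ x(t)=\psi(t),\ y(t)=\varphi(t), & t\in[-r,0],\end{cases}$$ is globally attractive (that is, for all $\psi\in C([-r,0];\mathbb{R}^d_{\ge0})$ and $\varphi\in C([-r,0];\mathbb{R}^n_{\ge0})$ with $C\psi(0)+D\varphi(-\tau_3(0))=\varphi(0)$, its solution $\Phi(\cdot;\psi,\varphi)=(x,y)^{\rm T}$ satisfies $\lim_{t\to\infty}\|\Phi(t;\psi,\varphi)\|=0$) if and only if $A+B+E(I_n-D)^{-1}C$ is Hurwitz.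
   Context: For $\alpha\in(0,1]$, $I^\alpha_{0^+}u(t)=\frac{1}{\Gamma(\alpha)}\int_0^t(t-s)^{\alpha-1}u(s)\,ds$ (with $I^0_{0^+}u=u$), and the Caputo fractional derivative is ${}^{C}D^{\alpha}_{0^+}u(t)=\frac{d}{dt}I^{1-\alpha}_{0^+}(u(t)-u(0))$ for $t>0$; ${}^{C}D^{\hat\alpha}_{0^+}x(t)=({}^{C}D^{\alpha_1}_{0^+}x_1(t),\dots,{}^{C}D^{\alpha_d}_{0^+}x_d(t))^{\rm T}$. A square matrix is Metzler if its off-diagonal entries are nonnegative, and Hurwitz if all its eigenvalues have negative real part; a matrix is nonnegative if all its entries are. The solution $\Phi(\cdot;\psi,\varphi)$ is the (under the row-sum conditions, unique) continuous function $[-r,\infty)\to\mathbb{R}^{d+n}$ satisfying the equations and the initial condition. Global attractivity is spelled out in the claim in the form the paper defines it for positive systems (nonnegative inputs and nonnegative initial data produce nonnegative solutions); the system here is of this kind. *)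

(* Defs.v *)
From HB Require Import structures.
From mathcomp Require Import all_boot all_order all_algebra.
From mathcomp Require Import complex.
From mathcomp Require Import all_classical all_reals all_analysis.

Set Implicit Arguments.
Unset Strict Implicit.
Unset Printing Implicit Defensive.

Import Order.TTheory GRing.Theory Num.Theory.
Import numFieldNormedType.Exports.

Local Open Scope classical_set_scope.
Local Open Scope ring_scope.

Definition Gamma (R : realType) (a : R) : R :=
  \int[@lebesgue_measure R]_(s in `]0, +oo[) (s `^ (a - 1) * expR (- s)).

Definition frac_int (R : realType) (a : R) (u : R -> R) (t : R) : R :=
  if a == 0 then u t else
  (Gamma a)^-1 *
    \int[@lebesgue_measure R]_(s in `[0, t]) ((t - s) `^ (a - 1) * u s).

Definition caputo_primitive (R : realType) (a : R) (u : R -> R) : R -> R :=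
  frac_int (1 - a) (fun s => u s - u 0).

Definition caputo (R : realType) (a : R) (u : R -> R) : R -> R :=
  derive1 (caputo_primitive a u).

(* [derive1] is total, so the existence of the derivative is a separate
   predicate. *)
Definition caputo_derivable (R : realType) (a : R) (u : R -> R) (t : R) : Prop :=
  derivable (caputo_primitive a u) t 1.

Definition caputo_vec_derivable (R : realType) (d : nat) (alpha : 'I_d -> R)
    (x : R -> 'cV[R]_d) (t : R) : Prop :=
  forall i, caputo_derivable (alpha i) (fun s => x s i 0) t.

Definition caputo_vec (R : realType) (d : nat) (alpha : 'I_d -> R)
    (x : R -> 'cV[R]_d) (t : R) : 'cV[R]_d :=
  \col_i caputo (alpha i) (fun s => x s i 0) t.

Definition nonneg_mx (R : numDomainType) (m n : nat) (M : 'M[R]_(m, n)) : Prop :=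
  forall i j, 0 <= M i j.

Definition metzler (R : numDomainType) (n : nat) (M : 'M[R]_n) : Prop :=
  forall i j, i != j -> 0 <= M i j.

Definition hurwitz (R : rcfType) (n : nat) (M : 'M[R]_n) : Prop :=
  forall z : R[i], eigenvalue (map_mx (real_complex R) M) z -> complex.Re z < 0.

Definition delay (R : realType) (r : R) (tau : R -> R) : Prop :=
  [/\ {within `[0, +oo[, continuous tau},
      forall t, 0 <= t -> 0 <= tau t,
      forall t, 0 <= t -> - r <= t - tau t
    & t - tau t @[t --> +oo] --> +oo].

(* [x] and [y] are total functions, of which only the values on [-r, +oo[
   matter; likewise [psi] and [phi] on [-r, 0]. *)
Definition is_solution (R : realType) (d n : nat) (r : R) (alpha : 'I_d -> R)
    (A B : 'M[R]_d) (E : 'M[R]_(d, n)) (C : 'M[R]_(n, d)) (D : 'M[R]_n)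
    (tau1 tau2 tau3 : R -> R) (psi : R -> 'cV[R]_d) (phi : R -> 'cV[R]_n)
    (x : R -> 'cV[R]_d) (y : R -> 'cV[R]_n) : Prop :=
  [/\ {within `[- r, +oo[, continuous x} /\ {within `[- r, +oo[, continuous y},
      forall t, 0 < t ->
        caputo_vec_derivable alpha x t /\
        caputo_vec alpha x t =
          A *m x t + B *m x (t - tau1 t) + E *m y (t - tau2 t),
      forall t, 0 <= t -> y t = C *m x t + D *m y (t - tau3 t)
    & forall t, - r <= t <= 0 -> x t = psi t /\ y t = phi t].

Definition globally_attractive (R : realType) (d n : nat) (r : R)
    (alpha : 'I_d -> R)
    (A B : 'M[R]_d) (E : 'M[R]_(d, n)) (C : 'M[R]_(n, d)) (D : 'M[R]_n)
    (tau1 tau2 tau3 : R -> R) : Prop :=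
  forall (psi : R -> 'cV[R]_d) (phi : R -> 'cV[R]_n),
    {within `[- r, 0], continuous psi} ->
    {within `[- r, 0], continuous phi} ->
    (forall t, - r <= t <= 0 -> nonneg_mx (psi t) /\ nonneg_mx (phi t)) ->
    C *m psi 0 + D *m phi (- tau3 0) = phi 0 ->
    forall (x : R -> 'cV[R]_d) (y : R -> 'cV[R]_n),
      is_solution r alpha A B E C D tau1 tau2 tau3 psi phi x y ->
      `|col_mx (x t) (y t)| @[t --> +oo] --> (0 : R).

(* Main.v *)
Require Import Defs.
From mathcomp Require Import all_boot all_order all_algebra.
From mathcomp Require Import complex.
From mathcomp Require Import all_classical all_reals all_analysis.
From mathcomp Require Import measurable_realfun ring lra.

Set Implicit Arguments.
Unset Strict Implicit.
Unset Printing Implicit Defensive.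

Import Order.TTheory GRing.Theory Num.Theory.
Import numFieldNormedType.Exports.

Local Open Scope classical_set_scope.
Local Open Scope ring_scope.

(** Write M := A + B + E (1 - D)^-1 C.  Both implications compare a solution
    with a constant state (v, w) of the system.  Eliminating w from
    w = C v + D w shows that the constant state is driven by M v alone, so the
    sign of M v decides between decay and persistence, whatever the delays and
    the fractional orders are.

    Matrices.  M is Metzler.  If M is Hurwitz there is v > 0 with M v < 0
    ([metzler_hurwitz]): otherwise the least real s for which some v > 0
    satisfies M v < s v would be a nonnegative eigenvalue.  If M is not
    Hurwitz, the moduli of an eigenvector for an eigenvalue of nonnegative
    real part form a nonzero v >= 0 with M v >= 0 ([metzler_not_hurwitz]).

    Reduction to integral equations.  For continuous x and f, the Caputo
    equation of order a with right-hand side f is equivalent on [0, +oo[ to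
      x(t) = x(0) + kappa a * \int_0^t (t - s)^(a - 1) f(s) ds
    ([caputo_volterra]).  The kernels s^(-a) and s^(a - 1) convolve to a
    constant, which gives both the formula and the injectivity of the
    fractional integral; kappa a is expressed with that constant.

    Scalar comparison.  Let k(t) = t^(a - 1) and let s solve s = 1 - l (k * s).
    Log-convexity of k makes s positive and nonincreasing: at a first zero of a
    solution the memory term is bounded by its value slightly earlier
    ([volterra_pos]).  It follows that s tends to 0, that a solution of
    u = u(0) + c (k * (F - m u)) with F >= 0 stays above u(0) s
    ([volterra_ge]), and that limsup u <= (limsup F) / m ([volterra_limsup]).

    Hurwitz implies attractive.  From M v < 0 one gets (v, w) > 0 with
    A v + B v + E w < 0 and C v + D w < w.  A solution whose initial data lie
    strictly below (v, w) never reaches it ([trajectory_upper]).  Since the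
    delayed arguments tend to infinity, a bound rho (v, w) valid at late times
    improves to a bound (1 - eta / 2) rho (v, w) at later times
    ([trajectory_contract]); iterating, and doing the same for the opposite
    solution, gives convergence to 0.

    Attractive implies Hurwitz.  If M is not Hurwitz, the deviation (u, z) from
    the constant state (v, w) solves the same system with zero data and the
    additional constant forcing M v >= 0.  A solution of that system with u >= 0
    exists ([positive_solution]): it is obtained by a contraction for the system
    with (u, z) replaced by positive parts, and [volterra_ge] shows that the
    positive parts change nothing.  Then (v + u, w + z) solves the original
    system from nonnegative data and does not tend to 0. *)

(** * Affine changes of variable in Lebesgue integrals *)

Section Affine.
Context {R : realType}.
Notation mu := (@lebesgue_measure R).
Local Open Scope ereal_scope.

Lemma measurable_affine (a b : R) :
  measurable_fun [set: R] (fun x : R => a * x + b)%R.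
Proof.
apply: measurable_funD => //; apply: measurable_funM => //; exact: measurable_id.
Qed.

(** The pushforward of Lebesgue measure under x |-> a x + b, multiplied by a, agrees with Lebesgue measure on intervals, hence everywhere. *)
Lemma ge0_integral_affine (f : R -> \bar R) (a b : R) : (0 < a)%R ->
  measurable_fun [set: R] f -> (forall x, 0 <= f x) ->
  \int[mu]_x f x = a%:E * \int[mu]_x f (a * x + b)%R.
Proof.
move=> a0 mf f0.
pose phi := (fun x : R => (a * x + b)%R) : measurableTypeR R -> measurableTypeR R.
have mphi : measurable_fun setT phi by exact: measurable_affine.
have a0' : (0 <= a)%R by exact: ltW.
pose nu_ : {measure set (measurableTypeR R) -> \bar R} :=
  mscale (NngNum a0') (pushforward mu phi).
pose nu := nu_ mphi.
transitivity (\int[nu]_x f x).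
  apply: eq_measure_integral => A mA _.
  apply: lebesgue_measure_unique => // _ [[u v]] _ <- /=.
  rewrite /nu /nu_ /mscale/= /pushforward.
  rewrite (_ : phi @^-1` _ = `](u - b) / a, (v - b) / a]%classic)%R; last first.
    apply/seteqP; split=> x /=; rewrite !in_itv /phi /=;
      by rewrite ltr_pdivrMr// ler_pdivlMr// lerBrDr ltrBlDr (mulrC x).
  rewrite !lebesgue_measure_itv/= !lte_fin.
  rewrite ltr_pM2r ?invr_gt0// ltrD2r; case: ifP => _; last by rewrite mule0.
  rewrite -!EFinD -EFinM; congr EFin.
  by rewrite -mulrBl mulrCA divff ?gt_eqF// mulr1 opprD opprK addrACA addNr addr0.
by rewrite /nu /nu_ ge0_integral_mscale// ge0_integral_pushforward.
Qed.

Lemma integral_translate (f : R -> \bar R) (b : R) :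
  measurable_fun [set: R] f ->
  \int[mu]_x f (x + b)%R = \int[mu]_x f x.
Proof.
move=> mf; rewrite integralE [RHS]integralE; congr (_ - _).
- rewrite [RHS](ge0_integral_affine b ltr01)//; last exact: measurable_funepos.
  by rewrite mul1e; apply: eq_integral => x _; rewrite !funeposE mul1r.
- rewrite [RHS](ge0_integral_affine b ltr01)//; last exact: measurable_funeneg.
  by rewrite mul1e; apply: eq_integral => x _; rewrite !funenegE mul1r.
Qed.

Lemma integral_opp (f : R -> \bar R) : measurable_fun [set: R] f ->
  \int[mu]_x f (- x)%R = \int[mu]_x f x.
Proof.
have H (g : R -> \bar R) : measurable_fun [set: R] g -> (forall x, 0 <= g x) ->
    \int[mu]_x g (- x)%R = \int[mu]_x g x.
  move=> mg g0.
  transitivity (\int[pushforward mu (-%R : measurableTypeR R -> measurableTypeR R)]_x g x).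
    by rewrite ge0_integral_pushforward//; exact: oppr_measurable.
  by apply: eq_measure_integral => A mA _; exact: lebesgue_measureN.
move=> mf; rewrite integralE [RHS]integralE; congr (_ - _).
- rewrite -(H f^\+)//; last exact: measurable_funepos.
  by apply: eq_integral => x _; rewrite !funeposE.
- rewrite -(H f^\-)//; last exact: measurable_funeneg.
  by apply: eq_integral => x _; rewrite !funenegE.
Qed.

Lemma integral_reflect (f : R -> \bar R) (t : R) : measurable_fun [set: R] f ->
  \int[mu]_x f (t - x)%R = \int[mu]_x f x.
Proof.
move=> mf.
rewrite -[RHS](integral_translate t)// -[RHS]integral_opp; last first.
  apply: measurableT_comp => //; apply: measurable_funD => //; exact: measurable_id.
by apply: eq_integral => x _; rewrite addrC.
Qed.

End Affine.

(** * Causal convolution *)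

Section Convolution.
Context {R : realType}.
Notation mu := (@lebesgue_measure R).
Implicit Types f g h k : R -> R.

(** Cutting functions off on the negative half-line turns the integral over ]0, t[ in a Volterra convolution into an integral over the whole line, where translation invariance and Tonelli's theorem apply directly. *)
Definition causal f (s : R) : R := if 0 < s then f s else 0.

Definition cconv f g (t : R) : R := \int[mu]_s (causal f s * causal g (t - s)).

(** The extended-real version of [cconv], on which associativity can be proved before any integrability is known. *)
Definition econv f g (t : R) : \bar R :=
  (\int[mu]_s (causal f s * causal g (t - s))%:E)%E.

(** Only the values on ]0, +oo[ matter, so a kernel may be singular at 0. *)
Definition lockernel k :=
  [/\ measurable_fun [set: R] k, forall s, 0 < s -> 0 <= k s &
      forall T, (\int[mu]_(s in `]0%R, T[) (k s)%:E < +oo)%E].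

Lemma measurable_causal f : measurable_fun [set: R] f -> measurable_fun [set: R] (causal f).
Proof. by move=> mf; apply: measurable_fun_ifT => //; exact: measurable_fun_ltr. Qed.

Lemma causal_ge0 f : (forall s, 0 < s -> 0 <= f s) -> forall s, 0 <= causal f s.
Proof. by move=> f0 s; rewrite /causal; case: ifPn => // /f0. Qed.

Lemma measurable_cconv_integrand f g (t : R) : measurable_fun [set: R] f -> measurable_fun [set: R] g ->
  measurable_fun [set: R] (fun s => causal f s * causal g (t - s)).
Proof.
move=> mf mg; apply: measurable_funM; first exact: measurable_causal.
apply: measurableT_comp; first exact: measurable_causal.
exact: measurable_funB.
Qed.

Lemma cconv_integrandE f g t : (fun s => causal f s * causal g (t - s)) =
  (fun s => f s * g (t - s)) \_ `]0, t[.
Proof.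
apply/funext => s; rewrite patchE /causal mem_setE in_itv /= subr_gt0.
by case: (0 < s); case: (s < t); rewrite /= ?mulr0 ?mul0r.
Qed.

Lemma cconvE f g t : cconv f g t = \int[mu]_(s in `]0, t[) (f s * g (t - s)).
Proof. by rewrite /cconv cconv_integrandE -Rintegral_mkcond. Qed.

Lemma cconv_le0 f g t : t <= 0 -> cconv f g t = 0.
Proof. by move=> t0; rewrite cconvE set_itv_ge ?Rintegral_set0// bnd_simp -leNgt. Qed.

Lemma causal_cconv f g t : causal (cconv f g) t = cconv f g t.
Proof. by rewrite /causal; case: ltP => // /(cconv_le0 f g) ->. Qed.

Lemma eq_cconv f f' g g' t : (forall s, 0 < s < t -> f s = f' s) ->
  (forall s, 0 < s < t -> g s = g' s) -> cconv f g t = cconv f' g' t.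
Proof.
move=> ff gg; rewrite !cconvE; apply: eq_Rintegral => s.
rewrite mem_setE in_itv /= => st; rewrite ff// gg//.
by move: st => /andP[s0 st]; rewrite subr_gt0 st ltrBlDr ltrDl s0.
Qed.

Lemma econvC f g t : measurable_fun [set: R] f -> measurable_fun [set: R] g ->
  econv f g t = econv g f t.
Proof.
move=> mf mg; rewrite /econv -[LHS](@integral_reflect _ _ t); last first.
  by apply/measurable_EFinP; exact: measurable_cconv_integrand.
by apply: eq_integral => s _; rewrite subKr mulrC.
Qed.

Lemma cconvC f g t : measurable_fun [set: R] f -> measurable_fun [set: R] g ->
  cconv f g t = cconv g f t.
Proof. by move=> mf mg; rewrite /cconv /Rintegral -/(econv f g t) econvC. Qed.

Lemma EFin_cconv f g t : (forall s, 0 < s -> 0 <= f s) -> (forall s, 0 < s -> 0 <= g s) ->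
  (econv f g t < +oo)%E -> (cconv f g t)%:E = econv f g t.
Proof.
move=> f0 g0 fin; rewrite /cconv /Rintegral fineK// ge0_fin_numE//.
by apply: integral_ge0 => s _; rewrite lee_fin mulr_ge0 ?causal_ge0.
Qed.

(** Tonelli's theorem together with a translation of the inner integral. The finiteness assumptions only ensure that the inner real-valued convolutions are not the default value of [fine]. *)
Lemma econvA f g h t :
  measurable_fun [set: R] f -> measurable_fun [set: R] g -> measurable_fun [set: R] h ->
  (forall s, 0 < s -> 0 <= f s) -> (forall s, 0 < s -> 0 <= g s) ->
  (forall s, 0 < s -> 0 <= h s) ->
  (forall t, (econv f g t < +oo)%E) -> (forall t, (econv g h t < +oo)%E) ->
  econv f (cconv g h) t = econv (cconv f g) h t.
Proof.
move=> mf mg mh f0 g0 h0 ffg fgh.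
have mcausal := measurable_causal.
transitivity (\int[mu]_s \int[mu]_x (causal f s * causal g (x - s) * causal h (t - x))%:E)%E.
  apply: eq_integral => s _; rewrite causal_cconv EFinM EFin_cconv// -ge0_integralZl//.
  - rewrite -[LHS](integral_translate (- s)); last first.
      apply/measurable_EFinP; apply: measurable_funM => //.
      exact: measurable_cconv_integrand.
    apply: eq_integral => x _; rewrite -EFinM mulrA; congr (_ * causal h _)%:E.
    by rewrite opprB addrA subrK.
  - by apply/measurable_EFinP; exact: measurable_cconv_integrand.
  - by move=> x _; rewrite lee_fin mulr_ge0 ?causal_ge0.
  - by rewrite lee_fin causal_ge0.
have mF : measurable_fun [set: R * R]
    (fun z => (causal f z.1 * causal g (z.2 - z.1) * causal h (t - z.2))%:E).
  apply/measurable_EFinP; apply: measurable_funM; [apply: measurable_funM|].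
  - by apply: measurableT_comp; [exact: mcausal|exact: measurable_fst].
  - apply: measurableT_comp; [exact: mcausal|].
    by apply: measurable_funB; [exact: measurable_snd|exact: measurable_fst].
  - apply: measurableT_comp; [exact: mcausal|].
    by apply: measurable_funB => //; exact: measurable_snd.
rewrite (@fubini_tonelli _ _ _ _ R mu mu
  (fun z => (causal f z.1 * causal g (z.2 - z.1) * causal h (t - z.2))%:E))//; last first.
  by move=> z; rewrite lee_fin !mulr_ge0 ?causal_ge0.
apply: eq_integral => x _ /=.
rewrite causal_cconv EFinM EFin_cconv// -ge0_integralZr//.
- by apply/measurable_EFinP; exact: measurable_cconv_integrand.
- by move=> s _; rewrite lee_fin mulr_ge0 ?causal_ge0.
- by rewrite lee_fin causal_ge0.
Qed.

End Convolution.

(** * Convolution of a locally integrable kernel with a continuous function *)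

Section Kernel.
Context {R : realType}.
Notation mu := (@lebesgue_measure R).
Implicit Types f g h k : R -> R.

Lemma continuous_itv_bounded f (a b : R) : continuous f ->
  exists2 M : R, 0 <= M & forall s, a <= s <= b -> `|f s| <= M.
Proof.
move=> cf; have [ab|ba] := leP a b; last first.
  exists 0 => // s /andP[h1 h2].
  by move: (le_trans h1 h2); rewrite leNgt ba.
have cn : {within `[a, b], continuous (fun x => `|f x|)}.
  apply: continuous_subspaceT => x; apply: cvg_norm; exact: cf.
have [c _ hc] := EVT_max ab cn.
by exists `|f c| => // s sab; apply: hc; rewrite in_itv.
Qed.

Lemma lockernel_integrable k (T : R) : lockernel k ->
  mu.-integrable `]0, T[ (EFin \o k).
Proof.
move=> [mk k0 kT]; apply/integrableP; split.
  by apply/measurable_EFinP; exact: measurable_funTS.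
apply: le_lt_trans (kT T); rewrite le_eqVlt; apply/orP; left; apply/eqP.
apply: eq_integral => s.
by rewrite mem_setE in_itv /= => /andP[s0 _]; rewrite ger0_norm// k0.
Qed.

Lemma cconv_integrable k f (t M : R) : lockernel k -> measurable_fun [set: R] f ->
  (forall s, 0 < s < t -> `|f s| <= M) ->
  mu.-integrable [set: R] (EFin \o (fun s : R => causal k s * causal f (t - s))).
Proof.
move=> kk mf fM; have [mk k0 _] := kk; rewrite cconv_integrandE -restrict_EFin.
apply/integrable_restrict => //; rewrite setTI.
have mkf : measurable_fun [set: R] (fun s : R => k s * f (t - s)).
  apply: measurable_funM => //; apply: measurableT_comp => //.
  exact: measurable_funB.
apply: (@le_integrable _ _ _ mu _ _ _ (EFin \o (fun s : R => M * k s))) => //.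
- by apply: measurable_funTS; exact/measurable_EFinP.
- move=> s; rewrite /= in_itv /= => /andP[s0 st].
  rewrite lee_fin !normrM mulrC ler_pM//.
  apply: le_trans (ler_norm _); apply: fM.
  by rewrite subr_gt0 st ltrBlDr ltrDl.
- have := @integrableZl _ _ _ mu _ (measurable_itv `]0, t[) M _ (lockernel_integrable t kk).
  by [].
Qed.

Lemma cconv_cont_integrable k f (t : R) : lockernel k -> continuous f ->
  mu.-integrable [set: R] (EFin \o (fun s : R => causal k s * causal f (t - s))).
Proof.
move=> kk cf; have [M _ fM] := continuous_itv_bounded 0 t cf.
apply: (@cconv_integrable _ _ _ M) => //; first exact: continuous_measurable_fun.
by move=> s /andP[s0 st]; apply: fM; rewrite !ltW.
Qed.

Lemma cconv_lin k f g (a t : R) : lockernel k -> continuous f -> continuous g ->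
  cconv k (fun s => a * f s + g s) t = a * cconv k f t + cconv k g t.
Proof.
move=> kk cf cg; rewrite /cconv.
rewrite -RintegralZl//; last exact: cconv_cont_integrable.
rewrite -RintegralD//; last exact: cconv_cont_integrable.
  apply: eq_Rintegral => s _; rewrite /causal; case: ifP => _; case: ifP => _; ring.
have := @integrableZl _ _ _ mu _ measurableT a _ (cconv_cont_integrable t kk cf).
by [].
Qed.

Lemma cconv_le k f g (t : R) : lockernel k -> continuous f -> continuous g ->
  (forall s, 0 < s < t -> f s <= g s) -> cconv k f t <= cconv k g t.
Proof.
move=> kk cf cg fg; apply: le_Rintegral => //; try exact: cconv_cont_integrable.
move=> s _; have [mk k0 _] := kk.
rewrite /causal; case: ltP => s0; last by rewrite !mul0r.
case: ltP => st; last by rewrite !mulr0.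
rewrite ler_wpM2l ?k0// fg// st /=.
by rewrite ltrBlDr ltrDl.
Qed.

Lemma cconvZ k f (a t : R) : lockernel k -> continuous f ->
  cconv k (fun s => a * f s) t = a * cconv k f t.
Proof.
move=> kk cf; have := @cconv_lin k f (fun=> 0) a t kk cf (@cst_continuous _ _ (0:R)).
rewrite (_ : (fun s => a * f s + 0) = (fun s => a * f s)); last first.
  by apply/funext => s; rewrite addr0.
move=> ->; rewrite (_ : cconv k (fun=> 0) t = 0) ?addr0//.
rewrite /cconv /Rintegral integral0_eq// => s _.
by rewrite /causal; case: ifP; case: ifP; rewrite ?mulr0.
Qed.

Lemma cconvD k f g (t : R) : lockernel k -> continuous f -> continuous g ->
  cconv k (fun s => f s + g s) t = cconv k f t + cconv k g t.
Proof.
move=> kk cf cg; rewrite -[cconv k f t]mul1r -cconv_lin//.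
by apply: eq_cconv => // s _; rewrite mul1r.
Qed.

Lemma cconvB k f g (t : R) : lockernel k -> continuous f -> continuous g ->
  cconv k (fun s => f s - g s) t = cconv k f t - cconv k g t.
Proof.
move=> kk cf cg; rewrite addrC -mulN1r -cconv_lin//.
by apply: eq_cconv => // s _; rewrite mulN1r addrC.
Qed.

Lemma cconv_ge0 k f (t : R) : lockernel k -> (forall s, 0 < s < t -> 0 <= f s) -> 0 <= cconv k f t.
Proof.
move=> [mk k0 _] f0; rewrite cconvE; apply: Rintegral_ge0 => s.
rewrite /= in_itv /= => /andP[s0 st]; rewrite mulr_ge0 ?k0// f0//.
by rewrite subr_gt0 st ltrBlDr ltrDl.
Qed.

Lemma cconv_norm_le k f g (t : R) : lockernel k -> continuous f -> continuous g ->
  (forall s, 0 < s < t -> `|f s| <= g s) -> `|cconv k f t| <= cconv k g t.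
Proof.
move=> kk cf cg fg.
have cNg : continuous (fun s => - g s) by move=> x; apply: cvgN; exact: cg.
rewrite ler_norml; apply/andP; split.
- rewrite -mulN1r -cconvZ//; apply: cconv_le => //.
    by move=> x; apply: cvgM; [exact: cvg_cst|exact: cg].
  by move=> s st; rewrite mulN1r; have := fg _ st; rewrite ler_norml => /andP[].
- by apply: cconv_le => // s st; exact: (le_trans (ler_norm _) (fg _ st)).
Qed.

Lemma lockernel_cont g : continuous g -> (forall s, 0 < s -> 0 <= g s) -> lockernel g.
Proof.
move=> cg g0; split => //; first exact: continuous_measurable_fun.
move=> T; have [M M0 gM] := continuous_itv_bounded 0 T cg.
apply: (@le_lt_trans _ _ (\int[mu]_(s in `]0%R, T[) M%:E)%E).
  apply: ge0_le_integral => //.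
  - by move=> s; rewrite /= in_itv /= lee_fin => /andP[/g0].
  - by apply/measurable_EFinP; apply: measurable_funTS; exact: continuous_measurable_fun.
  - move=> s; rewrite /= in_itv /= lee_fin => /andP[s0 sT].
    by apply: le_trans (ler_norm _) _; apply: gM; rewrite !ltW.
by rewrite integral_cst//= lebesgue_measure_itv /=; case: ifP => _; rewrite ?mule0// -EFinB -EFinM ltry.
Qed.

Lemma cconv1E k (t : R) : cconv k (fun=> 1) t = \int[mu]_(s in `]0, t[) k s.
Proof. by rewrite cconvE; apply: eq_Rintegral => s _; rewrite mulr1. Qed.

(** On a bounded interval the function is the indefinite integral of one fixed integrable function. *)
Lemma cconv1_continuous k : lockernel k -> continuous (cconv k (fun=> 1)).
Proof.
move=> kk x; have [mk k0 kT] := kk.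
pose T := `|x| + 1.
have xT : x \in `]- T, T[ by rewrite in_itv /= -ltr_norml ltrDl.
have ck y : y <= T -> mu.-integrable `[- T, y] (EFin \o causal k).
  move=> yT; apply: (@eq_integrable _ _ _ mu _ _ (EFin \o (k \_ `]0, T + 1[))) => //.
    move=> s; rewrite mem_setE in_itv /= => /andP[sT sy].
    rewrite patchE /causal mem_setE in_itv /=.
    by rewrite (le_lt_trans sy) ?andbT// (le_lt_trans yT)// ltrDl.
  apply: (@integrableS _ _ _ mu setT) => //.
  rewrite -restrict_EFin; apply/integrable_restrict => //; rewrite setTI.
  exact: lockernel_integrable.
have TT : - T < T by move: xT; rewrite in_itv /= => /andP[]; exact: lt_trans.
have /(continuous_within_itvP _ TT)[/(_ x xT) h _ _] :=
  @parameterized_integral_continuous R (- T) T (causal k) (ltW TT) (ck T (lexx _)).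
have E y : y \in `]- T, T[ ->
    parameterized_integral mu (- T) y (causal k) = cconv k (fun=> 1) y.
  rewrite in_itv /= => /andP[yT Ty].
  rewrite /parameterized_integral -Rintegral_itv_bndo_bndc; last first.
    by apply: integrableS (ck y (ltW Ty)) => //; exact: subset_itv_co_cc.
  rewrite Rintegral_mkcond; apply: eq_Rintegral => s _.
  rewrite patchE mem_setE in_itv /= /causal subr_gt0.
  case: (ltP s y) => sy; last by rewrite andbF mulr0.
  rewrite andbT mulr1; case: (leP (- T) s) => // sT.
  by rewrite ltNge (le_trans (ltW sT))// oppr_le0 /T addr_ge0.
move: h; rewrite /continuous_at E//; apply: cvg_trans.
apply: near_eq_cvg; near=> y; apply: E.
by near: y; exact: near_in_itvoo.
Unshelve. all: by end_near. Qed.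

Lemma max_cst_continuous (a : R) : continuous (fun t : R => Num.max t a).
Proof.
rewrite (_ : (fun t => Num.max t a) = (fun t => (t + a + `|t - a|) / 2)).
  move=> t; apply: cvgM; last exact: cvg_cst.
  apply: cvgD; first by apply: cvgD; [exact: cvg_id|exact: cvg_cst].
  by apply: cvg_norm; apply: cvgB; [exact: cvg_id|exact: cvg_cst].
by apply/funext => t; rewrite maxr_absE.
Qed.

Lemma causal_continuous f : continuous f -> f 0 = 0 -> continuous (causal f).
Proof.
move=> cf f0; rewrite (_ : causal f = f \o (fun t : R => Num.max t 0)).
  by move=> t; apply: continuous_comp; [exact: max_cst_continuous|exact: cf].
by apply/funext => s; rewrite /causal /=; case: ltP.
Qed.

(** Subtracting f 0 makes [causal f] continuous, so that the integrand depends continuously on t for every fixed s and dominated convergence applies; the constant f 0 is covered by [cconv1_continuous]. *)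
Lemma cconv_continuous k f : lockernel k -> continuous f -> continuous (cconv k f).
Proof.
move=> kk cf; have [mk k0 kT] := kk.
pose g s := f s - f 0.
have cg : continuous g by move=> x; apply: cvgB; [exact: cf|exact: cvg_cst].
have ccg : continuous (causal g) by apply: causal_continuous => //; rewrite /g subrr.
have -> : cconv k f = (fun t => f 0 * cconv k (fun=> 1) t + cconv k g t).
  apply/funext => t; rewrite -cconv_lin//; last exact: cst_continuous.
  by apply: eq_cconv => // s _; rewrite /g mulr1 addrC subrK.
suff cvg : continuous (cconv k g).
  move=> x; apply: cvgD; last exact: cvg.
  by apply: cvgM; [exact: cvg_cst|exact: cconv1_continuous].
move=> x; pose T := `|x| + 1.
have xT : x \in `]- T, T[ by rewrite in_itv /= -ltr_norml ltrDl.
have [M M0 gM] := continuous_itv_bounded 0 T cg.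
have ckT : mu.-integrable `]0, T[ (EFin \o (fun s => k s * M)).
  have := @integrableZr _ _ _ mu _ (measurable_itv `]0, T[) M _ (lockernel_integrable T kk).
  by [].
have cgM y : y < T -> `|causal g y| <= M.
  move=> yT; rewrite /causal; case: ifPn => y0; last by rewrite normr0.
  by apply: gM; rewrite !ltW.
have mcg : measurable_fun [set: R] (causal g) by exact: continuous_measurable_fun.
have bnd (t s : R) : t < T -> 0 < s -> `|k s * causal g (t - s)| <= k s * M.
  move=> tT s0; rewrite normrM (ger0_norm (k0 _ s0)) ler_wpM2l ?k0// cgM//.
  by rewrite (lt_trans _ tT)// ltrBlDr ltrDl.
have mkg t : measurable_fun `]0, T[ (fun s => k s * causal g (t - s)).
  apply: measurable_funTS; apply: measurable_funM => //.
  by apply: measurableT_comp => //; exact: measurable_funB.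
have h : {in `]- T, T[%classic,
    continuous (fun l => \int[mu]_(s in `]0, T[) (k s * causal g (l - s)))}.
  apply: (@continuity_under_integral _ _ _ mu (fun t s => k s * causal g (t - s))
    `]0, T[%classic (measurable_itv _) (- T) T _ _ (fun s => k s * M) ckT).
  - move=> t; rewrite /= in_itv /= => /andP[_ tT].
    apply: le_integrable ckT => //; first by apply/measurable_EFinP; exact: mkg.
    move=> s; rewrite /= in_itv /= => /andP[s0 _]; rewrite lee_fin.
    by rewrite (le_trans (bnd _ _ tT s0))// ler_norm.
  - apply: aeW => s _ t _; apply: cvgM; first exact: cvg_cst.
    apply: (continuous_comp (f := fun t : R => t - s) (g := causal g)) => //; last exact: ccg.
    by apply: cvgB; [exact: cvg_id|exact: cvg_cst].
  - move=> t; rewrite /= in_itv /= => /andP[_ tT]; apply: aeW => s.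
    by rewrite /= in_itv /= => /andP[s0 _]; exact: bnd.
have {}h := h x (mem_set xT).
have E y : y \in `]- T, T[ ->
    \int[mu]_(s in `]0, T[) (k s * causal g (y - s)) = cconv k g y.
  rewrite in_itv /= => /andP[yT Ty].
  rewrite Rintegral_mkcond; apply: eq_Rintegral => s _.
  rewrite patchE mem_setE in_itv /= {2}/causal.
  case: (ltP 0 s) => s0 /=; last by rewrite mul0r.
  case: (ltP s T) => // sT.
  by rewrite /causal subr_gt0 ltNge (le_trans (ltW Ty) sT)/= mulr0.
move: h; rewrite /continuous_at E//; apply: cvg_trans.
apply: near_eq_cvg; near=> y; apply: E.
by near: y; exact: near_in_itvoo.
Unshelve. all: by end_near. Qed.
End Kernel.

(** * Associativity of causal convolution *)

Section Assoc.
Context {R : realType}.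
Notation mu := (@lebesgue_measure R).
Implicit Types f g h k : R -> R.

Lemma econv_cont_fin k f (t : R) : lockernel k -> continuous f ->
  (forall s, 0 < s -> 0 <= f s) -> (econv k f t < +oo)%E.
Proof.
move=> kk cf f0; have [mk k0 _] := kk.
have /integrableP[_] := cconv_cont_integrable t kk cf.
apply: le_lt_trans; rewrite le_eqVlt; apply/orP; left; apply/eqP.
apply: eq_integral => s _ /=; rewrite ger0_norm// mulr_ge0// causal_ge0//.
Qed.

(** The nonnegative case is [econvA]; a signed h is the difference of |h| and |h| - h. *)
Lemma cconvA k1 k2 h (t : R) : lockernel k1 -> lockernel k2 ->
  (forall t, (econv k1 k2 t < +oo)%E) -> lockernel (cconv k1 k2) -> continuous h ->
  cconv k1 (cconv k2 h) t = cconv (cconv k1 k2) h t.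
Proof.
move=> kk1 kk2 fin kk12 ch.
have [mk1 k10 _] := kk1; have [mk2 k20 _] := kk2.
have H g : continuous g -> (forall s, 0 <= g s) ->
    cconv k1 (cconv k2 g) t = cconv (cconv k1 k2) g t.
  move=> cg g0; rewrite /cconv /Rintegral.
  rewrite -[X in fine X]/(econv k1 (cconv k2 g) t) -[X in _ = fine X]/(econv (cconv k1 k2) g t).
  rewrite econvA//; first exact: continuous_measurable_fun.
  by move=> t'; exact: econv_cont_fin.
pose p s := `|h s|; pose q s := `|h s| - h s.
have cp : continuous p by move=> x; apply: cvg_norm; exact: ch.
have cq : continuous q by move=> x; apply: cvgB; [exact: cp|exact: ch].
(* A signed function is a difference of two nonnegative continuous ones. *)
have -> : h = (fun s => p s - q s) by apply/funext => s; rewrite /q opprB addrC subrK.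
have q0 s : 0 <= q s by rewrite /q subr_ge0 ler_norm.
have p0 s : 0 <= p s by rewrite /p normr_ge0.
move: p q cp cq q0 p0 => p q cp cq q0 p0.
rewrite [RHS]cconvB//. rewrite -(H p)// -(H q)//.

rewrite -cconvB//; try exact: cconv_continuous.
by apply: eq_cconv => // s _; rewrite cconvB.
Qed.

Lemma cconvA_cont k g h (t : R) : lockernel k -> continuous g -> (forall s, 0 < s -> 0 <= g s) ->
  continuous h -> cconv k (cconv g h) t = cconv (cconv k g) h t.
Proof.
move=> kk cg g0 ch; apply: cconvA => //.
- exact: lockernel_cont.
- by move=> t'; exact: econv_cont_fin.
- apply: lockernel_cont; first exact: cconv_continuous.
  by move=> s s0; apply: cconv_ge0 => // x /andP[x0 _]; exact: g0.
Qed.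

Lemma lockernel1 : lockernel (fun _ : R => 1).
Proof. by apply: lockernel_cont; [exact: cst_continuous|move=> *; exact: ler01]. Qed.

(** Plain integration is the convolution with the constant 1, so it commutes with every other convolution. *)
Lemma cconv_intC k h (t : R) : lockernel k -> continuous h ->
  cconv k (cconv (fun=> 1) h) t = cconv (fun=> 1) (cconv k h) t.
Proof.
move=> kk ch; have [mk k0 _] := kk.
have cc : cconv k (fun=> 1) = cconv (fun=> 1) k.
  by apply/funext => s; rewrite cconvC.
have c1 : continuous (fun _ : R => 1 : R) by exact: cst_continuous.
rewrite cconvA_cont// cc [RHS]cconvA//; first exact: lockernel1.
- by move=> s; rewrite econvC//; exact: econv_cont_fin.
- rewrite -cc; apply: lockernel_cont; first exact: cconv_continuous.
  by move=> s s0; exact: cconv_ge0.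
Qed.

Lemma cconv1_itv f (t : R) : continuous f ->
  cconv (fun=> 1) f t = \int[mu]_(s in `]0, t[) f s.
Proof.
move=> cf; rewrite cconvC//; last exact: continuous_measurable_fun.
by rewrite cconvE; apply: eq_Rintegral => s _; rewrite mulr1.
Qed.

Lemma integrable_itv_cont f (a b : R) : continuous f -> mu.-integrable `[a, b] (EFin \o f).
Proof.
by move=> cf; apply: continuous_compact_integrable; [exact: segment_compact|exact: continuous_subspaceT].
Qed.

Lemma Rintegral_itv_oo_cc f (a b : R) : continuous f ->
  \int[mu]_(s in `]a, b[) f s = \int[mu]_(s in `[a, b]) f s.
Proof.
move=> cf; rewrite Rintegral_itv_obnd_cbnd.
  rewrite Rintegral_itv_bndo_bndc//; apply: integrableS (integrable_itv_cont a b cf) => //.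
  exact: subset_itv_co_cc.
by apply: integrableS (integrable_itv_cont a b cf) => //; exact: subset_itv_oo_cc.
Qed.

Lemma cconv1_derive f (t : R) : continuous f -> 0 < t ->
  derivable (cconv (fun=> 1) f) t 1 /\ derive1 (cconv (fun=> 1) f) t = f t.
Proof.
move=> cf t0.
have -> : cconv (fun=> 1) f = (fun x => \int[mu]_(s in `[0, x]) f s).
  by apply/funext => x; rewrite cconv1_itv// Rintegral_itv_oo_cc.
apply: (@continuous_FTC1_closed _ f 0 t (t + 1)) => //; first by rewrite ltrDl.
  exact: integrable_itv_cont.
exact: cf.
Qed.

End Assoc.

(** * Power kernels and the Beta constant *)

Section Power.
Context {R : realType}.
Notation mu := (@lebesgue_measure R).
Implicit Types (f g h k : R -> R) (a t : R).

Definition pker a (s : R) : R := s `^ (a - 1).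

Lemma pker_gt0 a s : 0 < s -> 0 < pker a s.
Proof. exact: powR_gt0. Qed.

Lemma measurable_pker a : measurable_fun [set: R] (pker a).
Proof. exact: measurable_powR. Qed.

Lemma powR_is_derive (a x : R) : 0 < x -> is_derive x 1 (fun y => y `^ a) (a * x `^ (a - 1)).
Proof.
move=> x0; have x0' : x \in `]0, +oo[ by rewrite in_itv /= x0.
have d := @derivable_powR R 1 a x x0'.
by split => //; rewrite -derive1E powR_derive1.
Qed.

Lemma powR_continuous (a x : R) : 0 < x -> {for x, continuous (fun y => y `^ a)}.
Proof.
move=> x0; apply: differentiable_continuous; apply/derivable1_diffP.
by have [] := powR_is_derive a x0.
Qed.

Lemma integral_pker_cc a (u v : R) : 0 < a -> 0 < u -> u < v ->
  (\int[mu]_(s in `[u, v]) (pker a s)%:E = (v `^ a / a - u `^ a / a)%:E)%E.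
Proof.
move=> a0 u0 uv.
have dF (x : R) : 0 < x -> is_derive x 1 (fun y => y `^ a / a) (pker a x).
  move=> x0; have -> : pker a x = a^-1 *: (a * x `^ (a - 1)).
    by rewrite /pker scalerAl /= -[_ *: _]/(_ * _) mulVf ?gt_eqF// mul1r.
  rewrite (_ : (fun y => y `^ a / a) = a^-1 \*: (fun y => y `^ a)); last first.
    by apply/funext => y; rewrite mulrC.
  by apply: is_deriveZ; exact: powR_is_derive.
have cF (x : R) : 0 < x -> {for x, continuous (fun y => y `^ a / a)}.
  move=> x0; apply: differentiable_continuous; apply/derivable1_diffP.
  by have [] := dF _ x0.
rewrite (@continuous_FTC2 _ _ (fun y => y `^ a / a))//.
- apply: continuous_in_subspaceT => x; rewrite mem_setE in_itv /= => /andP[ux _].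
  by apply: powR_continuous; exact: lt_le_trans ux.
- split.
  + move=> x; rewrite in_itv /= => /andP[ux _].
    by have [] := dF _ (lt_trans u0 ux).
  + by apply: cvg_at_right_filter; exact: cF.
  + by apply: cvg_at_left_filter; apply: cF; exact: lt_trans uv.
- move=> x; rewrite in_itv /= => /andP[ux _].
  by have [_] := dF _ (lt_trans u0 ux); rewrite derive1E.
Qed.

(** The kernel is singular at 0, so the value is the limit of the integrals over [T / (n + 2), T]. *)
Lemma integral_pker a (T : R) : 0 < a -> 0 < T ->
  (\int[mu]_(s in `]0%R, T[) (pker a s)%:E = (T `^ a / a)%:E)%E.
Proof.
move=> a0 T0.
pose F (i : nat) := `[T / i.+2%:R, T]%classic.
have UF : \bigcup_i F i = `]0, T]%classic.
  apply/seteqP; split => [x [i _]|x]; rewrite /F /= !in_itv /=.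
    move=> /andP[h ->]; rewrite andbT; apply: lt_le_trans h.
    by rewrite divr_gt0.
  move=> /andP[x0 xT]; exists (Num.truncn (T / x)) => //=.
  rewrite in_itv /= xT andbT ler_pdivrMr// mulrC -ler_pdivrMr//.
  by rewrite ltW// (lt_le_trans (truncnS_gt _))// ler_nat.
(* The index i + 2 keeps the lower bound strictly below T. *)
have cv0 : (T / i.+2%:R) `^ a @[i --> \oo] --> (0 : R).
  apply: cvg_comp (powR_cvg0 a0) => P /= [e /= e0 He].
  have : \forall i \near \oo, T / i.+2%:R < e.
    near=> i; rewrite ltr_pdivrMr// mulrC -ltr_pdivrMr//.
    apply: (@lt_le_trans _ _ i%:R); last by rewrite ler_nat leqW.
    by near: i; exact: nbhs_infty_gtr.
  apply: filterS => i ie; apply: He; last by rewrite divr_gt0.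
  by rewrite /ball_ /= sub0r normrN gtr0_norm ?divr_gt0.
have lim : (\int[mu]_(s in F i) (pker a s)%:E)%E @[i --> \oo] --> (T `^ a / a)%:E.
  rewrite (_ : (fun i => _) = (fun i => (T `^ a / a - (T / i.+2%:R) `^ a / a)%:E)); last first.
    apply/funext => i; rewrite integral_pker_cc// ?divr_gt0//.
    by rewrite ltr_pdivrMr// ltr_pMr// ltr1n.
  apply: cvg_EFin; first by near=> i.
  rewrite -[X in _ --> X]subr0; apply: cvgB; first exact: cvg_cst.
  by rewrite -[X in _ --> X](mul0r a^-1); apply: cvgM; [exact: cv0|exact: cvg_cst].
rewrite integral_itv_bndo_bndc; last first.
  by apply/measurable_EFinP; apply: measurable_funTS; exact: measurable_pker.
apply: (cvg_unique _ _ lim) => //; rewrite -UF.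
apply: ge0_nondecreasing_set_cvg_integral.
- move=> n m nm; rewrite subsetEset; apply: subset_itvr; rewrite bnd_simp.
  by rewrite ler_pM2l// lef_pV2 ?posrE// ler_nat ltnS ltnS.
- by move=> i; exact: measurable_itv.
- by move=> i; apply/measurable_EFinP; apply: measurable_funTS; exact: measurable_pker.
- by move=> i s _; rewrite lee_fin powR_ge0.
Unshelve. all: by end_near. Qed.

Lemma powR_div_surjective a (q : R) : 0 < a -> 0 < q -> exists2 e : R, 0 < e & e `^ a / a = q.
Proof.
move=> a0 q0; have aq0 : 0 < a * q by rewrite mulr_gt0.
exists ((a * q) `^ a^-1); first exact: powR_gt0.
rewrite -powRrM mulVf ?gt_eqF// powRr1 ?(ltW aq0)//.
by rewrite mulrC mulKf// gt_eqF.
Qed.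

Lemma lockernel_pker a : 0 < a -> lockernel (pker a).
Proof.
move=> a0; split; [exact: measurable_pker|by move=> s s0; exact/ltW/pker_gt0|].
move=> T; have [T0|T0] := ltP 0 T; first by rewrite integral_pker// ltry.
by rewrite set_itv_ge ?integral_set0// bnd_simp -leNgt.
Qed.

Lemma cconv_pker1 a t : 0 < a -> 0 < t -> cconv (pker a) (fun=> 1) t = t `^ a / a.
Proof. by move=> a0 t0; rewrite cconv1E /Rintegral integral_pker. Qed.

Lemma pker1 : pker 1 = fun=> 1.
Proof. by apply/funext => s; rewrite /pker subrr powRr0. Qed.

Lemma Rintegral_pker_itv a f t : 0 < a -> continuous f ->
  \int[mu]_(s in `[0, t]) ((t - s) `^ (a - 1) * f s) = cconv (pker a) f t.
Proof.
move=> a0 cf; rewrite cconvC; [|exact: measurable_pker|exact: continuous_measurable_fun].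
rewrite cconvE /Rintegral.
have mg : measurable_fun [set: R] (fun s => (t - s) `^ (a - 1) * f s).
  apply: measurable_funM; last exact: continuous_measurable_fun.
  by apply: (measurableT_comp (measurable_pker a)); exact: measurable_funB.
rewrite -integral_itv_obnd_cbnd; last first.
  by apply/measurable_EFinP; apply: measurable_funTS.
rewrite -integral_itv_bndo_bndc; last first.
  by apply/measurable_EFinP; apply: measurable_funTS.
by congr fine; apply: eq_integral => s _; rewrite mulrC.
Qed.

(** The Beta integral B(1 - a, a). *)
Definition beta_cst a : R := cconv (pker (1 - a)) (pker a) 1.

Lemma pker_half_le2 a (s : R) : 0 < a < 1 -> 1 / 2 <= s -> pker a s <= 2.
Proof.
move=> /andP[a0 a1] s2; 
have s0 : 0 < s by apply: lt_le_trans s2; rewrite divr_gt0.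
rewrite /pker -opprB powRN -[leRHS]invrK lef_pV2 ?posrE ?invr_gt0 ?powR_gt0//.
have h2 : (2^-1 : R) `^ 1 <= 2^-1 `^ (1 - a).
  by apply: ger_powR; [rewrite invr_gt0 ltr0n invf_le1 ?ler1n|rewrite gerBl ltW].
rewrite powRr1 ?invr_ge0// in h2; apply: (le_trans h2).
apply: ge0_ler_powR; rewrite ?nnegrE ?subr_ge0 ?(ltW s0) ?(ltW a1) ?invr_ge0//.
by move: s2; rewrite div1r.
Qed.

Lemma le1_pker_ge1 a (s : R) : a <= 1 -> 0 < s <= 1 -> 1 <= pker a s.
Proof.
move=> a1 s01; rewrite -[leLHS](powRr0 s); apply: ger_powR => //.
by rewrite subr_le0.
Qed.

Lemma causal_pker_scale a t x : 0 < t ->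
  causal (pker a) (t * x) = t `^ (a - 1) * causal (pker a) x.
Proof.
move=> t0; rewrite /causal pmulr_rgt0//; case: ifP => x0; last by rewrite mulr0.
by rewrite /pker powRM ?ltW.
Qed.

(** Each factor is at most 2 away from its own singularity, so the product is at most twice the sum of the factors. *)
Lemma econv_pker1_fin a : 0 < a < 1 -> (econv (pker (1 - a)) (pker a) 1 < +oo)%E.
Proof.
move=> a01; have /andP[a0 a1] := a01.
have b01 : 0 < 1 - a < 1 by rewrite subr_gt0 a1 gtrBl.
have ka := lockernel_pker a0; have kb : lockernel (pker (1 - a)).
  by apply: lockernel_pker; case/andP: b01.
have c1 : continuous (fun _ : R => 1 : R) by exact: cst_continuous.
have m1 : measurable_fun [set: R] (fun _ : R => 1 : R) by exact: measurable_cst.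
have ma := measurable_pker a; have mb := measurable_pker (1 - a).
have A0 b s : 0 < s -> 0 <= pker b s by move=> s0; exact/ltW/pker_gt0.
apply: (@le_lt_trans _ _ (\int[mu]_s
   (2%:E * (causal (pker (1 - a)) s * causal (fun=> 1) (1 - s))%:E +
    2%:E * (causal (fun=> 1) s * causal (pker a) (1 - s))%:E))%E).
  apply: ge0_le_integral => //.
  - by move=> s _; rewrite lee_fin mulr_ge0 ?causal_ge0//; exact: A0.
  - by apply/measurable_EFinP; exact: measurable_cconv_integrand.
  - apply: emeasurable_funD; apply: measurable_funeM;
      by apply/measurable_EFinP; exact: measurable_cconv_integrand.
  - move=> s _; rewrite -!EFinM -EFinD lee_fin /causal.
    case: ltP => s0; last by rewrite !mul0r !mulr0 addr0.
    rewrite subr_gt0; case: ltP => s1; last by rewrite !mulr0 addr0.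
    rewrite mulr1 mul1r; have [h|h] := leP (1 / 2) s.
    - have := pker_half_le2 b01 h; have p1 := A0 a (1 - s) _.
      rewrite subr_gt0 in p1; have p2 := A0 (1 - a) _ s0.
      move=> p3; apply: ler_wpDl; first by rewrite mulr_ge0.
      by rewrite ler_wpM2r// p1.
    - have h' : 1 / 2 <= 1 - s by lra.
      have := pker_half_le2 a01 h'; have p1 := A0 a (1 - s) _.
      rewrite subr_gt0 in p1; have p2 := A0 (1 - a) _ s0.
      move=> p3; apply: ler_wpDr; first by rewrite mulr_ge0// p1.
      by rewrite mulrC ler_wpM2r.
rewrite ge0_integralD//; last 4 first.
- by move=> s _; rewrite -EFinM lee_fin !mulr_ge0 ?causal_ge0//; exact: A0.
- by apply: measurable_funeM; apply/measurable_EFinP; exact: measurable_cconv_integrand.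
- by move=> s _; rewrite -EFinM lee_fin !mulr_ge0 ?causal_ge0//; exact: A0.
- by apply: measurable_funeM; apply/measurable_EFinP; exact: measurable_cconv_integrand.
rewrite ge0_integralZl//; last 2 first.
- by apply/measurable_EFinP; exact: measurable_cconv_integrand.
- by move=> s _; rewrite lee_fin mulr_ge0 ?causal_ge0//; exact: A0.
rewrite ge0_integralZl//; last 2 first.
- by apply/measurable_EFinP; exact: measurable_cconv_integrand.
- by move=> s _; rewrite lee_fin mulr_ge0 ?causal_ge0//; exact: A0.
rewrite -/(econv (pker (1 - a)) (fun=> 1) 1) -/(econv (fun=> 1) (pker a) 1).
rewrite [econv (fun=> 1) _ _]econvC//.
apply: lte_add_pinfty; apply: lte_mul_pinfty => //; first exact: econv_cont_fin.
exact: econv_cont_fin.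
Qed.

(** The exponents of the two kernels add up to -1, which makes the convolution invariant under scaling, hence constant on ]0, +oo[. *)
Lemma econv_pker a t : 0 < a < 1 ->
  econv (pker (1 - a)) (pker a) t = (causal (fun=> beta_cst a) t)%:E.
Proof.
move=> a01; have /andP[a0 a1] := a01.
have A0 b s : 0 < s -> 0 <= pker b s by move=> s0; exact/ltW/pker_gt0.
have ma := measurable_pker a; have mb := measurable_pker (1 - a).
rewrite [in RHS]/causal; case: ifPn => [t0|]; last first.
  rewrite -leNgt => t0; rewrite /econv integral0_eq// => s _.
  rewrite /causal; case: ltP => s0; last by rewrite mul0r.
  by rewrite subr_gt0 ltNge (le_trans t0 (ltW s0)) mulr0.
rewrite /beta_cst (EFin_cconv (A0 _) (A0 _) (econv_pker1_fin a01)).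
rewrite /econv (ge0_integral_affine 0 t0)//; last 2 first.
- by apply/measurable_EFinP; exact: measurable_cconv_integrand.
- by move=> s; rewrite lee_fin mulr_ge0 ?causal_ge0//; exact: A0.
rewrite -ge0_integralZl//; last 3 first.
- apply/measurable_EFinP.
  apply: (measurableT_comp (measurable_cconv_integrand t mb ma)); exact: measurable_affine.
- by move=> s _; rewrite lee_fin mulr_ge0 ?causal_ge0//; exact: A0.
- by rewrite lee_fin ltW.
apply: eq_integral => s _; rewrite -EFinM addr0 -{3}[t]mulr1 -mulrBr !causal_pker_scale//.
congr EFin; rewrite mulrACA (mulrA t) -[RHS]mul1r; congr (_ * _).
rewrite -powRD; last by rewrite (gt_eqF t0) implybT.
rewrite (_ : 1 - a - 1 + (a - 1) = -1) ?powR_inv1 ?ltW// ?divff ?gt_eqF//; lra.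
Qed.

Lemma beta_cst_gt0 a : 0 < a < 1 -> 0 < beta_cst a.
Proof.
move=> a01; have /andP[a0 a1] := a01.
have A0 b s : 0 < s -> 0 <= pker b s by move=> s0; exact/ltW/pker_gt0.
apply: lt_le_trans ltr01 _.
rewrite /beta_cst -lee_fin (EFin_cconv (A0 _) (A0 _) (econv_pker1_fin a01)).
rewrite (_ : 1%:E = \int[mu]_s (causal (fun=> 1) s * causal (fun=> 1) (1 - s) : R)%:E)%E.
  apply: ge0_le_integral => //.
  - by move=> s _; rewrite lee_fin mulr_ge0 ?causal_ge0.
  - by apply/measurable_EFinP; apply: measurable_cconv_integrand; exact: measurable_cst.
  - by apply/measurable_EFinP; apply: measurable_cconv_integrand; exact: measurable_pker.
  - move=> s _; rewrite lee_fin /causal subr_gt0.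
    case: ltP => s0; last by rewrite !mul0r.
    case: ltP => s1; last by rewrite !mulr0.
    by rewrite ler_pM ?le1_pker_ge1 ?s0 ?(ltW s1) ?subr_gt0 ?s1 ?gerBl ?(ltW s0) ?(ltW a0) ?(ltW a1).
have h : cconv (fun=> 1) (fun=> 1) 1 = 1 :> R.
  by have := @cconv_pker1 1 1 ltr01 ltr01; rewrite pker1 powR1 divr1.
transitivity ((cconv (fun=> 1) (fun=> 1) 1 : R)%:E); first by rewrite h.
rewrite EFin_cconv//; apply: econv_cont_fin => //; first exact: lockernel1.
exact: cst_continuous.
Qed.

(** Associativity reduces the composition of the two fractional integrals to the constant kernel of [econv_pker]. *)
Lemma cconv_pkerK a f t : 0 < a < 1 -> continuous f ->
  cconv (pker (1 - a)) (cconv (pker a) f) t = beta_cst a * cconv (fun=> 1) f t.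
Proof.
move=> a01 cf; have /andP[a0 a1] := a01.
have A0 b s : 0 < s -> 0 <= pker b s by move=> s0; exact/ltW/pker_gt0.
have E : cconv (pker (1 - a)) (pker a) = causal (fun=> beta_cst a).
  by apply/funext => s; rewrite /cconv /Rintegral -/(econv _ _ s) econv_pker.
have lc : lockernel (causal (fun=> beta_cst a)).
  split; first by apply: measurable_causal; exact: measurable_cst.
    by move=> s s0; apply: causal_ge0 => *; exact/ltW/beta_cst_gt0.
  move=> T; have := @lockernel_cont R (fun=> beta_cst a) (@cst_continuous _ _ _).
  case=> [|_ _ /(_ T)]; first by move=> *; exact/ltW/beta_cst_gt0.
  congr (_ < _)%E; apply: eq_integral => s.
  by rewrite mem_setE in_itv /= /causal => /andP[->].
rewrite cconvA//; last 4 first.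
- by apply: lockernel_pker; rewrite subr_gt0.
- exact: lockernel_pker.
- by move=> s; rewrite econv_pker// ltry.
- by rewrite E.
rewrite E [LHS](_ : _ = cconv (fun=> beta_cst a) f t); last first.
  by apply: eq_cconv => // s /andP[s0 _]; rewrite /causal s0.
rewrite [LHS]cconvC; [|exact: measurable_cst|exact: continuous_measurable_fun].
rewrite [in RHS]cconvC; [|exact: measurable_cst|exact: continuous_measurable_fun].
have e : \int[mu]_(s in `]0, t[) (f s * 1) = \int[mu]_(s in `]0, t[) f s.
  by apply: eq_Rintegral => s _; rewrite mulr1.
rewrite !cconvE e -RintegralZl//.
  by apply: eq_Rintegral => s _; rewrite mulrC.
by apply: integrableS (integrable_itv_cont 0 t cf) => //; exact: subset_itv_oo_cc.
Qed.

End Power.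

(** * The Gamma integral and exponential weights *)

Section Caputo.
Context {R : realType}.
Notation mu := (@lebesgue_measure R).
Implicit Types (f g h k : R -> R) (a t : R).

Lemma pker_le1 a s : a <= 1 -> 1 <= s -> pker a s <= 1.
Proof.
move=> a1 s1; rewrite -[leRHS](powRr0 s); apply: ler_powR => //.
by rewrite subr_le0.
Qed.

Lemma measurable_expRN : measurable_fun [set: R] (fun s : R => expR (- s)).
Proof. by apply: measurableT_comp => //; exact: oppr_measurable. Qed.

Lemma integral_expRN_fin : (\int[mu]_(s in `]0%R, +oo[) (expR (- s))%:E < +oo)%E.
Proof.
have := @integral_exponential_pdf R 1 ltr01.
move=> h; have : (\int[mu]_x (exponential_pdf 1 x)%:E < +oo :> \bar R)%E by rewrite h ltry.
apply: le_lt_trans.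
apply: (@le_trans _ _ (\int[mu]_(s in `]0%R, +oo[) (exponential_pdf 1 s)%:E)%E).
  rewrite le_eqVlt; apply/orP; left; apply/eqP; apply: eq_integral => s.
  rewrite mem_setE in_itv /= andbT => s0.
  by rewrite /exponential_pdf patchE mem_setE in_itv /= andbT (ltW s0) mul1r mulN1r.
apply: ge0_subset_integral => //.
  by apply/measurable_EFinP; exact: measurable_exponential_pdf.
by move=> s _; rewrite lee_fin exponential_pdf_ge0.
Qed.

(** The integrand is at most s^(a - 1) before 1 and at most e^(-s) after 1, and it is at least e^(-1) on ]0, 1[. *)
Lemma Gamma_gt0 a : 0 < a <= 1 -> 0 < Gamma a.
Proof.
move=> /andP[a0 a1]; rewrite /Gamma /Rintegral.
have c1 : continuous (fun _ : R => 1 : R) by exact: cst_continuous.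
have mk : measurable_fun [set: R] (fun s : R => s `^ (a - 1) * expR (- s)).
  by apply: measurable_funM; [exact: measurable_pker|exact: measurable_expRN].
have k0 s : 0 < s -> 0 <= s `^ (a - 1) * expR (- s).
  by move=> s0; rewrite mulr_ge0 ?powR_ge0 ?expR_ge0.
have mc : measurable_fun [set: R] (fun s => causal (pker a) s * causal (fun=> 1) (1 - s)).
  by apply: measurable_cconv_integrand; [exact: measurable_pker|exact: measurable_cst].
have c0 s : 0 <= causal (pker a) s * causal (fun=> 1) (1 - s).
  by rewrite mulr_ge0 ?causal_ge0// => y y0; exact/ltW/pker_gt0.
have fin : (\int[mu]_(s in `]0%R, +oo[) (s `^ (a - 1) * expR (- s))%:E < +oo)%E.
  apply: (@le_lt_trans _ _ (\int[mu]_(s in `]0%R, +oo[)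
    ((causal (pker a) s * causal (fun=> 1) (1 - s))%:E + (expR (- s))%:E))%E).
    apply: ge0_le_integral => //.
    - by move=> s /=; rewrite in_itv /= andbT => /k0; rewrite lee_fin.
    - by apply/measurable_EFinP; exact: measurable_funTS.
    - apply: emeasurable_funD; apply/measurable_EFinP; apply: measurable_funTS => //.
      exact: measurable_expRN.
    - move=> s /=; rewrite in_itv /= andbT => s0; rewrite -EFinD lee_fin.
      rewrite /causal s0 subr_gt0; case: ltP => s1.
        rewrite mulr1; apply: ler_wpDr; first exact: expR_ge0.
        rewrite ler_piMr ?powR_ge0// -expR0 ler_expR oppr_le0 ltW//.
      by rewrite mulr0 add0r ler_piMl ?expR_ge0//; exact: pker_le1.
  rewrite ge0_integralD//; last 3 first.
  - by move=> s _; rewrite lee_fin.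
  - by apply/measurable_EFinP; exact: measurable_funTS.
  - by apply/measurable_EFinP; apply: measurable_funTS; exact: measurable_expRN.
  apply: lte_add_pinfty; last exact: integral_expRN_fin.
  apply: (@le_lt_trans _ _ (econv (pker a) (fun=> 1) 1)).
    apply: ge0_subset_integral => //; first by apply/measurable_EFinP.
    by move=> s _; rewrite lee_fin.
  by apply: econv_cont_fin => //; exact: lockernel_pker.
apply: fine_gt0; rewrite fin andbT.
apply: (@lt_le_trans _ _ (\int[mu]_(s in `]0%R, 1%R[) (expR (- 1))%:E)%E).
  by rewrite integral_cst//= lebesgue_measure_itv /= lte_fin ltr01 -EFinB subr0 mule1 lte_fin expR_gt0.
apply: (@le_trans _ _ (\int[mu]_(s in `]0%R, 1%R[) (s `^ (a - 1) * expR (- s))%:E)%E).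
  apply: ge0_le_integral => //.
  - by apply/measurable_EFinP; exact: measurable_funTS.
  - move=> s /=; rewrite in_itv /= => /andP[s0 s1]; rewrite lee_fin -[leLHS]mul1r.
    rewrite ler_pM ?expR_ge0//; last by rewrite ler_expR lerN2 ltW.
    by apply: le1_pker_ge1 => //; rewrite s0 ltW.
apply: ge0_subset_integral => //.
- by apply/measurable_EFinP; exact: measurable_funTS.
- by move=> s /=; rewrite in_itv /= andbT lee_fin => /k0.
- by move=> s /=; rewrite !in_itv /= => /andP[->].
Qed.

Lemma expRM_continuous (b : R) : continuous (fun s : R => expR (b * s)).
Proof.
move=> x; apply: (continuous_comp (f := fun s : R => b * s)); last exact: continuous_expR.
by apply: cvgM; [exact: cvg_cst|exact: cvg_id].
Qed.

Lemma cconv1_expR_le (b t : R) : 0 < b -> cconv (fun=> 1) (fun s => expR (b * s)) t <= expR (b * t) / b.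
Proof.
move=> b0; have [t0|t0] := leP t 0.
  by rewrite cconv_le0// divr_ge0 ?expR_ge0// ltW.
have cE := @expRM_continuous b.
rewrite cconv1_itv// Rintegral_itv_oo_cc// /Rintegral.
have dF (x : R) : is_derive x 1 (fun y => expR (b * y) / b) (expR (b * x)).
  have -> : expR (b * x) = b^-1 *: ((b : R) *: expR (b * x)).
    by rewrite scalerA mulVf ?gt_eqF// scale1r.
  rewrite (_ : (fun y => expR (b * y) / b) = b^-1 \*: (fun y => expR (b * y))); last first.
    by apply/funext => y; rewrite mulrC.
  apply: is_deriveZ.
  have h1 : is_derive x 1 (fun y : R => b * y) b.
    apply: is_derive_eq. by rewrite -[_%:A]/(_ * _) mulr1.
  by have := @is_derive1_comp R expR (fun y => b * y) x _ _ (is_derive_expR _) h1; rewrite mulrC.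
rewrite (@continuous_FTC2 _ _ (fun y => expR (b * y) / b))//=.
- by rewrite gerBl// divr_ge0 ?expR_ge0// ltW.
- exact: continuous_subspaceT.
- have cF : continuous (fun y => expR (b * y) / b).
    by move=> x; apply: cvgM; [exact: cE|exact: cvg_cst].
  split; first by move=> x _; have [] := dF x.
  + by apply: cvg_at_right_filter; exact: cF.
  + by apply: cvg_at_left_filter; exact: cF.
- by move=> x _; rewrite derive1E; have [_] := dF x.
Qed.

(** This makes the Volterra operators contractions for a large exponential weight. The mass of the kernel on ]0, e] is small with e; beyond e the kernel is bounded and integrating the exponential gains a factor 1 / b. *)
Lemma cconv_expR_small a (q : R) : 0 < a <= 1 -> 0 < q ->
  exists2 b0 : R, 0 < b0 & forall b, b0 <= b -> forall t,
    cconv (pker a) (fun s => expR (b * s)) t <= q * expR (b * t).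
Proof.
move=> /andP[a0 a1] q0.
have [e e0 ea] := powR_div_surjective a0 (divr_gt0 q0 (ltr0n _ 2)).
have pe0 : 0 < pker a e by exact: pker_gt0.
have p20 : 0 < pker a e * (2 / q) by apply: mulr_gt0 => //; exact: divr_gt0.
exists (pker a e * (2 / q)) => //.
move=> b hb t.
have b0 : 0 < b by exact: lt_le_trans hb.
have cE := @expRM_continuous b.
have ka := lockernel_pker a0.
have c1 : continuous (fun _ : R => 1 : R) by exact: cst_continuous.
have mE := continuous_measurable_fun cE.
have i1 := cconv_cont_integrable e ka c1.
have i2 := cconv_cont_integrable t lockernel1 cE.
apply: (@le_trans _ _ (expR (b * t) * cconv (pker a) (fun=> 1) e +
   pker a e * cconv (fun=> 1) (fun s => expR (b * s)) t)).
  rewrite /cconv -RintegralZl// -RintegralZl// -RintegralD//; last 2 first.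
  - exact: (integrableZl measurableT (expR (b * t)) i1).
  - exact: (integrableZl measurableT (pker a e) i2).
  apply: le_Rintegral => //.
  - exact: cconv_cont_integrable.
  - have := integrableD measurableT (integrableZl measurableT (expR (b * t)) i1)
      (integrableZl measurableT (pker a e) i2).
    by [].
  move=> s _; rewrite /causal; case: ltP => s0; last by rewrite !mul0r !mulr0 addr0.
  rewrite !subr_gt0 mul1r.
  case: (ltP s t) => st; last first.
    by rewrite !mulr0 addr0 mulr_ge0 ?expR_ge0//; case: ifP; rewrite ?mulr0 ?mulr1 ?powR_ge0.
  case: ltP => se.
    rewrite mulr1; apply: ler_wpDr; first by rewrite mulr_ge0 ?expR_ge0 ?powR_ge0.
    rewrite mulrC ler_wpM2r ?powR_ge0// ler_expR ler_pM2l// gerBl ltW//.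
  rewrite mulr0 mulr0 add0r ler_wpM2r ?expR_ge0//.
  rewrite /pker -!(opprB 1 a) !powRN lef_pV2 ?posrE ?powR_gt0//.
  by apply: ge0_ler_powR; rewrite ?nnegrE ?subr_ge0 ?(ltW e0) ?(ltW s0).
rewrite (cconv_pker1 a0 e0) ea.
have h : pker a e / b <= q / 2.
  rewrite ler_pdivrMr// mulrC -ler_pdivrMr ?divr_gt0//.
  by rewrite invf_div.
rewrite [leRHS](_ : _ = expR (b * t) * (q / 2) + expR (b * t) * (q / 2)); last by field.
rewrite lerD2l; apply: (@le_trans _ _ (pker a e * (expR (b * t) / b))).
  by rewrite ler_wpM2l ?powR_ge0// cconv1_expR_le.
by rewrite mulrCA ler_wpM2l ?expR_ge0.
Qed.

End Caputo.

(** * Caputo equations as Volterra equations *)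

Section Caputo2.
Context {R : realType}.
Notation mu := (@lebesgue_measure R).
Implicit Types (f g h k : R -> R) (a t : R).

(** The coefficient of the Volterra equation equivalent to a Caputo equation of order a. By the reflection formula it is 1 / Gamma a; this form is the one that makes [caputo_volterra] follow from [cconv_pkerK] alone. *)
Definition kappa a : R := if a == 1 then 1 else Gamma (1 - a) / beta_cst a.

Lemma kappa_gt0 a : 0 < a <= 1 -> 0 < kappa a.
Proof.
move=> /andP[a0 a1]; rewrite /kappa; case: eqP => // /eqP an1.
have {}a1 : a < 1 by rewrite lt_neqAle an1.
by rewrite divr_gt0// ?beta_cst_gt0 ?a0// Gamma_gt0// subr_gt0 a1 gerBl ltW.
Qed.

Lemma caputo_primitive1 (x : R -> R) : caputo_primitive 1 x = fun t => x t - x 0.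
Proof. by apply/funext => t; rewrite /caputo_primitive /frac_int subrr eqxx. Qed.

Lemma caputo_primitive_lt1 a (x : R -> R) : 0 < a < 1 -> continuous x ->
  caputo_primitive a x =
  fun t => (Gamma (1 - a))^-1 * cconv (pker (1 - a)) (fun s => x s - x 0) t.
Proof.
move=> /andP[a0 a1] cx; apply/funext => t.
rewrite /caputo_primitive /frac_int subr_eq0 gt_eqF// Rintegral_pker_itv//.
  by rewrite subr_gt0.
by move=> y; apply: cvgB; [exact: cx|exact: cvg_cst].
Qed.

Lemma constant_of_derive0 g t : 0 <= t -> continuous g ->
  (forall s : R, 0 < s -> is_derive s 1 g 0) -> g t = g 0.
Proof.
rewrite le_eqVlt => /predU1P[<-//|t0] cg dg.
have [||c _ /eqP] := @MVT R g (fun=> 0) 0 t t0.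
- by move=> s; rewrite in_itv /= => /andP[s0 _]; exact: dg.
- exact: continuous_subspaceT.
- by rewrite mul0r subr_eq0 => /eqP.
Qed.

Lemma is_derive_cconv1 f t : continuous f -> 0 < t -> is_derive t 1 (cconv (fun=> 1) f) (f t).
Proof.
move=> cf t0; have [d e] := cconv1_derive cf t0.
by apply: DeriveDef; [exact: d|rewrite -derive1E; exact: e].
Qed.

Lemma continuous_cmul f (c : R) : continuous f -> continuous (fun s => c * f s).
Proof. by move=> cf x; apply: cvgM; [exact: cvg_cst|exact: cf]. Qed.

(** Differentiating the two primitives recovers the functions on ]0, +oo[; the value at 0 is a separate assumption. *)
Lemma primitive_injective f g : continuous f -> continuous g -> f 0 = g 0 ->
  (forall t, 0 <= t -> cconv (fun=> 1) f t = cconv (fun=> 1) g t) ->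
  forall t, 0 <= t -> f t = g t.
Proof.
move=> cf cg fg0 fg t; rewrite le_eqVlt => /predU1P[<-//|t0].
have [df <-] := cconv1_derive cf t0; have [dg <-] := cconv1_derive cg t0.
rewrite !derive1E; apply: near_eq_derive.
near=> s; apply/fg/ltW; near: s; exact: lt_nbhsr.
Unshelve. all: by end_near. Qed.

(** Applying the integral of order 1 - a to the Volterra equation gives the Caputo primitive as a plain integral of f, by [cconv_pkerK]. Conversely that integral of order 1 - a is injective, because composing it with the integral of order a yields plain integration. *)
Lemma caputo_volterra a (x f : R -> R) : 0 < a <= 1 -> continuous x -> continuous f ->
  (forall t, 0 <= t -> x t = x 0 + kappa a * cconv (pker a) f t) <->
  (forall t, 0 < t -> caputo_derivable a x t /\ caputo a x t = f t).
Proof.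
move=> a01 cx cf; have /andP[a0 a1] := a01.
have ka := kappa_gt0 a01.
have cx0 : continuous (fun s => x s - x 0).
  by move=> y; apply: cvgB; [exact: cx|exact: cvg_cst].
have kera := lockernel_pker a0.
have cV : continuous (cconv (pker a) f) by exact: cconv_continuous.
have cJ : continuous (cconv (fun=> 1) f) by apply: cconv_continuous => //; exact: lockernel1.
(* The right-hand side says that the primitive is the integral of f. *)
have S1 : (forall t, 0 <= t -> caputo_primitive a x t = cconv (fun=> 1) f t) <->
    (forall t, 0 < t -> caputo_derivable a x t /\ caputo a x t = f t).
  split=> H.
    move=> t t0.
    have ne : {near t, cconv (fun=> 1) f =1 caputo_primitive a x}.
      near=> s; rewrite H//; apply/ltW; near: s; exact: lt_nbhsr.
    have [d e] := cconv1_derive cf t0; split.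
      exact: near_eq_derivable ne d.
    rewrite /caputo -e !derive1E; apply/esym; exact: near_eq_derive.
  have P0 : caputo_primitive a x 0 = 0.
    move: a1; rewrite le_eqVlt => /predU1P[->|a1].
      by rewrite caputo_primitive1 subrr.
    by rewrite caputo_primitive_lt1 ?a0// cconv_le0// mulr0.
  have cP : continuous (caputo_primitive a x).
    move: a1; rewrite le_eqVlt => /predU1P[->|a1].
      by rewrite caputo_primitive1.
    rewrite caputo_primitive_lt1 ?a0//; apply: continuous_cmul.
    by apply: cconv_continuous cx0; apply: lockernel_pker; rewrite subr_gt0.
  move=> t t0; apply/eqP; rewrite -subr_eq0; apply/eqP.
  pose g s := caputo_primitive a x s - cconv (fun=> 1) f s.
  have -> : 0 = g 0 by rewrite /g P0 cconv_le0// subrr.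
  apply: (@constant_of_derive0 g) => // [|s s0].
    by move=> y; apply: cvgB; [exact: cP|exact: cJ].
  have [d e] := H s s0.
  have dP : is_derive s 1 (caputo_primitive a x) (f s).
    by apply: DeriveDef; [exact: d|rewrite -derive1E; exact: e].
  rewrite -(subrr (f s)); apply: is_deriveB; exact: is_derive_cconv1.
apply: iff_trans S1; move: a1; rewrite le_eqVlt => /predU1P[a1|a1].
  rewrite a1 /kappa eqxx pker1 caputo_primitive1.
  by split=> H t /H e; [rewrite e mul1r addrC addKr|rewrite mul1r -e addrC subrK].
have a01' : 0 < a < 1 by rewrite a0 a1.
have b0 := beta_cst_gt0 a01'.
have G0 : 0 < Gamma (1 - a) by apply: Gamma_gt0; rewrite subr_gt0 a1 gerBl ltW.
have kE : kappa a = Gamma (1 - a) / beta_cst a by rewrite /kappa lt_eqF.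
have VE t : cconv (pker (1 - a)) (fun s => kappa a * cconv (pker a) f s) t =
    Gamma (1 - a) * cconv (fun=> 1) f t.
  have kb : lockernel (pker (1 - a)) by apply: lockernel_pker; rewrite subr_gt0.
  rewrite (cconvZ (kappa a) t kb cV).
  by rewrite cconv_pkerK// kE mulrA divfK// gt_eqF.
rewrite caputo_primitive_lt1//; split=> H t t0.
  rewrite (_ : cconv (pker (1 - a)) _ t = Gamma (1 - a) * cconv (fun=> 1) f t).
    by rewrite mulKf// gt_eqF.
  rewrite -VE; apply: eq_cconv => // s /andP[s0 _].
  by rewrite H ?(ltW s0)// addrC addKr.
suff h s : 0 <= s -> x s - x 0 = kappa a * cconv (pker a) f s.
  by rewrite -h// addrC subrK.
have a01'' : 0 < 1 - a < 1 by rewrite subr_gt0 a1 gtrBl.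
have b1 := beta_cst_gt0 a01''.
apply: (@primitive_injective (fun s => x s - x 0) (fun s => kappa a * cconv (pker a) f s)) => //.
- exact: continuous_cmul.
- by rewrite subrr cconv_le0// mulr0.
move=> y y0.
apply: (mulfI (lt0r_neq0 b1)).
have ckV := @continuous_cmul _ (kappa a) cV.
rewrite -(cconv_pkerK y a01'' cx0) -(cconv_pkerK y a01'' ckV).
rewrite (_ : 1 - (1 - a) = a); last by rewrite opprB addrC subrK.
apply: eq_cconv => // z /andP[/ltW z0 _].
by rewrite VE -H// mulVKf// gt_eqF.
Unshelve. all: by end_near. Qed.

End Caputo2.

(** * Fixed points in weighted spaces *)

Section Picard.
Context {R : realType}.

Lemma geometric_cvg (u : nat -> R) (C q : R) : 0 <= q < 1 ->
  (forall n, `|u n.+1 - u n| <= C * q ^+ n) ->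
  exists l : R, forall n, `|l - u n| <= C / (1 - q) * q ^+ n.
Proof.
move=> /andP[q0 q1] uC.
have C0 : 0 <= C by have := uC 0%N; rewrite expr0 mulr1; apply: le_trans.
have q1' : 0 < 1 - q by rewrite subr_gt0.
have B n k : `|u (n + k)%N - u n| <= C / (1 - q) * q ^+ n * (1 - q ^+ k).
  elim: k => [|k IH]; first by rewrite addn0 subrr normr0 expr0 subrr mulr0.
  rewrite (_ : u (n + k.+1)%N - u n = (u (n + k).+1 - u (n + k)%N) + (u (n + k)%N - u n)).
    apply: le_trans (ler_normD _ _) _; apply: le_trans (lerD (uC _) IH) _.
    rewrite le_eqVlt; apply/orP; left; apply/eqP; rewrite exprD exprS.
    by field; rewrite gt_eqF.
  by rewrite addnS addrA subrK.
have B' n m : (n <= m)%N -> `|u m - u n| <= C / (1 - q) * q ^+ n.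
  move=> nm; rewrite -(subnKC nm); apply: le_trans (B _ _) _.
  by rewrite ler_piMr ?mulr_ge0 ?invr_ge0 ?exprn_ge0 ?(ltW q1')// gerBl exprn_ge0.
have qn : C / (1 - q) * q ^+ n @[n --> \oo] --> (0 : R).
  rewrite -[X in _ --> X](mulr0 (C / (1 - q))); apply: cvgM; first exact: cvg_cst.
  by apply: cvg_expr; rewrite ger0_norm.
have uc : cvgn u.
  apply/cauchy_cvgP; apply: cauchy_exP => e e0.
  have /cvgrPdist_lt /(_ e e0)[N _ HN] := qn.
  exists (u N); exists N => // m Nm; rewrite /ball /= distrC.
  apply: le_lt_trans (B' _ _ Nm) _.
  have := HN N (leqnn N); rewrite /= sub0r normrN ger0_norm//.
  by rewrite mulr_ge0 ?divr_ge0 ?exprn_ge0// ltW.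
exists (limn u) => n.
have h : `|u m - u n| @[m --> \oo] --> `|limn u - u n|.
  by apply: cvg_norm; apply: cvgB; [exact: uc|exact: cvg_cst].
rewrite -(cvg_lim _ h)//; apply: limr_le; first by apply/cvg_ex; eexists; exact: h.
by exists n => // m nm; exact: B'.
Qed.

(** The values for t <= 0 are pinned to 0 so that delayed arguments reaching below 0 are harmless. *)
Definition causal_family (I : Type) (X : I -> R -> R) :=
  forall i, continuous (X i) /\ forall t, t <= 0 -> X i t = 0.

(** Banach's fixed point theorem for the norm sup |X i t| / W i t. The weights may differ between components, which is what allows the algebraic components to contract although they contain no integration. *)
Lemma picard (I : Type) (T : (I -> R -> R) -> I -> R -> R) (W : I -> R -> R) (q M : R) :
  0 <= q < 1 -> (forall i, continuous (W i)) -> (forall i t, 0 < W i t) ->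
  (forall X, causal_family X -> causal_family (T X)) ->
  (forall i t, `|T (fun _ _ => 0) i t| <= M * W i t) ->
  (forall X Y (e : R), causal_family X -> causal_family Y -> (forall i t, `|X i t - Y i t| <= e * W i t) ->
     forall i t, `|T X i t - T Y i t| <= q * e * W i t) ->
  exists2 X, causal_family X & forall i t, X i t = T X i t.
Proof.
move=> q01 cW W0 gT T0 TL; have /andP[q0 q1] := q01.
pose Xn n := iter n T (fun _ _ => 0).
have gX n : causal_family (Xn n).
  elim: n => [|n IH]; last exact: gT.
  by move=> i; split => //; exact: cst_continuous.
have dX n i t : `|Xn n.+1 i t - Xn n i t| <= (M * q ^+ n) * W i t.
  elim: n i t => [|n IH] i t; first by rewrite /Xn /= subr0 expr0 mulr1.
  by rewrite exprS mulrCA; exact: (TL (Xn n.+1) (Xn n)).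
have [X XP] : exists X, forall i t n, `|X i t - Xn n i t| <= M * W i t / (1 - q) * q ^+ n.
  have H i t : exists l : R, forall n, `|l - Xn n i t| <= M * W i t / (1 - q) * q ^+ n.
    by apply: geometric_cvg => // n; apply: le_trans (dX n i t) _; rewrite mulrAC.
  exists (fun i t => sval (cid (H i t))) => i t n.
  by case: cid => l /= /(_ n).
have M0 : forall i t, 0 <= M * W i t / (1 - q).
  move=> i t; by have := XP i t 0%N; rewrite expr0 mulr1; apply: le_trans; exact: normr_ge0.
have qn : (q ^+ n) @[n --> \oo] --> (0 : R) by apply: cvg_expr; rewrite ger0_norm.
have small (e : R) : 0 < e -> exists n, q ^+ n < e.
  move=> e0; have /cvgrPdist_lt /(_ e e0)[N _ HN] := qn.
  exists N; have := HN N (leqnn N).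
  by rewrite /= sub0r normrN ger0_norm// exprn_ge0.
have gXX : causal_family X.
  move=> i; split; last first.
    move=> t t0; apply/eqP; rewrite -normr_le0; apply/ler_addgt0Pr => e e0; rewrite add0r.
    have d0 : 0 < M * W i t / (1 - q) + 1 by rewrite ltr_wpDl.
    have [n hn] := small (e / (M * W i t / (1 - q) + 1)) (divr_gt0 e0 d0).
    have := XP i t n; rewrite (gX n i).2// subr0 => h; apply: (le_trans h).
    move: hn; rewrite ltr_pdivlMr// mulrDr mulr1 => hn.
    apply: ltW; apply: le_lt_trans hn; rewrite mulrC lerDl; exact: exprn_ge0.
  move=> t; apply/cvgrPdist_le => /= e e0.
  have Wt : \forall s \near t, W i s < W i t + 1.
    by apply: (cvgr_lt _ (cW i t)); rewrite ltrDl.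
  pose B := M * (W i t + 1) / (1 - q).
  have M00 : 0 <= M.
    have := M0 i t; rewrite -mulrA pmulr_lge0// divr_gt0 ?subr_gt0//; exact: W0.
  have B0 : 0 <= B by rewrite /B !mulr_ge0 ?invr_ge0 ?subr_ge0 ?(ltW q1)// addr_ge0// ltW.
  have B1 : 0 < B + 1 by rewrite ltr_wpDl.
  have [n hn] := small (e / 3 / (B + 1)) (divr_gt0 (divr_gt0 e0 (ltr0n _ 3)) B1).
  have Bq : B * q ^+ n <= e / 3.
    move: hn; rewrite ltr_pdivlMr// mulrDr mulr1 => hn.
    apply: ltW; apply: le_lt_trans hn; rewrite mulrC lerDl; exact: exprn_ge0.
  have /cvgrPdist_le /(_ (e / 3) (divr_gt0 e0 (ltr0n _ 3))) hc := (gX n i).1 t.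
  have bd s : W i s < W i t + 1 -> `|X i s - Xn n i s| <= e / 3.
    move=> Ws; apply: le_trans (XP i s n) _; apply: le_trans Bq.
    rewrite ler_wpM2r ?exprn_ge0// /B ler_wpM2r ?invr_ge0 ?subr_ge0 ?(ltW q1)//.
    by rewrite ler_wpM2l// ltW.
  near=> s.
  have h1 := bd t _; have h2 := bd s _; have h3 : `|Xn n i t - Xn n i s| <= e / 3 by near: s.
  have {}h1 : `|X i t - Xn n i t| <= e / 3 by apply: h1; rewrite ltrDl.
  have {}h2 : `|X i s - Xn n i s| <= e / 3 by apply: h2; near: s.
  rewrite (_ : X i t - X i s = (X i t - Xn n i t) + (Xn n i t - Xn n i s) - (X i s - Xn n i s)).
    apply: le_trans (ler_normB _ _) _.
    rewrite (_ : e = e / 3 + e / 3 + e / 3); last by field.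
    by apply: lerD => //; apply: le_trans (ler_normD _ _) _; exact: lerD.
  by ring.
exists X => // i t; apply/eqP; rewrite -subr_eq0 -normr_le0; apply/ler_addgt0Pr => e e0; rewrite add0r.
pose B := M * W i t / (1 - q).
have B1 : 0 < B + B + 1 by rewrite ltr_wpDl// addr_ge0//; exact: M0.
have [n hn] := small (e / (B + B + 1)) (divr_gt0 e0 B1).
have h1 := XP i t n.+1.
have h2 : `|T X i t - Xn n.+1 i t| <= B * q ^+ n.
  have := TL X (Xn n) (M / (1 - q) * q ^+ n) gXX (gX n) _ i t.
  move=> h; apply: le_trans (h _) _.
    by move=> j s; apply: le_trans (XP j s n) _; rewrite le_eqVlt; apply/orP; left; apply/eqP; ring.
  rewrite [leLHS](_ : _ = q * (B * q ^+ n)); last by rewrite /B; ring.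
  by apply: ler_piMl (ltW q1); apply: mulr_ge0; [exact: M0|exact: exprn_ge0].
rewrite (_ : X i t - T X i t = (X i t - Xn n.+1 i t) - (T X i t - Xn n.+1 i t)); last by ring.
apply: le_trans (ler_normB _ _) _; apply: le_trans (lerD h1 h2) _.
move: hn; rewrite ltr_pdivlMr// => hn; apply: ltW; apply: le_lt_trans hn.
rewrite exprS -/B; have qn0 : 0 <= q ^+ n by exact: exprn_ge0.
have B0 : 0 <= B by exact: M0.
rewrite [leRHS](_ : _ = B * q ^+ n + B * q ^+ n + q ^+ n); last by ring.
apply: ler_wpDr => //; rewrite lerD2r ler_wpM2l// ler_piMl// ltW.
Unshelve. all: by end_near. Qed.

End Picard.

(** * Uniqueness and positivity for Volterra equations *)

Section Positivity.
Context {R : realType}.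
Notation mu := (@lebesgue_measure R).
Implicit Types (f g h k v : R -> R) (a t : R).

Lemma first_zero v t : continuous v -> 0 < v 0 -> 0 <= t -> v t <= 0 ->
  exists t0, [/\ 0 < t0, v t0 = 0 & forall s, 0 <= s < t0 -> 0 < v s].
Proof.
move=> cv v0 t0 vt.
pose A := [set s | 0 <= s <= t /\ v s <= 0].
have At : A t by split => //; rewrite t0 lexx.
have Alb : lbound A 0 by move=> s [/andP[]].
have hA : has_inf A by split; [exists t|exists 0].
pose s0 := inf A.
have s00 : 0 <= s0 by apply: lb_le_inf => //; exists t.
have s0t : s0 <= t by apply: ge_inf => //; exists 0.
have before_pos s : 0 <= s < s0 -> 0 < v s.
  move=> /andP[h0 h1]; rewrite ltNge; apply/negP => vs.
  have : A s by split => //; rewrite h0 (ltW (lt_le_trans h1 s0t)).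
  by move=> /(ge_inf (ex_intro _ 0 Alb)); rewrite leNgt h1.
have vs0 : v s0 <= 0.
  rewrite leNgt; apply/negP => vs0.
  have := cvgr_gt _ (cv s0) _ vs0; move=> [e /= e0 He].
  have [s As ss0] := inf_adherent e0 hA; have [sA vs] := As.
  have s0s : s0 <= s by apply: ge_inf => //; exists 0.
  have := He s; rewrite /ball_ /= ler0_norm ?subr_le0// opprB => /(_ _).
  by rewrite ltrBlDl => /(_ ss0); rewrite ltNge vs.
have s00' : 0 < s0 by rewrite lt_neqAle s00 andbT; apply: contraTneq vs0 => <-; rewrite -ltNge.
have vs0' : v s0 = 0.
  apply/le_anti; rewrite vs0 /= leNgt; apply/negP => vn.
  have := cvgr_lt _ (cv s0) _ vn; move=> [e /= e0 He].
  pose s := Num.max 0 (s0 - e / 2).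
  have ss0 : s < s0 by rewrite /s gt_max s00' /= ltrBlDr ltrDl divr_gt0.
  have s_ge : s0 - e / 2 <= s by rewrite /s le_max lexx orbT.
  have : v s < 0.
    apply: He; rewrite /ball_ /= ger0_norm ?subr_ge0 ?(ltW ss0)//.
    rewrite ltrBlDr; apply: le_lt_trans (_ : e / 2 + s < _); first by rewrite -lerBlDl.
    by rewrite ltrD2r; lra.
  by rewrite ltNge ltW// before_pos// ss0 /s le_max lexx.
by exists s0.
Qed.

Lemma Rintegral_translate f (b : R) : measurable_fun [set: R] f ->
  \int[mu]_s f (s + b) = \int[mu]_s f s.
Proof.
by move=> mf; rewrite /Rintegral (@integral_translate _ (EFin \o f))//; apply/measurable_EFinP.
Qed.

Lemma integrable_translate f (b : R) : mu.-integrable [set: R] (EFin \o f) ->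
  mu.-integrable [set: R] (EFin \o (fun s => f (s + b))).
Proof.
move=> /integrableP[mf fin].
have mf' : measurable_fun [set: R] f by exact/measurable_EFinP.
apply/integrableP; split.
  apply/measurable_EFinP; apply: measurableT_comp => //.
  by apply: measurable_funD.
rewrite (@integral_translate _ (fun s => `|(EFin \o f) s|)%E b)//.
exact: measurableT_comp.
Qed.

(** At the maximum of |v| e^(-b t) the equation bounds this maximum by half of itself when b is large. *)
Lemma volterra_unique a l (T : R) v : 0 < a <= 1 -> 0 <= T -> continuous v ->
  (forall t, 0 <= t <= T -> v t = l * cconv (pker a) v t) ->
  forall t, 0 <= t <= T -> v t = 0.
Proof.
move=> a01 T0 cv vE; have /andP[a0 a1] := a01.
have ka := lockernel_pker a0.
pose q := (`|l| + 1)^-1 / 2.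
have l1 : 0 < `|l| + 1 by rewrite ltr_wpDl.
have q0 : 0 < q by rewrite divr_gt0// invr_gt0.
have [b b0 /(_ b (lexx _)) bE] := cconv_expR_small a01 q0.
have cE : continuous (fun s => expR (b * s)) := @expRM_continuous R b.
pose w t := `|v t| * expR (- (b * t)).
have cw : continuous w.
  move=> x; apply: cvgM; first by apply: cvg_norm; exact: cv.
  have e := @expRM_continuous R (- b) x.
  rewrite (_ : (fun t => expR (- (b * t))) = (fun t => expR (- b * t))); last first.
    by apply/funext => y; rewrite mulNr.
  by rewrite -mulNr.
have [c] := EVT_max T0 (continuous_subspaceT (A := `[0, T]) cw).
rewrite in_itv /= => /andP[c0 cT] hc.
have vw t : 0 <= t <= T -> `|v t| <= w c * expR (b * t).
  move=> tT; have := hc t; rewrite in_itv /= => /(_ tT).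
  by rewrite /w expRN ler_pdivrMr ?expR_gt0.
have wc : w c <= 0.
  have ccT : 0 <= c <= T by rewrite c0 cT.
  have h : `|v c| <= `|l| * (w c * (q * expR (b * c))).
    rewrite vE// normrM ler_wpM2l//.
    apply: le_trans (_ : cconv (pker a) (fun s => w c * expR (b * s)) c <= _).
      apply: cconv_norm_le => //; first exact: continuous_cmul.
      by move=> s /andP[s0 sc]; apply: vw; rewrite ltW//= (ltW (lt_le_trans sc cT)).
    have w0 : 0 <= w c by apply: mulr_ge0 => //; exact: expR_ge0.
    by rewrite (cconvZ _ _ ka cE); apply: ler_wpM2l => //; exact: bE.
  have {h}h : w c <= `|l| * q * w c.
    rewrite {1}/w expRN ler_pdivrMr ?expR_gt0//; apply: le_trans h _.
    by rewrite le_eqVlt; apply/orP; left; apply/eqP; ring.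
  have lq : `|l| * q <= 2^-1.
    rewrite /q mulrA ler_pdivrMr// mulVf// ler_pdivrMr// mul1r.
    by rewrite lerDl.
  have w0 : 0 <= w c by rewrite /w mulr_ge0 ?expR_ge0.
  have : w c <= 2^-1 * w c by apply: le_trans h _; rewrite ler_wpM2r.
  lra.
move=> t tT; apply/eqP; rewrite -normr_le0; apply: le_trans (vw t tT) _.
by rewrite pmulr_lle0 ?expR_gt0.
Qed.

(** At a first zero t0, take c < t0 close to t0 maximising v on [c, t0]. The hypothesis on g and the kernel bounds the part of the memory term coming from [0, c] by g t0 / g c times the memory term at c, and the part coming from [c, t0] by v c times a small mass of the kernel. Hence v t0 is at least a positive multiple of v c. *)
Lemma volterra_pos a l v g : 0 < a -> 0 < l -> continuous v -> 0 < v 0 ->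
  (forall t, 0 < t -> v t = g t - l * cconv (pker a) v t) ->
  (forall t, 0 < t -> 0 < g t) ->
  (forall t t', 0 < t <= t' -> g t' <= g t) ->
  (forall s t t', 0 <= s < t -> t < t' -> g t * pker a (t' - s) <= g t' * pker a (t - s)) ->
  forall t, 0 <= t -> 0 < v t.
Proof.
move=> a0 l0 cv v0 vE g0 gd gk t tge; rewrite ltNge; apply/negP => vt.
have [t0 [t00 vt0 vpos]] := first_zero cv v0 tge vt.
have ka := lockernel_pker a0.
have h0 : 0 < t0 / 2 by rewrite divr_gt0.
pose r := g t0 / g (t0 / 2).
have r0 : 0 < r by rewrite divr_gt0 ?g0.
have [e e0 eE] := powR_div_surjective a0 (divr_gt0 r0 (mulr_gt0 (ltr0n _ 2) l0)).
(* The window [t1, t0] has length at most e / 2, and e is chosen so that l * (e ^ a / a) is half of the lower bound r of g t0 / g c. *)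
pose t1 := Num.max (t0 / 2) (t0 - e / 2).
have t1t0 : t1 < t0 by rewrite /t1 gt_max; apply/andP; split; lra.
have t1h : t0 / 2 <= t1 by rewrite /t1 le_max lexx.
have t1e : t0 - t1 <= e / 2 by rewrite lerBlDr -lerBlDl /t1 le_max lexx orbT.
have t10 : 0 < t1 by exact: lt_le_trans t1h.
have [c] := EVT_max (ltW t1t0) (continuous_subspaceT (A := `[t1, t0]) cv).
rewrite in_itv /= => /andP[t1c ct0] hc.
have vc : 0 < v c.
  apply: lt_le_trans (hc t1 _); last by rewrite in_itv /= lexx ltW.
  by apply: vpos; rewrite (ltW t10).
have {}ct0 : c < t0.
  by rewrite lt_neqAle ct0 andbT; apply: contraTneq vc => ->; rewrite vt0 ltxx.
have c0 : 0 < c by exact: lt_le_trans t1c.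
pose h := t0 - c.
have hh : 0 < h by rewrite subr_gt0.
have h2 : h + h <= e by rewrite /h; lra.
have hc' s : c <= s -> s <= t0 -> v s <= v c.
  by move=> cs st0; apply: hc; rewrite in_itv /= (le_trans t1c cs).
have gc0 := g0 _ c0; have gt0 := g0 _ t00.
(* The cut at distance h from t0 is covered by a kernel mass over ]0, 2 h[ rather than ]0, h], which avoids treating the cutting point separately. *)
have main : cconv (pker a) v t0 <=
    g t0 / g c * cconv (pker a) v c + v c * cconv (pker a) (fun=> 1) (h + h).
  have i1 := cconv_cont_integrable c ka cv.
  have i2 := cconv_cont_integrable (h + h) ka (@cst_continuous _ _ (1 : R)).
  have i1' := integrable_translate (- h) i1.
  have -> : cconv (pker a) v c =
      \int[mu]_s (causal (pker a) (s - h) * causal v (c - (s - h))).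
    rewrite (Rintegral_translate (f := fun s => causal (pker a) s * causal v (c - s)))//.
    apply: measurable_cconv_integrand; first exact: measurable_pker.
    exact: continuous_measurable_fun.
  rewrite [X in _ <= _ + v c * X]/cconv.
  rewrite -RintegralZl// -RintegralZl// -RintegralD//; last 2 first.
  - exact: (integrableZl measurableT (g t0 / g c) i1').
  - exact: (integrableZl measurableT (v c) i2).
  apply: le_Rintegral => //; first exact: cconv_cont_integrable.
    have := integrableD measurableT (integrableZl measurableT (g t0 / g c) i1')
      (integrableZl measurableT (v c) i2).
    by [].
  move=> s _.
  have ce : c - (s - h) = t0 - s by rewrite /h; ring.
  rewrite ce /causal !subr_gt0.
  case: (ltP 0 s) => s0; last first.
    rewrite !mul0r mulr0 addr0 ltNge (le_trans s0 (ltW hh)) /=.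
    by rewrite mul0r mulr0.
  have ks := pker_gt0 a s0.
  case: (ltP s t0) => st0; last first.
    rewrite !mulr0 add0r; apply: mulr_ge0; first exact: ltW.
    by case: ifP; rewrite ?mulr1 ?mulr0// ltW.
  have vts : 0 < v (t0 - s) by apply: vpos; rewrite subr_ge0 (ltW st0) /= ltrBlDr ltrDl.
  case: (ltP h s) => hs.
    apply: ler_wpDr.
      apply: mulr_ge0; first exact: ltW.
      by case: ifP; rewrite ?mulr1 ?mulr0// ltW.
    rewrite mulrA ler_wpM2r// ?(ltW vts)//.
    rewrite mulrAC ler_pdivlMr// mulrC.
    have := gk (t0 - s) c t0; rewrite subr_ge0 (ltW st0) subKr.
    rewrite (_ : c - (t0 - s) = s - h); last by rewrite /h; ring.
    by apply => //=; rewrite ltrBlDr addrC -ltrBlDr.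
  rewrite mul0r mulr0 add0r (le_lt_trans hs) ?ltrDl// mulr1 mulrC.
  rewrite ler_wpM2r// ?(ltW ks)//; apply: hc'; last by rewrite gerBl ltW.
  by rewrite lerBrDr -lerBrDl.
have V1 : cconv (pker a) (fun=> 1) (h + h) <= r / (2 * l).
  rewrite (cconv_pker1 a0 (addr_gt0 hh hh)) -eE ler_wpM2r ?invr_ge0 ?(ltW a0)//.
  by apply: ge0_ler_powR; rewrite ?nnegrE ?(ltW a0) ?(ltW e0)// ltW// addr_gt0.
have r1 : r <= g t0 / g c.
  rewrite /r ler_pM2l// lef_pV2 ?posrE ?g0//; apply: gd.
  by rewrite h0 (le_trans t1h).
have : 0 < v t0.
  rewrite vE//; apply: lt_le_trans (_ : g t0 - l * (g t0 / g c * cconv (pker a) v c + v c * (r / (2 * l))) <= _).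
    have Ec : l * cconv (pker a) v c = g c - v c by rewrite vE// opprB addrC subrK.
    rewrite [X in 0 < X](_ : _ = (g t0 / g c) * (g c - l * cconv (pker a) v c) - v c * (r / 2)).
      rewrite -vE// (mulrC _ (v c)) -mulrBr; apply: mulr_gt0 => //.
      by rewrite subr_gt0; apply: lt_le_trans r1; lra.
    by field; rewrite !gt_eqF.
  rewrite lerD2l lerN2 ler_pM2l//; apply: le_trans main _.
  by rewrite lerD2l ler_wpM2l// ltW.
by rewrite vt0 ltxx.
Qed.

End Positivity.

(** * The resolvent of a power kernel *)

Section Resolvent.
Context {R : realType}.
Notation mu := (@lebesgue_measure R).
Implicit Types (f g h k v : R -> R) (a t : R).

Lemma pker_anti a (x y : R) : a <= 1 -> 0 < x -> x <= y -> pker a y <= pker a x.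
Proof.
move=> a1 x0 xy; have y0 : 0 < y := lt_le_trans x0 xy.
rewrite /pker -!(opprB 1 a) !powRN lef_pV2 ?posrE ?powR_gt0//.
by apply: ge0_ler_powR; rewrite ?nnegrE ?subr_ge0 ?(ltW x0) ?(ltW y0).
Qed.

(** With a - 1 <= 0 the inequality reverses the comparison of x (y + d) with y (x + d). *)
Lemma pker_logconvex a (x y d : R) : a <= 1 -> 0 < x -> x <= y -> 0 <= d ->
  pker a y * pker a (x + d) <= pker a (y + d) * pker a x.
Proof.
move=> a1 x0 xy d0; have y0 : 0 < y := lt_le_trans x0 xy.
have xd : 0 < x + d by rewrite ltr_wpDr.
have yd : 0 < y + d by rewrite ltr_wpDr.
rewrite /pker -!powRM ?(ltW x0) ?(ltW y0) ?(ltW xd) ?(ltW yd)//.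
apply: pker_anti => //; first exact: mulr_gt0.
by rewrite mulrDl mulrDr lerD2l mulrC ler_wpM2r.
Qed.

Lemma resolvent_exists a (l : R) : 0 < a <= 1 ->
  exists2 s, continuous s & forall t, s t = 1 - l * cconv (pker a) s t.
Proof.
move=> a01; have /andP[a0 a1] := a01; have ka := lockernel_pker a0.
pose q := (`|l| + 1)^-1 / 2.
have l1 : 0 < `|l| + 1 by rewrite ltr_wpDl.
have q0 : 0 < q by rewrite divr_gt0// invr_gt0.
have lq : `|l| * q <= 2^-1.
  rewrite /q mulrA ler_pdivrMr// mulVf// ler_pdivrMr// mul1r.
  by rewrite lerDl.
have [b b0 /(_ b (lexx _)) bE] := cconv_expR_small a01 q0.
have cE : continuous (fun s => expR (b * s)) := @expRM_continuous R b.
have c1 : continuous (fun _ : R => 1 : R) by exact: cst_continuous.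
pose T (X : unit -> R -> R) (_ : unit) t := - l * cconv (pker a) (fun s => 1 + X tt s) t.
have cX X : causal_family X -> continuous (fun s => 1 + X tt s).
  by move=> gX x; apply: cvgD; [exact: cvg_cst|exact: (gX tt).1].
have [||||||X gX XE] := @picard R unit T (fun _ t => expR (b * t)) (2^-1) (`|l| * q).
- by apply/andP; split; lra.
- by [].
- by move=> i t; exact: expR_gt0.
- move=> X gX i; split; last by move=> t t0; rewrite /T cconv_le0// mulr0.
  by apply: continuous_cmul; apply: cconv_continuous => //; exact: cX.
- move=> i t; rewrite /T normrM normrN -mulrA ler_wpM2l//; apply: le_trans (bE t).
  apply: cconv_norm_le => //.
    by move=> x; apply: cvgD; exact: cvg_cst.
  move=> s /andP[s0 _]; rewrite addr0 normr1 -expR0 ler_expR mulr_ge0// ltW//.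
- move=> X Y e gX gY XY i t; rewrite /T -mulrBr normrM normrN.
  rewrite -cconvB//; [|exact: cX|exact: cX].
  apply: le_trans (_ : `|l| * (e * (q * expR (b * t))) <= _).
    have e0 : 0 <= e.
      have := le_trans (normr_ge0 _) (XY tt 0).
      by rewrite mulr0 expR0 mulr1.
    rewrite ler_wpM2l//; apply: le_trans (_ : e * cconv (pker a) (fun s => expR (b * s)) t <= _).
      rewrite -cconvZ//; apply: cconv_norm_le => //.
      - by move=> x; apply: cvgB; exact: cX.
      - exact: continuous_cmul.
      - move=> s _; rewrite opprD addrACA subrr add0r; exact: XY.
    by rewrite ler_wpM2l.
  have e0 : 0 <= e * expR (b * t) by exact: le_trans (normr_ge0 _) (XY tt t).
  rewrite [leLHS](_ : _ = (`|l| * q) * (e * expR (b * t))); last by ring.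
  by rewrite -[leRHS]mulrA ler_wpM2r.
exists (fun s => 1 + X tt s); first exact: cX.
by move=> t; rewrite {1}XE /T mulNr.
Qed.

(** The case g = 1 of [volterra_pos]. *)
Lemma resolvent_gt0 a (l : R) s : 0 < a <= 1 -> 0 < l -> continuous s ->
  (forall t, s t = 1 - l * cconv (pker a) s t) -> forall t, 0 <= t -> 0 < s t.
Proof.
move=> /andP[a0 a1] l0 cs sE.
apply: (@volterra_pos _ a l s (fun=> 1)) => //.
- by rewrite sE cconv_le0// mulr0 subr0 ltr01.
- move=> u t t' /andP[u0 ut] tt'; rewrite !mul1r; apply: pker_anti => //.
    by rewrite subr_gt0.
  by rewrite lerD2r ltW.
Qed.

(** The difference of s and its translate by d satisfies a Volterra equation whose inhomogeneity collects the memory of s in a window of length d. That inhomogeneity inherits log-convexity from the kernel. It is only known to be nonnegative, so e' s is added to reach the strict positivity that [volterra_pos] requires, and e' is arbitrary. *)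
Lemma resolvent_nonincreasing a (l : R) s : 0 < a <= 1 -> 0 < l -> continuous s ->
  (forall t, s t = 1 - l * cconv (pker a) s t) ->
  forall t t', 0 <= t -> t <= t' -> s t' <= s t.
Proof.
move=> a01 l0 cs sE; have /andP[a0 a1] := a01; have ka := lockernel_pker a0.
have sp := resolvent_gt0 a01 l0 cs sE.
have s01 : s 0 = 1 by rewrite sE cconv_le0// mulr0 subr0.
have Vs t : 0 <= cconv (pker a) s t.
  by apply: cconv_ge0 => // x /andP[x0 _]; apply/ltW/sp/ltW.
move=> t t' t0; rewrite le_eqVlt => /predU1P[->//|tt'].
pose d := t' - t; have d0 : 0 < d by rewrite subr_gt0.
pose sd y := s (y + d).
have csd : continuous sd.
  move=> y; apply: (continuous_comp (f := fun y => y + d) (g := s)); last exact: cs.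
  by apply: cvgD; [exact: cvg_id|exact: cvg_cst].
(* Up to the factor l, the integral of H y is the inhomogeneity of the equation for s - sd at time y. *)
pose H y z := causal (pker a) z * causal s (y + d - z) - causal (pker a) z * causal sd (y - z).
have iH y : mu.-integrable [set: R] (EFin \o H y).
  have := integrableB measurableT (cconv_cont_integrable (y + d) ka cs)
    (cconv_cont_integrable y ka csd).
  by [].
have mH y : measurable_fun [set: R] (H y).
  by have /integrableP[/measurable_EFinP] := iH y.
pose rest y := \int[mu]_z H y z.
have restE y : cconv (pker a) s (y + d) - cconv (pker a) sd y = rest y.
  by rewrite /rest /H RintegralB//; exact: cconv_cont_integrable.
have HE y z : 0 <= y -> H y z = if (y <= z) && (z < y + d) then causal (pker a) z * s (y + d - z) else 0.
  move=> y0; rewrite /H {2 4}/causal !subr_gt0.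
  case: (leP y z) => yz /=.
    by rewrite mulr0 subr0; case: ifP; rewrite ?mulr0.
  rewrite (lt_trans yz) ?ltrDl// /sd addrAC subrr//.
have shift y y' : rest y' = \int[mu]_z H y' (z + (y' - y)).
  by rewrite Rintegral_translate.
have ishift y y' := integrable_translate (y' - y) (iH y').
have Hge0 y z : 0 <= y -> 0 <= H y z.
  move=> y0; rewrite HE//; case: ifPn => // /andP[yz zy].
  rewrite mulr_ge0//; last by rewrite ltW// sp// subr_ge0 ltW.
  by apply: causal_ge0 => x x0; exact/ltW/pker_gt0.
have rest0 y : 0 <= y -> 0 <= rest y.
  by move=> y0; apply: Rintegral_ge0 => z _; exact: Hge0.
have HEs y y' z : 0 < y -> y <= y' ->
    H y' (z + (y' - y)) = if (y <= z) && (z < y + d) then pker a (z + (y' - y)) * s (y + d - z) else 0.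
  move=> y0 yy'; rewrite HE; last by rewrite (le_trans (ltW y0)).
  rewrite addrC -lerBlDl subKr -(addrA y' d) (addrC d).
  rewrite (_ : (_ < _) = (z < y + d)); last first.
    by rewrite -ltrBrDl; congr (_ < _); ring.
  case: ifPn => // /andP[yz _]; rewrite /causal ifT; last first.
    by rewrite ltr_wpDl ?subr_ge0// (lt_le_trans y0).
  by congr (pker a _ * s _); ring.
have HEy y z : 0 < y -> H y z = if (y <= z) && (z < y + d) then pker a z * s (y + d - z) else 0.
  by move=> y0; have := @HEs y y z y0 (lexx _); rewrite subrr addr0.
apply/ler_addgt0Pr => e e0.
have [e' e'0 ->] : exists2 e', 0 < e' & e = e' * s t.
  by exists (e / s t); rewrite ?divr_gt0 ?sp// divfK// gt_eqF// sp.
have st' : s t' = sd t by rewrite /sd addrC subrK.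
suff : forall y, 0 <= y -> 0 < s y + e' * s y - sd y.
  by move=> /(_ t t0); rewrite st' subr_gt0; exact: ltW.
apply: (@volterra_pos _ a l (fun y => s y + e' * s y - sd y) (fun y => e' + l * rest y)) => //.
- move=> y; apply: cvgB; last exact: csd.
  by apply: cvgD; [exact: cs|exact: continuous_cmul].
- rewrite /sd add0r s01 mulr1.
  have : s d <= 1 by rewrite sE gerBl mulr_ge0// ltW.
  by move: e'0 => /[swap]; lra.
- move=> y y0.
  have e1 : cconv (pker a) (fun y => s y + e' * s y - sd y) y =
      cconv (pker a) s y + e' * cconv (pker a) s y - cconv (pker a) sd y.
    rewrite cconvB//; last by move=> x; apply: cvgD; [exact: cs|exact: continuous_cmul].
    by rewrite cconvD//; [rewrite cconvZ|exact: continuous_cmul].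
  rewrite e1 -restE {1 2}(sE y) {1}/sd (sE (y + d)); ring.
- by move=> y y0; rewrite ltr_wpDr// mulr_ge0 ?rest0// ltW.
- move=> y y' /andP[y0 yy']; rewrite lerD2l ler_pM2l// (shift y y').
  apply: (le_Rintegral measurableT (ishift y y') (iH y)).
  move=> z _; rewrite HEs// HEy//; case: ifPn => // /andP[yz zy].
  rewrite ler_wpM2r//; first by rewrite ltW// sp// subr_ge0 ltW.
  apply: pker_anti => //; first exact: lt_le_trans yz.
  by rewrite lerDl subr_ge0.
- move=> u y y' /andP[u0 uy] yy'; rewrite !mulrDl; apply: lerD.
    rewrite ler_pM2l//; apply: pker_anti => //; first by rewrite subr_gt0.
    by rewrite lerD2r ltW.
  rewrite -!mulrA ler_pM2l// (shift y y') -(RintegralZr _ measurableT (iH y)).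
  rewrite -(RintegralZr _ measurableT (ishift y y')).
  have y0 : 0 < y by exact: le_lt_trans uy.
  apply: le_Rintegral => //.
  + exact: (integrableZr measurableT (pker a (y' - u)) (iH y)).
  + exact: (integrableZr measurableT (pker a (y - u)) (ishift y y')).
  move=> z _; rewrite HEs ?(ltW yy')// HEy//; case: ifPn => [/andP[yz zy]|_]; last by rewrite !mul0r.
  rewrite mulrAC [leRHS]mulrAC ler_wpM2r//; first by rewrite ltW// sp// subr_ge0 ltW.
  rewrite (_ : y' - u = y - u + (y' - y)); last by ring.
  apply: pker_logconvex => //; rewrite ?subr_gt0 ?subr_ge0 ?(ltW yy')//.
  by rewrite (le_trans _ yz)// gerBl.
Qed.

End Resolvent.

(** * Comparison and asymptotic bounds *)

Section Comparison.
Context {R : realType}.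
Notation mu := (@lebesgue_measure R).
Implicit Types (f g h k v : R -> R) (a t : R).

(** By monotonicity the convolution of the kernel with s is at least s t * t^a / a, while the equation bounds it by 1 / l. *)
Lemma resolvent_cvg0 a (l : R) s : 0 < a <= 1 -> 0 < l -> continuous s ->
  (forall t, s t = 1 - l * cconv (pker a) s t) ->
  forall e : R, 0 < e -> exists T, forall t, T <= t -> s t <= e.
Proof.
move=> a01 l0 cs sE e e0; have /andP[a0 a1] := a01; have ka := lockernel_pker a0.
have sp := resolvent_gt0 a01 l0 cs sE.
have sd := resolvent_nonincreasing a01 l0 cs sE.
have le0 : 0 < (l * e)^-1 by rewrite invr_gt0 mulr_gt0.
have [T T0 TE] := powR_div_surjective a0 le0.
exists T => t Tt; have t0 : 0 < t := lt_le_trans T0 Tt.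
have h1 : s t * cconv (pker a) (fun=> 1) t <= cconv (pker a) s t.
  rewrite -cconvZ//; last exact: cst_continuous.
  apply: cconv_le => //.
    by apply: continuous_cmul; exact: cst_continuous.
  by move=> y /andP[y0 yt]; rewrite mulr1; apply: sd; exact: ltW.
have h2 : l * cconv (pker a) s t <= 1.
  by have := sp t (ltW t0); rewrite sE subr_gt0 => /ltW.
rewrite cconv_pker1// in h1.
have h3 : (l * e)^-1 <= t `^ a / a.
  rewrite -TE ler_wpM2r ?invr_ge0 ?(ltW a0)//.
  by apply: ge0_ler_powR; rewrite ?nnegrE ?(ltW a0) ?(ltW T0) ?(ltW t0).
have h4 : s t * (l * e)^-1 <= l^-1.
  apply: le_trans (_ : s t * (t `^ a / a) <= _); first by rewrite ler_wpM2l// ltW// sp// ltW.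
  by apply: le_trans h1 _; rewrite -[leRHS]mul1r ler_pdivlMr// mulrC.
move: h4; rewrite ler_pdivrMr ?mulr_gt0//.
by rewrite mulrA mulVf ?mul1r// gt_eqF.
Qed.

Lemma nonneg_of_nondecreasing_primitive f (T : R) : continuous f ->
  (forall t t', 0 <= t -> t <= t' -> t' <= T -> cconv (fun=> 1) f t <= cconv (fun=> 1) f t') ->
  forall t, 0 < t <= T -> 0 <= f t.
Proof.
move=> cf H t /andP[t0 tT]; rewrite leNgt; apply/negP => ft.
have [e /= e0 He] := cvgr_lt _ (cf t) _ ft.
pose t1 := Num.max (t / 2) (t - e / 2).
have t1t : t1 < t by rewrite /t1 gt_max; apply/andP; split; lra.
have t10 : 0 < t1 by rewrite /t1 lt_max divr_gt0.
have [||c ct] := @MVT R (cconv (fun=> 1) f) f t1 t t1t.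
- move=> x; rewrite in_itv /= => /andP[t1x _]; apply: is_derive_cconv1 => //.
  exact: lt_trans t1x.
- by apply: continuous_subspaceT; apply: cconv_continuous => //; exact: lockernel1.
have := H t1 t (ltW t10) (ltW t1t) tT; rewrite -subr_ge0 => /[swap] ->.
rewrite leNgt => /negP; apply; rewrite nmulr_rlt0 ?subr_gt0//.
move: ct; rewrite in_itv /= => /andP[t1c ct]; apply: He.
rewrite /ball_ /= gtr0_norm ?subr_gt0// ltrBlDr -ltrBlDl.
apply: le_lt_trans t1c; rewrite /t1 le_max; apply/orP; right; lra.
Qed.

(** Put w = u - u 0 * s, which solves the equation with zero initial value. The primitive of F - m w and the convolution s * F solve the same Volterra equation, so they agree. Hence m times the primitive of w is the convolution of 1 - s with F, which is nondecreasing because s is nonincreasing and F >= 0; therefore w >= 0. *)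
Lemma volterra_ge a (c m T : R) (u F s : R -> R) : 0 < a <= 1 -> 0 < c -> 0 < m ->
  continuous u -> continuous F -> continuous s ->
  (forall t, s t = 1 - c * m * cconv (pker a) s t) ->
  0 <= u 0 -> (forall t, 0 <= t <= T -> 0 <= F t) ->
  (forall t, 0 <= t <= T -> u t = u 0 + c * cconv (pker a) (fun y => F y - m * u y) t) ->
  forall t, 0 <= t <= T -> u 0 * s t <= u t.
Proof.
move=> a01 c0 m0 cu cF cs sE u0 F0 uE; have /andP[a0 a1] := a01.
have ka := lockernel_pker a0; have cm0 : 0 < c * m by rewrite mulr_gt0.
have sp := resolvent_gt0 a01 cm0 cs sE.
have sd := resolvent_nonincreasing a01 cm0 cs sE.
have s01 : s 0 = 1 by rewrite sE cconv_le0// mulr0 subr0.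
have c1 : continuous (fun _ : R => 1 : R) by exact: cst_continuous.
(* F is only nonnegative on [0, T]; this extension keeps the equation on [0, T]. *)
pose G y := Num.max (F y) 0.
have cG : continuous G.
  move=> y; apply: (continuous_comp (f := F) (g := fun z => Num.max z 0)); first exact: cF.
  exact: max_cst_continuous.
have G0 y : 0 <= G y by rewrite /G le_max lexx orbT.
have GF y : 0 <= y <= T -> G y = F y by move=> /F0 h; rewrite /G; apply/max_idPl.
have kG : lockernel G by apply: lockernel_cont.
have mG := continuous_measurable_fun cG.
have ks : lockernel s by apply: lockernel_cont => // y /ltW /sp /ltW.
have ms := continuous_measurable_fun cs.
pose w y := u y - u 0 * s y.
have cw : continuous w.
  by move=> y; apply: cvgB; [exact: cu|exact: continuous_cmul].
have cmu := continuous_cmul (c := m) cu.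
have cms := continuous_cmul (c := m) cs.
have cmw := continuous_cmul (c := m) cw.
have cFm : continuous (fun y => F y - m * u y).
  by move=> y; apply: cvgB; [exact: cF|exact: cmu].
have cGm : continuous (fun y => G y - m * w y).
  by move=> y; apply: cvgB; [exact: cG|exact: cmw].
have cV f : continuous f -> continuous (cconv (pker a) f) by move=> cf; exact: cconv_continuous.
have wE t : 0 <= t <= T -> w t = c * cconv (pker a) (fun y => G y - m * w y) t.
  move=> /andP[t0 tT]; rewrite {1}/w uE ?t0// sE.
  have -> : cconv (pker a) (fun y => G y - m * w y) t =
      cconv (pker a) (fun y => F y - m * u y) t + (m * u 0) * cconv (pker a) s t.
    rewrite -cconvZ// -cconvD//; last exact: continuous_cmul.
    apply: eq_cconv => // y /andP[y0 yt].
    by rewrite GF ?(ltW y0) ?(le_trans (ltW yt))// /w; ring.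
  ring.
pose U := cconv s G.
have UE t : U t = cconv (fun=> 1) G t - c * m * cconv (pker a) U t.
  rewrite /U cconvA_cont//; last by move=> y /ltW /sp /ltW.
  have mV := continuous_measurable_fun (cV _ cs).
  rewrite (cconvC t ms mG) (cconvC t mV mG) [cconv (fun=> 1) G t]cconvC//.
  rewrite -cconvZ//; last exact: cV.
  rewrite -cconvB//; last by apply: continuous_cmul; exact: cV.
  by apply: eq_cconv => // y _; rewrite {1}sE.
have cJ f : continuous f -> continuous (cconv (fun=> 1) f).
  by move=> cf; apply: cconv_continuous => //; exact: lockernel1.
pose W := cconv (fun=> 1) (fun y => G y - m * w y).
have WE t : 0 <= t <= T -> W t = cconv (fun=> 1) G t - c * m * cconv (pker a) W t.
  move=> /andP[t0 tT]; rewrite /W [LHS]cconvB//; last exact: lockernel1.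
  rewrite cconv_intC// cconvZ//; last exact: lockernel1.
  rewrite (mulrC c) -mulrA; congr (_ - _ * _).
  rewrite -(cconvZ c t lockernel1 (cV _ cGm)).
  apply: eq_cconv => // y /andP[y0 yt].
  by apply: wE; rewrite (ltW y0) (le_trans (ltW yt)).
have cW : continuous W := cJ _ cGm.
have cU : continuous U by exact: cconv_continuous.
have WU t : 0 <= t <= T -> W t = U t.
  move=> tT; have T0 : 0 <= T by case/andP: tT => h1 h2; exact: le_trans h2.
  apply/eqP; rewrite -subr_eq0; apply/eqP.
  apply: (@volterra_unique _ a (- (c * m)) T (fun y => W y - U y)) => //.
  - by move=> y; apply: cvgB; [exact: cW|exact: cU].
  - move=> y yT; rewrite (cconvB y ka cW cU) (WE y yT) UE.
    move: (cconv (pker a) W y) (cconv (pker a) U y) (cconv _ G y) => p q r; ring.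
have inc t t' : 0 <= t -> t <= t' -> t' <= T -> cconv (fun=> 1) w t <= cconv (fun=> 1) w t'.
  move=> t0 tt' t'T.
  have E y : 0 <= y <= T -> m * cconv (fun=> 1) w y = cconv G (fun z => 1 - s z) y.
    move=> yT; rewrite (cconvB y kG c1 cs) -(cconvC y ms mG) -/(U y) -WU// /W.
    rewrite [in RHS](cconvC y mG (measurable_cst _)).
    rewrite cconvB//; last exact: lockernel1.
    by rewrite cconvZ//; [rewrite opprB addrC subrK|exact: lockernel1].
  have c1s : continuous (fun z => 1 - s z) by move=> y; apply: cvgB; [exact: cvg_cst|exact: cs].
  rewrite -(ler_pM2l m0) !E ?t0 ?(le_trans t0 tt') ?(le_trans tt' t'T)//.
  apply: le_Rintegral => //; [exact: cconv_cont_integrable|exact: cconv_cont_integrable|].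
  move=> z _; apply: ler_wpM2l; first exact: causal_ge0.
  have s1 y : 0 <= y -> s y <= 1 by move=> y0; rewrite -s01 sd.
  rewrite /causal !subr_gt0; case: (ltP z t) => zt.
    rewrite (lt_le_trans zt tt') lerD2l lerN2; apply: sd; first by rewrite subr_ge0 ltW.
    by rewrite lerD2r.
  by case: ltP => zt' //; rewrite subr_ge0 s1// subr_ge0 ltW.
move=> t tT'; suff : 0 <= w t by rewrite /w subr_ge0.
move: tT' => /andP[]; rewrite le_eqVlt => /predU1P[<- _|t0 tT].
  by rewrite /w s01 mulr1 subrr.
by apply: (@nonneg_of_nondecreasing_primitive w T) => //; rewrite t0.
Qed.

(** Compare u with the constant L / m plus a multiple of the resolvent h for the rate m / 2. For the equation with rate m the function h has the positive forcing m / 2 * h, which absorbs the excess of F over L on [0, T0], and h tends to 0. *)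
Lemma volterra_limsup a (c m B L T0 : R) (u F : R -> R) : 0 < a <= 1 -> 0 < c -> 0 < m ->
  continuous u -> continuous F -> 0 <= T0 ->
  (forall t, 0 <= t -> u t = u 0 + c * cconv (pker a) (fun y => F y - m * u y) t) ->
  (forall t, 0 <= t -> F t <= B) -> (forall t, T0 <= t -> F t <= L) ->
  forall e : R, 0 < e -> exists T, forall t, T <= t -> u t <= L / m + e.
Proof.
move=> a01 c0 m0 cu cF T00 uE FB FL e e0; have /andP[a0 a1] := a01.
have ka := lockernel_pker a0.
have m20 : 0 < m / 2 by rewrite divr_gt0.
have cm0 : 0 < c * (m / 2) by rewrite mulr_gt0.
have [h ch hE] := resolvent_exists (c * (m / 2)) a01.
have [s cs sE] := resolvent_exists (c * m) a01.
have cmm0 : 0 < c * m by rewrite mulr_gt0.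
have hp := resolvent_gt0 a01 cm0 ch hE.
have sp := resolvent_gt0 a01 cmm0 cs sE.
have hd := resolvent_nonincreasing a01 cm0 ch hE.
have h01 : h 0 = 1 by rewrite hE cconv_le0// mulr0 subr0.
have hT0 := hp _ T00.
(* The first summand absorbs the excess of F over L before T0, the second one the initial value. *)
pose M := `|B - L| / (m / 2 * h T0) + `|u 0 - L / m|.
have mh0 : 0 < m / 2 * h T0 by rewrite mulr_gt0.
have M0 : 0 <= M by rewrite addr_ge0// divr_ge0// ltW.
pose w t := L / m + M * h t - u t.
pose G t := L + m / 2 * M * h t - F t.
have cw : continuous w.
  move=> y; apply: cvgB; last exact: cu.
  by apply: cvgD; [exact: cvg_cst|exact: continuous_cmul].
have cG : continuous G.
  move=> y; apply: cvgB; last exact: cF.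
  by apply: cvgD; [exact: cvg_cst|exact: continuous_cmul].
have cFm : continuous (fun y => F y - m * u y).
  by move=> y; apply: cvgB; [exact: cF|exact: continuous_cmul].
have G0 t : 0 <= t -> 0 <= G t.
  move=> t0; rewrite /G; have [tT|Tt] := leP T0 t.
    have h1 := FL t tT; have : 0 <= m / 2 * M * h t.
      by rewrite !mulr_ge0// ltW// hp.
    lra.
  have h1 := FB t t0; have : B - L <= m / 2 * M * h t.
    apply: le_trans (ler_norm _) _.
    apply: le_trans (_ : m / 2 * (`|B - L| / (m / 2 * h T0)) * h T0 <= _).
      by rewrite le_eqVlt; apply/orP; left; apply/eqP; field; rewrite !gt_eqF.
    apply: ler_pM; rewrite ?(ltW hT0)//.
    - by rewrite mulr_ge0 ?(ltW m20)// divr_ge0// ltW.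
    - by rewrite ler_wpM2l ?(ltW m20)// /M lerDl.
    - by apply: hd => //; exact: ltW.
  lra.
have w00 : 0 <= w 0.
  rewrite /w h01 mulr1 /M.
  have h1 : 0 <= `|B - L| / (m / 2 * h T0) by rewrite divr_ge0// ltW.
  have h2 := ler_norm (u 0 - L / m); lra.
have wE t : 0 <= t -> w t = w 0 + c * cconv (pker a) (fun y => G y - m * w y) t.
  move=> t0.
  have -> : cconv (pker a) (fun y => G y - m * w y) t =
      - (m / 2 * M) * cconv (pker a) h t - cconv (pker a) (fun y => F y - m * u y) t.
    rewrite -cconvZ// -cconvB//; last exact: continuous_cmul.
    by apply: eq_cconv => // y _; rewrite /G /w; field; rewrite gt_eqF.
  by rewrite /w h01 {1}hE uE//; ring.
have [T HT] := resolvent_cvg0 a01 cm0 ch hE (divr_gt0 e0 (ltr_wpDl M0 ltr01)).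
exists (Num.max 0 T) => t; rewrite ge_max => /andP[t0 Tt].
have : w 0 * s t <= w t.
  apply: (@volterra_ge a c m t w G s) => //; rewrite ?lexx ?t0//.
  - by move=> y /andP[y0 _]; exact: G0.
  - by move=> y /andP[y0 _]; exact: wE.
have ws : 0 <= w 0 * s t by rewrite mulr_ge0// ltW// sp.
move=> /(le_trans ws); rewrite /w subr_ge0 => h1; apply: le_trans h1 _.
rewrite lerD2l; have := HT t Tt; rewrite ler_pdivlMr ?ltr_wpDl//.
apply: le_trans; rewrite mulrDr mulr1 mulrC lerDl ltW// hp//.
Qed.

End Comparison.

(** * Metzler and Hurwitz matrices *)

Section Metzler.
Context {R : realType}.

(** Consider the index that minimises x i / v i. If the minimum were negative, row i of N would send x to a negative value. *)
Lemma zmatrix_mono (F : realFieldType) n (N : 'M[F]_n) (v x : 'cV[F]_n) :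
  (forall i j, i != j -> N i j <= 0) -> (forall i, 0 < v i 0) ->
  (forall i, 0 < (N *m v) i 0) -> (forall i, 0 <= (N *m x) i 0) ->
  forall i, 0 <= x i 0.
Proof.
move=> NZ v0 Nv Nx i0; rewrite leNgt; apply/negP => xi0.
pose f i := x i 0 / v i 0.
case: (@arg_minP _ _ _ i0 predT f isT) => i _ fi.
have mneg : f i < 0.
  by apply: le_lt_trans (fi i0 isT) _; rewrite /f pmulr_llt0 ?invr_gt0.
have xE j : f i * v j 0 <= x j 0 by rewrite -ler_pdivlMr//; exact: fi.
have : (N *m x) i 0 <= f i * (N *m v) i 0.
  rewrite !mxE mulr_sumr; apply: ler_sum => j _.
  rewrite mulrCA; have [<-|ij] := eqVneq i j.
    by rewrite /f divfK// gt_eqF.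
  by apply: ler_wnM2l; [exact: NZ|exact: xE].
rewrite leNgt => /negP; apply; apply: lt_le_trans (Nx i).
by rewrite nmulr_rlt0.
Qed.

Lemma zmatrix_unit (F : realFieldType) n (N : 'M[F]_n) (v : 'cV[F]_n) :
  (forall i j, i != j -> N i j <= 0) -> (forall i, 0 < v i 0) ->
  (forall i, 0 < (N *m v) i 0) -> N \in unitmx.
Proof.
move=> NZ v0 Nv; rewrite -unitmx_tr -row_free_unit; apply: inj_row_free => u uN.
have Nu : N *m u^T = 0 by rewrite -[N]trmxK -trmx_mul uN trmx0.
apply/rowP => i; rewrite mxE; apply/le_anti/andP; split.
- rewrite -oppr_ge0; have := @zmatrix_mono F n N v (- u^T) NZ v0 Nv _ i.
  by rewrite !mxE; apply => j; rewrite mulmxN Nu !mxE oppr0.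
- have := @zmatrix_mono F n N v u^T NZ v0 Nv _ i.
  by rewrite !mxE; apply => j; rewrite Nu !mxE.
Qed.

Lemma char_poly_trmx (S : comNzRingType) n (M : 'M[S]_n) : char_poly M^T = char_poly M.
Proof.
rewrite /char_poly -[RHS]det_tr; congr (\det _).
by apply/matrixP => i j; rewrite !mxE eq_sym.
Qed.

(** For M u = z u with Re z >= 0, taking moduli in row i gives |z - M i i| |u i| <= sum over j != i of M i j |u j|, and |z - M i i| >= - M i i. *)
Lemma metzler_not_hurwitz n (M : 'M[R]_n) : metzler M -> ~ hurwitz M ->
  exists v : 'cV[R]_n, [/\ forall i, 0 <= v i 0, exists i, 0 < v i 0 &
    forall i, 0 <= (M *m v) i 0].
Proof.
move=> MM; rewrite /hurwitz => /existsNP[z /not_implyP[ez /negP]].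
rewrite -leNgt => rz.
move: ez; rewrite eigenvalue_root_char -char_poly_trmx -eigenvalue_root_char.
move=> /eigenvalueP[u uM u0].
pose w (i : 'I_n) := complex.Re `|u 0 i|.
have nE (x : R[i]) : `|x| = (complex.Re `|x|)%:C%C by rewrite RRe_real ?normr_real.
have n0 (x : R[i]) : 0 <= complex.Re `|x| by rewrite -(@lecR R) -nE rmorph0 normr_ge0.
exists (\col_i w i); split.
- by move=> i; rewrite mxE; exact: n0.
- apply: contrapT => H; move/eqP: u0; apply; apply/rowP => i; rewrite mxE.
  apply/eqP; rewrite -normr_eq0 nE.
  suff -> : complex.Re `|u 0 i| = 0 by [].
  apply/le_anti; rewrite n0 andbT leNgt; apply/negP => h.
  by apply: H; exists i; rewrite mxE.
move=> i; rewrite mxE (bigD1 i)//= mxE.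
have E : (z - (M i i)%:C%C) * u 0 i = \sum_(j | j != i) (M i j)%:C%C * u 0 j.
  have /rowP/(_ i) := uM; rewrite !mxE (bigD1 i)//= !mxE => h.
  rewrite mulrBl -h mulrC addrAC subrr add0r.
  by apply: eq_bigr => j _; rewrite !mxE mulrC.
have h1 : complex.Re `|z - (M i i)%:C%C| * w i <= \sum_(j | j != i) M i j * w j.
  rewrite -(@lecR R) rmorphM/= -!nE -normrM E.
  rewrite rmorph_sum /=; apply: le_trans (ler_norm_sum _ _ _) _.
  rewrite le_eqVlt; apply/orP; left; apply/eqP; apply: eq_bigr => j ji.
  rewrite normrM rmorphM /= -nE; congr (_ * _).
  by rewrite ger0_norm// lecR; apply: MM; rewrite eq_sym.
have h2 : - M i i <= complex.Re `|z - (M i i)%:C%C|.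
  rewrite -(@lecR R) -nE; apply: le_trans (normc_ge_Re _).
  rewrite lecR; apply: le_trans (ler_norm _).
  by case: (z) rz => a b /= a0; rewrite lerDr.
rewrite (eq_bigr (fun j => M i j * w j)) => [|j _]; last by rewrite mxE.
rewrite -lerBlDl sub0r -mulNr; apply: le_trans h1.
by apply: ler_wpM2r => //; exact: n0.
Qed.

Lemma horner_adj_char n (M : 'M[R]_n) (s : R) i j :
  (\adj (char_poly_mx M) i j).[s] = \adj (s%:M - M) i j.
Proof.
have -> : s%:M - M = map_mx (horner_eval s) (char_poly_mx M).
  apply/matrixP => k l; rewrite !mxE /horner_eval hornerD hornerN hornerC.
  by rewrite hornerMn hornerX.
by rewrite -map_mx_adj [RHS]mxE.
Qed.

Lemma horner_char n (M : 'M[R]_n) (s : R) : (char_poly M).[s] = \det (s%:M - M).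
Proof.
have -> : s%:M - M = map_mx (horner_eval s) (char_poly_mx M).
  apply/matrixP => k l; rewrite !mxE /horner_eval hornerD hornerN hornerC.
  by rewrite hornerMn hornerX.
by rewrite det_map_mx.
Qed.

(** Let s0 be the infimum of the s >= 0 such that M v < s v for some v > 0. For s > s0 the solution x of (s - M) x = 1 is nonnegative. It is a rational function of s without pole on [0, +oo[ since M is Hurwitz, so it stays nonnegative at s0, and then positive. Thus s0 itself is admissible; the condition being open, s0 = 0. *)
Lemma metzler_hurwitz n (M : 'M[R]_n) : metzler M -> hurwitz M ->
  exists v : 'cV[R]_n, (forall i, 0 < v i 0) /\ (forall i, (M *m v) i 0 < 0).
Proof.
move=> MM hM.
have det0 s : 0 <= s -> (char_poly M).[s] != 0.
  move=> s0; apply/negP => ps; have := hM s%:C%C.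
  rewrite eigenvalue_root_char -map_char_poly fmorph_root /root ps /= => /(_ isT).
  by rewrite ltNge s0.
pose dominated s := exists v : 'cV[R]_n, (forall i, 0 < v i 0) /\ (forall i, (M *m v) i 0 < s * v i 0).
suff [v [v0 Mv]] : dominated 0.
  by exists v; split => // i; have := Mv i; rewrite mul0r.
pose S := [set s : R | 0 <= s /\ dominated s].
have up s s' : s <= s' -> dominated s -> dominated s'.
  move=> ss [v [v0 Mv]]; exists v; split => // i; apply: lt_le_trans (Mv i) _.
  by rewrite ler_wpM2r// ltW.
have S0 : S !=set0.
  exists (1 + \sum_i \sum_j `|M i j|); split.
    by rewrite addr_ge0// sumr_ge0// => i _; apply: sumr_ge0.
  exists (const_mx 1); split => [i|i]; first by rewrite mxE.
  rewrite !mxE mulr1; apply: le_lt_trans (_ : \sum_i \sum_j `|M i j| < _); last by rewrite ltrDr.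
  apply: le_trans (_ : \sum_j `|M i j| <= _).
    by apply: ler_sum => j _; rewrite mxE mulr1 ler_norm.
  rewrite [leRHS](bigD1 i)//=; apply: ler_wpDr => //.
  by apply: sumr_ge0 => k _; apply: sumr_ge0.
have Slb : lbound S 0 by move=> s [].
have hS : has_inf S by split => //; exists 0.
pose s0 := inf S.
have s00 : 0 <= s0 by apply: lb_le_inf.
have gt_dominated s : s0 < s -> dominated s.
  move=> ss; have [|s' [_ gs'] s's] := @inf_adherent _ S (s - s0) _ hS.
    by rewrite subr_gt0.
  by apply: up gs'; rewrite addrC subrK in s's; exact: ltW.
pose q i := \sum_j \adj (char_poly_mx M) i j.
pose X s : 'cV[R]_n := invmx (s%:M - M) *m const_mx 1.
have XE s i : 0 <= s -> X s i 0 = (q i).[s] / (char_poly M).[s].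
  move=> ss; have us : s%:M - M \in unitmx.
    by rewrite unitmxE unitfE -horner_char; exact: det0.
  rewrite /X /invmx us -scalemxAl mxE mulrC -horner_char; congr (_ / _).
  rewrite mxE /q horner_sum; apply: eq_bigr => j _.
  by rewrite horner_adj_char [X in _ * X]mxE mulr1.
have NX s : 0 <= s -> (s%:M - M) *m X s = const_mx 1.
  move=> ss; rewrite /X mulmxA mulmxV ?mul1mx//.
  by rewrite unitmxE unitfE -horner_char; exact: det0.
have X0 s : s0 < s -> forall i, 0 <= X s i 0.
  move=> ss; have [v [v0 Mv]] := gt_dominated s ss.
  apply: (@zmatrix_mono R n (s%:M - M) v) => //.
  - move=> i j ij; rewrite !mxE (negbTE ij) mulr0n sub0r oppr_le0; exact: MM.
  - move=> i; rewrite mulmxBl mul_scalar_mx mxE [X in 0 < X + _]mxE [X in 0 < _ + X]mxE subr_gt0.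
    exact: Mv.
  - by move=> i; rewrite NX ?mxE// (le_trans s00)// ltW.
have X00 i : 0 <= X s0 i 0.
  rewrite leNgt; apply/negP => xn.
  pose f s := (q i).[s] / (char_poly M).[s].
  have cf : {for s0, continuous f}.
    apply: cvgM; first exact: continuous_horner.
    by apply: cvgV; [exact: det0|exact: continuous_horner].
  have fn : f s0 < 0 by rewrite /f -XE.
  have [e /= e0 He] := cvgr_lt _ cf _ fn.
  have : f (s0 + e / 2) < 0.
    apply: He; rewrite /ball_ /= opprD addrA subrr sub0r normrN gtr0_norm ?divr_gt0//.
    by rewrite ltr_pdivrMr// ltr_pMr// ltr1n.
  rewrite /f -XE; last by rewrite addr_ge0// divr_ge0// ltW.
  by rewrite ltNge X0// ltrDl divr_gt0.
have NXi i : s0 * X s0 i 0 - (M *m X s0) i 0 = 1.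
  have /colP/(_ i) := NX s0 s00.
  by rewrite mulmxBl mul_scalar_mx mxE [X in X + _]mxE [X in _ + X]mxE [RHS]mxE.
have dominated0 : dominated s0.
  exists (X s0); split => i; last first.
    by rewrite -subr_gt0 NXi.
  rewrite lt_neqAle X00 andbT; apply/negP => /eqP xi.
  have := NXi i; rewrite -xi mulr0 sub0r => /eqP; rewrite eqr_oppLR => /eqP h.
  have : 0 <= (M *m X s0) i 0.
    rewrite mxE; apply: sumr_ge0 => j _; have [<-|ij] := eqVneq i j.
      by rewrite -xi mulr0.
    by rewrite mulr_ge0// MM.
  by rewrite h oppr_ge0 ler10.
have [v [v0 Mv]] := dominated0.
pose m := \big[Num.max/0]_i ((M *m v) i 0 / v i 0).
move: s00; rewrite le_eqVlt => /predU1P[->//|s0p].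
have ms : m < s0.
  by apply: bigmax_lt => // i _; rewrite ltr_pdivrMr.
have m0 : 0 <= m by exact: bigmax_ge_id.
have Ss : S ((m + s0) / 2).
  split; first by rewrite divr_ge0// addr_ge0// ltW.
  exists v; split => // i; rewrite -ltr_pdivrMr//.
  apply: le_lt_trans (_ : m < _); last by lra.
  by apply: (@le_bigmax _ _ _ _ (fun i => (M *m v) i 0 / v i 0)).
have : s0 <= (m + s0) / 2 by apply: ge_inf => //; exists 0.
lra.
Qed.
End Metzler.

(** * Trajectories of the coupled system *)

Section Trajectory.
Context {R : realType}.

Definition rowdot m n (A : 'M[R]_(m, n)) (x : 'I_n -> R) (i : 'I_m) : R :=
  \sum_j A i j * x j.

Lemma rowdot_le m n (A : 'M[R]_(m, n)) x y i : nonneg_mx A ->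
  (forall j, x j <= y j) -> rowdot A x i <= rowdot A y i.
Proof. by move=> A0 xy; apply: ler_sum => j _; rewrite ler_wpM2l. Qed.

Lemma rowdotZ m n (A : 'M[R]_(m, n)) (c : R) x i :
  rowdot A (fun j => c * x j) i = c * rowdot A x i.
Proof. by rewrite /rowdot mulr_sumr; apply: eq_bigr => j _; rewrite mulrCA. Qed.

Lemma rowdotN m n (A : 'M[R]_(m, n)) x i : rowdot A (fun j => - x j) i = - rowdot A x i.
Proof. by rewrite /rowdot -sumrN; apply: eq_bigr => j _; rewrite mulrN. Qed.

Lemma rowdotB m n (A : 'M[R]_(m, n)) x y i :
  rowdot A (fun j => x j - y j) i = rowdot A x i - rowdot A y i.
Proof. by rewrite /rowdot -sumrB; apply: eq_bigr => j _; rewrite mulrBr. Qed.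

Lemma rowdot_ge0 m n (A : 'M[R]_(m, n)) x i : nonneg_mx A ->
  (forall j, 0 <= x j) -> 0 <= rowdot A x i.
Proof. by move=> A0 x0; apply: sumr_ge0 => j _; rewrite mulr_ge0. Qed.

Lemma sum_continuous (I : finType) (f : I -> R -> R) : (forall j, continuous (f j)) ->
  continuous (fun t => \sum_j f j t).
Proof.
move=> cf; elim: (index_enum I) => [|j s IH].
  by under eq_fun do rewrite big_nil; exact: cst_continuous.
under eq_fun do rewrite big_cons.
by move=> x; apply: cvgD; [exact: cf|exact: IH].
Qed.

Lemma rowdot_continuous m n (A : 'M[R]_(m, n)) (x : 'I_n -> R -> R) i :
  (forall j, continuous (x j)) -> continuous (fun t => rowdot A (x^~ t) i).
Proof. by move=> cx; apply: sum_continuous => j; exact: continuous_cmul. Qed.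

(** Among the finitely many components that fail, take the one whose first zero comes earliest. *)
Lemma first_failure (I : finType) (p : I -> R -> R) : (forall i, continuous (p i)) ->
  (forall i, 0 < p i 0) -> (exists i t, 0 <= t /\ p i t <= 0) ->
  exists k t, [/\ 0 < t, p k t = 0 & forall j s, 0 <= s <= t -> 0 <= p j s].
Proof.
move=> cp p0 [i1 [t1 [t10 pt1]]].
pose P i := `[< exists t, 0 <= t /\ p i t <= 0 >].
have H i : exists t, P i -> [/\ 0 < t, p i t = 0 & forall s, 0 <= s < t -> 0 < p i s].
  have [/asboolP [t [t0 pt]]|nP] := boolP (P i); last by exists 0.
  by have [u [u0 pu up]] := first_zero (cp i) (p0 i) t0 pt; exists u.
have /choice[z zP] := H.
have Pi1 : P i1 by apply/asboolP; exists t1.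
case: (@arg_minP _ _ _ i1 P z Pi1) => k Pk zk.
have [zk0 pzk _] := zP k Pk; exists k, (z k); split => // j s /andP[s0 sz].
have [Pj|nPj] := boolP (P j).
  have [_ pzj zj] := zP j Pj.
  have := le_trans sz (zk j Pj); rewrite le_eqVlt => /predU1P[->|szj].
    by rewrite pzj.
  by apply/ltW/zj; rewrite s0.
rewrite leNgt; apply: contra nPj => pjs; apply/asboolP; exists s.
by split => //; exact: ltW.
Qed.

Lemma eventually_forall (I : finType) (P : I -> R -> Prop) :
  (forall i, exists T, forall t, T <= t -> P i t) ->
  exists T, forall t, T <= t -> forall i, P i t.
Proof.
move=> /choice[z zP]; exists (\big[Num.max/0]_i z i) => t Tt i.
by apply: zP; apply: le_trans Tt; exact: le_bigmax.
Qed.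

Definition rhs d n (A B : 'M[R]_d) (E : 'M[R]_(d, n)) (t1 t2 : R -> R)
    (x : 'I_d -> R -> R) (y : 'I_n -> R -> R) (i : 'I_d) (t : R) : R :=
  rowdot A (x^~ t) i + rowdot B (x^~ (t - t1 t)) i + rowdot E (y^~ (t - t2 t)) i.

(** A solution in Volterra form. The functions and the delays are defined on the whole line; only the equations for t >= 0 are imposed. *)
Definition trajectory d n (alpha : 'I_d -> R) (A B : 'M[R]_d) (E : 'M[R]_(d, n))
    (C : 'M[R]_(n, d)) (D : 'M[R]_n) (t1 t2 t3 : R -> R)
    (x : 'I_d -> R -> R) (y : 'I_n -> R -> R) : Prop :=
  [/\ forall i, continuous (x i), forall i, continuous (y i),
      forall i t, 0 <= t -> x i t = x i 0 + kappa (alpha i) *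
        cconv (pker (alpha i)) (rhs A B E t1 t2 x y i) t
    & forall i t, 0 <= t -> y i t = rowdot C (x^~ t) i + rowdot D (y^~ (t - t3 t)) i].

Lemma rhs_continuous d n (A B : 'M[R]_d) (E : 'M[R]_(d, n)) t1 t2 x y i :
  continuous t1 -> continuous t2 -> (forall i, continuous (x i)) -> (forall i, continuous (y i)) ->
  continuous (rhs A B E t1 t2 x y i).
Proof.
move=> ct1 ct2 cx cy.
have comp (f t0 : R -> R) : continuous f -> continuous t0 -> continuous (fun t => f (t - t0 t)).
  move=> cf ct t; apply: (continuous_comp (f := fun t => t - t0 t) (g := f)); last exact: cf.
  by apply: cvgB; [exact: cvg_id|exact: ct].
move=> t; apply: cvgD; [apply: cvgD|].
- exact: rowdot_continuous.
- by apply: (@rowdot_continuous _ _ _ (fun j t => x j (t - t1 t))) => j; exact: comp.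
- by apply: (@rowdot_continuous _ _ _ (fun j t => y j (t - t2 t))) => j; exact: comp.
Qed.

Lemma rhsN d n (A B : 'M[R]_d) (E : 'M[R]_(d, n)) t1 t2 x y i t :
  rhs A B E t1 t2 (fun j s => - x j s) (fun j s => - y j s) i t = - rhs A B E t1 t2 x y i t.
Proof. by rewrite /rhs !rowdotN !opprD. Qed.

Lemma trajectoryN d n alpha A B E C D t1 t2 t3 (x : 'I_d -> R -> R) (y : 'I_n -> R -> R) :
  (forall i, 0 < alpha i <= 1) -> continuous t1 -> continuous t2 ->
  trajectory alpha A B E C D t1 t2 t3 x y ->
  trajectory alpha A B E C D t1 t2 t3 (fun i t => - x i t) (fun i t => - y i t).
Proof.
move=> a01 ct1 ct2 [cx cy xE yE]; split.
- by move=> i t; apply: cvgN; exact: cx.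
- by move=> i t; apply: cvgN; exact: cy.
- move=> i t t0; rewrite xE// opprD -mulrN; congr (_ + _ * _).
  have /andP[a0 _] := a01 i.
  rewrite -mulN1r -cconvZ; [|exact: lockernel_pker|exact: rhs_continuous].
  by apply: eq_cconv => // s _; rewrite rhsN mulN1r.
- by move=> i t t0; rewrite yE// opprD !rowdotN.
Qed.

Lemma rowdot_diag d (A : 'M[R]_d) x i :
  rowdot A x i = A i i * x i + \sum_(j | j != i) A i j * x j.
Proof. by rewrite /rowdot (bigD1 i). Qed.

End Trajectory.

(** * Decay of trajectories *)

Section Decay.
Context {R : realType}.

(** The constant state (v, w) strictly dominates its own evolution. *)
Definition supersolution d n (A B : 'M[R]_d) (E : 'M[R]_(d, n)) (C : 'M[R]_(n, d)) (D : 'M[R]_n)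
    (v : 'I_d -> R) (w : 'I_n -> R) : Prop :=
  [/\ forall i, 0 < v i, forall i, 0 < w i,
      forall i, rowdot A v i + rowdot B v i + rowdot E w i < 0 &
      forall i, rowdot C v i + rowdot D w i < w i].

(** All the other contributions to row i of A v + B v + E w are nonnegative. *)
Lemma supersolution_diag d n (A B : 'M[R]_d) (E : 'M[R]_(d, n)) C D v w i :
  metzler A -> nonneg_mx B -> nonneg_mx E -> supersolution A B E C D v w -> A i i < 0.
Proof.
move=> hA hB hE [v0 w0 Hv _]; have := Hv i.
have h1 : 0 <= rowdot B v i by apply: rowdot_ge0 => // j; exact: ltW.
have h2 : 0 <= rowdot E w i by apply: rowdot_ge0 => // j; exact: ltW.
have h3 : 0 <= \sum_(j | j != i) A i j * v j.
  by apply: sumr_ge0 => j ji; rewrite mulr_ge0 ?(ltW (v0 _))// hA// eq_sym.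
rewrite rowdot_diag => h; have : A i i * v i < 0 by lra.
by rewrite pmulr_llt0.
Qed.

(** At a first contact of x i with v i, the difference v i - x i solves a scalar equation with rate - A i i and nonnegative forcing, so [volterra_ge] keeps it positive. A contact of y i with w i contradicts C v + D w < w directly. *)
Lemma trajectory_upper d n (alpha : 'I_d -> R) (A B : 'M[R]_d) (E : 'M[R]_(d, n))
    (C : 'M[R]_(n, d)) (D : 'M[R]_n) (t1 t2 t3 : R -> R) (v : 'I_d -> R) (w : 'I_n -> R)
    (x : 'I_d -> R -> R) (y : 'I_n -> R -> R) :
  (forall i, 0 < alpha i <= 1) ->
  metzler A -> nonneg_mx B -> nonneg_mx C -> nonneg_mx D -> nonneg_mx E ->
  continuous t1 -> continuous t2 ->
  (forall t, 0 <= t1 t) -> (forall t, 0 <= t2 t) -> (forall t, 0 <= t3 t) ->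
  supersolution A B E C D v w -> trajectory alpha A B E C D t1 t2 t3 x y ->
  (forall i s, s <= 0 -> x i s < v i) -> (forall i s, s <= 0 -> y i s < w i) ->
  forall t, (forall i, x i t <= v i) /\ (forall i, y i t <= w i).
Proof.
move=> a01 hA hB hC hD hE ct1 ct2 t10 t20 t30 sub tr xv yw.
have [v0 w0 Hv Hw] := sub; have [cx cy xE yE] := tr.
pose p (k : 'I_d + 'I_n) t := match k with inl i => v i - x i t | inr i => w i - y i t end.
have cp k : continuous (p k).
  by case: k => i t; apply: cvgB; try exact: cvg_cst; [exact: cx|exact: cy].
have pneg k s : s <= 0 -> 0 < p k s by case: k => i s0; rewrite subr_gt0; [exact: xv|exact: yw].
suff H t : 0 <= t -> forall k, 0 <= p k t.
  move=> t; have h k : 0 <= p k t.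
    by have [/H|/ltW /(pneg k) /ltW] := leP 0 t.
  by split => i; rewrite -subr_ge0; [exact: (h (inl i))|exact: (h (inr i))].
move=> t0 k0; rewrite leNgt; apply/negP => ptk.
have [|k [z [z0 pz pj]]] := first_failure cp (fun k => pneg k 0 (lexx 0)).
  by exists k0, t; split => //; exact: ltW.
have {}pj j s : s <= z -> 0 <= p j s.
  by move=> sz; have [s0|/ltW /(pneg j) /ltW//] := leP 0 s; apply: pj; rewrite s0.
have xle j s : s <= z -> x j s <= v j by move=> /(pj (inl j)); rewrite subr_ge0.
have yle j s : s <= z -> y j s <= w j by move=> /(pj (inr j)); rewrite subr_ge0.
have dl (f : R -> R) s : (forall t, 0 <= f t) -> s <= z -> s - f s <= z.
  by move=> f0 sz; rewrite (le_trans _ sz)// gerBl.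
case: k pz => i /= pz; last first.
  move: pz; rewrite (yE _ _ (ltW z0)) => pz.
  have h1 : rowdot C (x^~ z) i <= rowdot C v i by apply: rowdot_le => // j; exact: xle.
  have h2 : rowdot D (y^~ (z - t3 z)) i <= rowdot D w i.
    by apply: rowdot_le => // j; apply: yle; exact: dl.
  have := Hw i; lra.
have Aii := supersolution_diag i hA hB hE sub.
pose m := - A i i; have m0 : 0 < m by rewrite oppr_gt0.
pose u t := v i - x i t.
have cu : continuous u := cp (inl i).
have cr := @rhs_continuous R d n A B E t1 t2 x y i ct1 ct2 cx cy.
pose F t := m * u t - rhs A B E t1 t2 x y i t.
have cF : continuous F by move=> y0; apply: cvgB; [exact: continuous_cmul|exact: cr].
have [al0 al1] := andP (a01 i).
have k0' := kappa_gt0 (a01 i).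
have [s cs sE] := resolvent_exists (kappa (alpha i) * m) (a01 i).
have := @volterra_ge R (alpha i) (kappa (alpha i)) m z u F s (a01 i) k0' m0 cu cF cs sE.
have u00 : 0 < u 0 by exact: (pneg (inl i) 0).
move=> /(_ (ltW u00)) H.
have sp := resolvent_gt0 (a01 i) (mulr_gt0 k0' m0) cs sE (ltW z0).
have : u 0 * s z <= u z.
  apply: H; last by rewrite lexx ltW.
  - move=> t' /andP[t'0 t'z]; rewrite /F /rhs /u rowdot_diag /m.
    have h1 : rowdot B (x^~ (t' - t1 t')) i <= rowdot B v i.
      by apply: rowdot_le => // j; apply: xle; exact: dl.
    have h2 : rowdot E (y^~ (t' - t2 t')) i <= rowdot E w i.
      by apply: rowdot_le => // j; apply: yle; exact: dl.
    have h3 : \sum_(j | j != i) A i j * x j t' <= \sum_(j | j != i) A i j * v j.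
      apply: ler_sum => j ji; rewrite ler_wpM2l ?xle//; apply: hA; by rewrite eq_sym.
    have := Hv i; rewrite rowdot_diag; lra.
  - move=> t' /andP[t'0 t'z]; rewrite {1}/u xE// /u.
    rewrite opprD addrA -mulrN; congr (_ + _ * _).
    rewrite -mulN1r -cconvZ; [|exact: lockernel_pker|exact: cr].
    by apply: eq_cconv => // s' _; rewrite /F /u mulN1r; ring.
rewrite -[u z]/(p (inl i) z) /= pz leNgt => /negP; apply.
exact: mulr_gt0.
Qed.

(** Once all delayed arguments exceed T, every term except the diagonal one is bounded by rho times its value at (v, w), so [volterra_limsup] gives the limiting bound (1 - eta) rho v; half of eta is given up to reach it in finite time. *)
Lemma trajectory_contract d n (alpha : 'I_d -> R) (A B : 'M[R]_d) (E : 'M[R]_(d, n))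
    (C : 'M[R]_(n, d)) (D : 'M[R]_n) (t1 t2 t3 : R -> R) (v : 'I_d -> R) (w : 'I_n -> R)
    (x : 'I_d -> R -> R) (y : 'I_n -> R -> R)
    (eta rho0 rho T : R) :
  (forall i, 0 < alpha i <= 1) ->
  metzler A -> nonneg_mx B -> nonneg_mx C -> nonneg_mx D -> nonneg_mx E ->
  continuous t1 -> continuous t2 ->
  supersolution A B E C D v w -> trajectory alpha A B E C D t1 t2 t3 x y ->
  (forall M : R, exists T', forall t, T' <= t -> [/\ M <= t - t1 t, M <= t - t2 t & M <= t - t3 t]) ->
  0 < eta < 1 -> 0 < rho ->
  (forall i, \sum_(j | j != i) A i j * v j + rowdot B v i + rowdot E w i <= (1 - eta) * (- A i i * v i)) ->
  (forall i, rowdot C v i + rowdot D w i <= (1 - eta) * w i) ->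
  (forall t, (forall i, x i t <= rho0 * v i) /\ (forall i, y i t <= rho0 * w i)) ->
  (forall t, T <= t -> (forall i, x i t <= rho * v i) /\ (forall i, y i t <= rho * w i)) ->
  exists T', forall t, T' <= t ->
    (forall i, x i t <= (1 - eta / 2) * rho * v i) /\ (forall i, y i t <= (1 - eta / 2) * rho * w i).
Proof.
move=> a01 hA hB hC hD hE ct1 ct2 sub tr dl /andP[eta0 eta1] rho_gt0 etaA etaC b0 bT.
have [v0 w0 Hv Hw] := sub; have [cx cy xE yE] := tr.
have [T1 HT1] := dl (Num.max T 0).
pose T2 := Num.max (Num.max T 0) T1.
have T2T t : T2 <= t -> [/\ 0 <= t, T <= t, T <= t - t1 t, T <= t - t2 t & T <= t - t3 t].
  rewrite /T2 !ge_max => /andP[/andP[Tt t0] /HT1[]]; rewrite !ge_max.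
  by move=> /andP[h1 _] /andP[h2 _] /andP[h3 _].
have Y t i : T2 <= t -> y i t <= (1 - eta / 2) * rho * w i.
  move=> /T2T[t0 Tt _ _ h3]; rewrite yE//.
  have e1 : rowdot C (x^~ t) i <= rho * rowdot C v i.
    by rewrite -rowdotZ; apply: rowdot_le => // j; apply: (bT t Tt).1.
  have e2 : rowdot D (y^~ (t - t3 t)) i <= rho * rowdot D w i.
    by rewrite -rowdotZ; apply: rowdot_le => // j; apply: (bT _ h3).2.
  apply: le_trans (lerD e1 e2) _; rewrite -mulrDr.
  apply: le_trans (_ : rho * ((1 - eta) * w i) <= _); first by rewrite ler_wpM2l// ltW.
  rewrite mulrA (mulrC rho) ler_wpM2r ?(ltW (w0 _))// ler_wpM2r ?(ltW rho_gt0)//.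
  by lra.
have X i : exists T', forall t, T' <= t -> x i t <= (1 - eta / 2) * rho * v i.
  have Aii := supersolution_diag i hA hB hE sub.
  pose m := - A i i; have m0 : 0 < m by rewrite oppr_gt0.
  have cr := @rhs_continuous R d n A B E t1 t2 x y i ct1 ct2 cx cy.
  pose F t := m * x i t + rhs A B E t1 t2 x y i t.
  have cF : continuous F by move=> y0; apply: cvgD; [exact: continuous_cmul|exact: cr].
  have FE t : F t = \sum_(j | j != i) A i j * x j t + rowdot B (x^~ (t - t1 t)) i + rowdot E (y^~ (t - t2 t)) i.
    rewrite /F /rhs rowdot_diag /m; ring.
  have Fb (r0 t : R) : (forall j, x j t <= r0 * v j) ->
      (forall j, x j (t - t1 t) <= r0 * v j) -> (forall j, y j (t - t2 t) <= r0 * w j) ->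
      F t <= r0 * (\sum_(j | j != i) A i j * v j + rowdot B v i + rowdot E w i).
    move=> h1 h2 h3; rewrite FE !mulrDr; apply: lerD; [apply: lerD|].
    - rewrite mulr_sumr; apply: ler_sum => j ji; rewrite mulrCA ler_wpM2l//.
      by apply: hA; rewrite eq_sym.
    - by rewrite -rowdotZ; exact: rowdot_le.
    - by rewrite -rowdotZ; exact: rowdot_le.
  have T20 : 0 <= T2 by rewrite /T2 !le_max lexx orbT.
  have e0 : 0 < eta / 2 * rho * v i by rewrite !mulr_gt0// divr_gt0.
  have V := @volterra_limsup R (alpha i) (kappa (alpha i)) m
    (rho0 * (\sum_(j | j != i) A i j * v j + rowdot B v i + rowdot E w i))
    (rho * ((1 - eta) * (m * v i))) T2
    (x i) F (a01 i) (kappa_gt0 (a01 i)) m0 (cx i) cF T20.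
  have [|||T' HT'] := V _ _ _ _ e0.
  - move=> t t0; rewrite xE//; congr (_ + _ * _); apply: eq_cconv => // s _.
    by rewrite /F addrC addKr.
  - move=> t t0; apply: (Fb rho0) => j.
    + exact: (b0 t).1.
    + exact: (b0 _).1.
    + exact: (b0 _).2.
  - move=> t /T2T[t0 Tt h1 h2 _]; apply: le_trans (Fb rho t _ _ _) _.
    + exact: (bT t Tt).1.
    + exact: (bT _ h1).1.
    + exact: (bT _ h2).2.
    + by rewrite ler_wpM2l ?(ltW rho_gt0)//; exact: etaA.
  exists T' => t /HT' h; apply: le_trans h _.
  by rewrite le_eqVlt; apply/orP; left; apply/eqP; field; rewrite gt_eqF.
have [T' HT'] := eventually_forall X.
exists (Num.max T2 T') => t; rewrite ge_max => /andP[h1 h2]; split => i.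
  exact: HT'.
exact: Y.
Qed.

Lemma supersolution_margin d n (A B : 'M[R]_d) (E : 'M[R]_(d, n)) C D v w :
  metzler A -> nonneg_mx B -> nonneg_mx E ->
  supersolution A B E C D v w -> exists eta, [/\ 0 < eta < 1,
    forall i, \sum_(j | j != i) A i j * v j + rowdot B v i + rowdot E w i <= (1 - eta) * (- A i i * v i) &
    forall i, rowdot C v i + rowdot D w i <= (1 - eta) * w i].
Proof.
move=> hA hB hE sub; have [v0 w0 Hv Hw] := sub.
have Aii i := supersolution_diag i hA hB hE sub.
pose a i := 1 - (\sum_(j | j != i) A i j * v j + rowdot B v i + rowdot E w i) / (- A i i * v i).
pose b i := 1 - (rowdot C v i + rowdot D w i) / w i.
have Av i : 0 < - A i i * v i by rewrite mulr_gt0// oppr_gt0.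
have a0 i : 0 < a i.
  rewrite subr_gt0 ltr_pdivrMr// mul1r; have := Hv i; rewrite rowdot_diag; lra.
have b0 i : 0 < b i by rewrite subr_gt0 ltr_pdivrMr// mul1r.
pose e := Num.min (\big[Num.min/2^-1]_i a i) (\big[Num.min/2^-1]_i b i).
have e0 : 0 < e by rewrite lt_min; apply/andP; split; apply: lt_bigmin.
have e1 : e <= 2^-1 by rewrite ge_min bigmin_le_id.
exists e; split.
- by rewrite e0 (le_lt_trans e1)// invf_lt1// ltr1n.
- move=> i; rewrite -ler_pdivrMr// -[leLHS](subKr 1) lerD2l lerN2 -/(a i).
  by rewrite ge_min bigmin_le.
- move=> i; rewrite -ler_pdivrMr// -[leLHS](subKr 1) lerD2l lerN2 -/(b i).
  by rewrite ge_min bigmin_le orbT.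
Qed.

Lemma trajectory_decay d n (alpha : 'I_d -> R) (A B : 'M[R]_d) (E : 'M[R]_(d, n))
    (C : 'M[R]_(n, d)) (D : 'M[R]_n) (t1 t2 t3 : R -> R) (v : 'I_d -> R) (w : 'I_n -> R)
    (x : 'I_d -> R -> R) (y : 'I_n -> R -> R) :
  (forall i, 0 < alpha i <= 1) ->
  metzler A -> nonneg_mx B -> nonneg_mx C -> nonneg_mx D -> nonneg_mx E ->
  continuous t1 -> continuous t2 ->
  (forall t, 0 <= t1 t) -> (forall t, 0 <= t2 t) -> (forall t, 0 <= t3 t) ->
  supersolution A B E C D v w -> trajectory alpha A B E C D t1 t2 t3 x y ->
  (forall M : R, exists T', forall t, T' <= t -> [/\ M <= t - t1 t, M <= t - t2 t & M <= t - t3 t]) ->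
  (forall i s, s <= 0 -> `|x i s| < v i) -> (forall i s, s <= 0 -> `|y i s| < w i) ->
  forall e : R, 0 < e -> exists T, forall t, T <= t ->
    (forall i, `|x i t| <= e * v i) /\ (forall i, `|y i t| <= e * w i).
Proof.
move=> a01 hA hB hC hD hE ct1 ct2 t10 t20 t30 sub tr dl xv yw e e0.
have trN := trajectoryN a01 ct1 ct2 tr.
have [eta [eta01 etaA etaC]] := supersolution_margin hA hB hE sub.
have /andP[eta0 eta1] := eta01.
have up := trajectory_upper a01 hA hB hC hD hE ct1 ct2 t10 t20 t30 sub tr
  (fun i s s0 => le_lt_trans (ler_norm _) (xv i s s0))
  (fun i s s0 => le_lt_trans (ler_norm _) (yw i s s0)).
have upN := trajectory_upper a01 hA hB hC hD hE ct1 ct2 t10 t20 t30 sub trN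
  (fun i s s0 => le_lt_trans (ler_norm _) (eq_ind_r (fun z => z < v i) (xv i s s0) (normrN _)))
  (fun i s s0 => le_lt_trans (ler_norm _) (eq_ind_r (fun z => z < w i) (yw i s s0) (normrN _))).
have it k : exists T, forall t, T <= t ->
    [/\ forall i, x i t <= (1 - eta / 2) ^+ k * v i, forall i, y i t <= (1 - eta / 2) ^+ k * w i,
        forall i, - x i t <= (1 - eta / 2) ^+ k * v i & forall i, - y i t <= (1 - eta / 2) ^+ k * w i].
  elim: k => [|k [T IH]].
    exists 0 => t _; rewrite expr0.
    by split => i; rewrite mul1r; [exact: (up t).1|exact: (up t).2|exact: (upN t).1|exact: (upN t).2].
  have r0 : 0 < (1 - eta / 2) ^+ k by rewrite exprn_gt0//; lra.
  have one (z1 : 'I_d -> R -> R) (z2 : 'I_n -> R -> R) : (forall t, (forall i, z1 i t <= v i) /\ (forall i, z2 i t <= w i)) ->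
      (forall t, (forall i, z1 i t <= 1 * v i) /\ (forall i, z2 i t <= 1 * w i)).
    by move=> h t; have [h1 h2] := h t; split => i; rewrite mul1r.
  have [|T1 HT1] := trajectory_contract a01 hA hB hC hD hE ct1 ct2 sub tr dl eta01 r0
    etaA etaC (one x y up) (T := T).
    by move=> t /IH[].
  have [|T2 HT2] := trajectory_contract a01 hA hB hC hD hE ct1 ct2 sub trN dl eta01 r0
    etaA etaC (one (fun i t => - x i t) (fun i t => - y i t) upN) (T := T).
    by move=> t /IH[].
  exists (Num.max T1 T2) => t; rewrite ge_max => /andP[/HT1[h1 h2] /HT2[h3 h4]].
  by rewrite exprS.
have qn : (1 - eta / 2) ^+ k @[k --> \oo] --> (0 : R).
  by apply: cvg_expr; rewrite ger0_norm; lra.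
have /cvgrPdist_lt /(_ e e0)[N _ HN] := qn.
have rN : (1 - eta / 2) ^+ N <= e.
  have := HN N (leqnn N); rewrite /= sub0r normrN => h.
  exact: ltW (le_lt_trans (ler_norm _) h).
have [T HT] := it N; have [v0 w0 _ _] := sub.
exists T => t /HT[h1 h2 h3 h4]; split => i.
- apply: le_trans (_ : (1 - eta / 2) ^+ N * v i <= _); last by rewrite ler_wpM2r// ltW.
  by rewrite ler_norml h1 lerNl h3.
- apply: le_trans (_ : (1 - eta / 2) ^+ N * w i <= _); last by rewrite ler_wpM2r// ltW.
  by rewrite ler_norml h2 lerNl h4.
Qed.

End Decay.

(** * Existence of a nonnegative solution *)

Section Existence.
Context {R : realType}.

Definition pospart (x : R) : R := Num.max x 0.

Lemma pospart_ge0 x : 0 <= pospart x.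
Proof. by rewrite /pospart le_max lexx orbT. Qed.

Lemma pospart_id x : 0 <= x -> pospart x = x.
Proof. by move=> x0; apply/max_idPl. Qed.

Lemma pospart0 : pospart 0 = 0.
Proof. exact: pospart_id. Qed.

Lemma pospart_lipschitz x y : `|pospart x - pospart y| <= `|x - y|.
Proof.
rewrite /pospart; case: (leP x 0) => x0; case: (leP y 0) => y0.
- by rewrite subrr normr0.
- by rewrite sub0r normrN gtr0_norm// ler_normr; apply/orP; right; lra.
- by rewrite subr0 gtr0_norm// ler_normr; apply/orP; left; lra.
- by [].
Qed.

Lemma pospart_continuous (f : R -> R) : continuous f -> continuous (fun t => pospart (f t)).
Proof.
move=> cf t; apply: (continuous_comp (f := f) (g := pospart)); first exact: cf.
exact: max_cst_continuous.
Qed.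

Lemma rowdot_lipschitz m n (A : 'M[R]_(m, n)) x y i (e : R) :
  (forall j, `|x j - y j| <= e) -> `|rowdot A x i - rowdot A y i| <= (\sum_j `|A i j|) * e.
Proof.
move=> xy; rewrite -rowdotB mulr_suml; apply: le_trans (ler_norm_sum _ _ _) _.
by apply: ler_sum => j _; rewrite normrM ler_wpM2l.
Qed.

(** The contraction is run on the system with positive parts. The second components contract because the row sums of D are below 1 and the first components carry the smaller weight om, which damps C; the first components contract by the choice of the exponential weight. Adding and subtracting m, larger than every |A i i|, makes the forcing of the scalar equations nonnegative, so [volterra_ge] gives u >= 0. *)
Lemma positive_solution d n (alpha : 'I_d -> R) (A B : 'M[R]_d) (E : 'M[R]_(d, n))
    (C : 'M[R]_(n, d)) (D : 'M[R]_n) (t1 t2 t3 : R -> R) (p : 'I_d -> R) :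
  (forall i, 0 < alpha i <= 1) ->
  metzler A -> nonneg_mx B -> nonneg_mx C -> nonneg_mx D -> nonneg_mx E ->
  (forall i, \sum_k `|C i k| < 1) -> (forall i, \sum_j `|D i j| < 1) ->
  continuous t1 -> continuous t2 -> continuous t3 ->
  (forall t, 0 <= t1 t) -> (forall t, 0 <= t2 t) -> (forall t, 0 <= t3 t) ->
  (forall i, 0 <= p i) ->
  exists (u : 'I_d -> R -> R) (z : 'I_n -> R -> R),
   [/\ (forall i, continuous (u i)) /\ (forall i, continuous (z i)),
      (forall i t, t <= 0 -> u i t = 0) /\ (forall i t, t <= 0 -> z i t = 0),
      (forall i t, 0 <= t -> 0 <= u i t),
      (forall i t, 0 <= t -> u i t = kappa (alpha i) *
        cconv (pker (alpha i)) (fun s => rhs A B E t1 t2 u z i s + p i) t)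
    & (forall i t, 0 <= t -> z i t = rowdot C (u^~ t) i + rowdot D (z^~ (t - t3 t)) i)].
Proof.
move=> a01 hA hB hC hD hE hCs hDs ct1 ct2 ct3 t10 t20 t30 p0.
pose m := 1 + \sum_i `|A i i|.
have m1 : 1 <= m by rewrite lerDl sumr_ge0.
have m0 : 0 < m by exact: lt_le_trans m1.
(* A Metzler matrix becomes nonnegative after this shift. *)
pose Am := A + m%:M.
have Am0 : nonneg_mx Am.
  move=> i j; rewrite !mxE; have [<-|ij] := eqVneq i j; last by rewrite mulr0n addr0 hA.
  rewrite mulr1n /m (bigD1 i)//=.
  have h1 := ler_norm (- A i i); rewrite normrN in h1.
  have h2 : 0 <= \sum_(k | k != i) `|A k k| by apply: sumr_ge0.
  lra.
have Aml (x : 'I_d -> R) i : rowdot Am x i = rowdot A x i + m * x i.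
  rewrite /rowdot /Am; under eq_bigr do rewrite !mxE mulrDl.
  rewrite big_split /=; congr (_ + _).
  rewrite (bigD1 i)//= eqxx mulr1n big1 ?addr0// => j ji.
  by rewrite eq_sym (negbTE ji) mulr0n mul0r.
have comp (f t0 : R -> R) : continuous f -> continuous t0 -> continuous (fun t => f (t - t0 t)).
  move=> cf ct t; apply: (continuous_comp (f := fun t => t - t0 t) (g := f)); last exact: cf.
  by apply: cvgB; [exact: cvg_id|exact: ct].
pose F (X : 'I_d + 'I_n -> R -> R) i t : R :=
  rhs Am B E t1 t2 (fun j t => pospart (X (inl j) t)) (fun j t => pospart (X (inr j) t)) i t + p i.
pose T (X : 'I_d + 'I_n -> R -> R) k t : R := match k with
  | inl i => kappa (alpha i) * cconv (pker (alpha i)) (fun s => F X i s - m * X (inl i) s) t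
  | inr i => rowdot C (fun j => pospart (X (inl j) t)) i +
             rowdot D (fun j => pospart (X (inr j) (t - t3 t))) i end.
have cF X i : causal_family X -> continuous (F X i).
  move=> gX t; apply: cvgD; last exact: cvg_cst.
  by apply: rhs_continuous => // j; apply: pospart_continuous; exact: (gX _).1.
have cG X i : causal_family X -> continuous (fun s => F X i s - m * X (inl i) s).
  by move=> gX t; apply: cvgB; [exact: cF|apply: continuous_cmul; exact: (gX _).1].
pose dm := \big[Num.max/0]_i \sum_j `|D i j|.
have dm0 : 0 <= dm by exact: bigmax_ge_id.
have dm1 : dm < 1 by apply: bigmax_lt.
(* om * 1 + dm = th < 1 is the contraction rate of the second components, and th >= 1 / 2 is the one required of the first components. *)
pose om := (1 - dm) / 2; pose th := (1 + dm) / 2.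
have om0 : 0 < om by rewrite divr_gt0// subr_gt0.
have om1 : om <= 1 by rewrite /om; lra.
have th01 : 0 <= th < 1 by rewrite /th; apply/andP; split; lra.
have th2 : 2^-1 <= th by rewrite /th; lra.
pose L i := \sum_j `|Am i j| + \sum_j `|B i j| + \sum_j `|E i j| + m.
have L1 i : 1 <= L i by rewrite /L ler_wpDl// !addr_ge0// sumr_ge0.
have L0 i : 0 < L i by exact: lt_le_trans (L1 i).
have kap i := kappa_gt0 (a01 i).
have qi0 i : 0 < om / 2 / (kappa (alpha i) * L i).
  by apply: divr_gt0; [exact: divr_gt0|exact: mulr_gt0].
have H i : exists b0 : R, forall b, b0 <= b -> forall t,
    cconv (pker (alpha i)) (fun s => expR (b * s)) t <= om / 2 / (kappa (alpha i) * L i) * expR (b * t).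
  by have [b0 _ h] := cconv_expR_small (a01 i) (qi0 i); exists b0.
have /choice[bi bP] := H.
pose b := \big[Num.max/1]_i bi i.
have b0 : 0 < b by apply: lt_le_trans ltr01 _; exact: bigmax_ge_id.
have bE i t : kappa (alpha i) * (L i * cconv (pker (alpha i)) (fun s => expR (b * s)) t) <= om / 2 * expR (b * t).
  apply: le_trans (_ : kappa (alpha i) * (L i * (om / 2 / (kappa (alpha i) * L i) * expR (b * t))) <= _).
    rewrite ler_pM2l// ler_pM2l//; apply: bP; exact: le_bigmax.
  by rewrite le_eqVlt; apply/orP; left; apply/eqP; field; rewrite !gt_eqF.
have cE : continuous (fun s => expR (b * s)) := @expRM_continuous R b.
pose W (k : 'I_d + 'I_n) t : R := (match k with inl _ => om | inr _ => 1 end) * expR (b * t).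
have mono (f : R -> R) s : 0 <= f s -> expR (b * (s - f s)) <= expR (b * s).
  by move=> f0; rewrite ler_expR ler_pM2l// gerBl.
have ka i : lockernel (pker (alpha i)) by apply: lockernel_pker; case/andP: (a01 i).
have [X gX XE] : exists2 X, causal_family X & forall k t, X k t = T X k t.
  apply: (@picard R _ T W th (\sum_i p i)) => //.
  - by case=> i; apply: continuous_cmul.
  - by case=> i t; apply: mulr_gt0 => //; exact: expR_gt0.
  - move=> Y gY [] i; split.
    + by apply: continuous_cmul; apply: cconv_continuous => //; exact: cG.
    + by move=> t t0; rewrite /T cconv_le0// mulr0.
    + move=> t; apply: cvgD.
        by apply: (@rowdot_continuous _ _ _ C (fun j t => pospart (Y (inl j) t))) => j;
          apply: pospart_continuous; exact: (gY _).1.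
      apply: (@rowdot_continuous _ _ _ D (fun j t => pospart (Y (inr j) (t - t3 t)))) => j.
      by apply: (comp (fun t => pospart (Y (inr j) t))) => //; apply: pospart_continuous; exact: (gY _).1.
    + move=> t tle; rewrite /T /rowdot !big1 ?addr0// => j _.
        by rewrite (gY _).2 ?pospart0 ?mulr0// (le_trans _ tle)// gerBl.
      by rewrite (gY _).2 ?pospart0 ?mulr0.
  - case=> i t; rewrite /T /W.
      have -> : cconv (pker (alpha i)) (fun s => F (fun=> fun=> 0) i s - m * 0) t =
          cconv (pker (alpha i)) (fun=> p i) t.
        apply: eq_cconv => // s _; rewrite /F /rhs /rowdot mulr0 subr0.
        by rewrite !big1 ?addr0 ?add0r// => j _; rewrite pospart0 mulr0.
      rewrite normrM (ger0_norm (ltW (kap i))).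
      apply: le_trans (_ : kappa (alpha i) * (p i * cconv (pker (alpha i)) (fun s => expR (b * s)) t) <= _).
        rewrite ler_pM2l// -cconvZ//; apply: cconv_norm_le => //.
        - exact: cst_continuous.
        - exact: continuous_cmul.
        - move=> s /andP[s0 _]; rewrite ger0_norm// ler_peMr// -expR0 ler_expR mulr_ge0// ltW//.
      have V0 : 0 <= cconv (pker (alpha i)) (fun s => expR (b * s)) t.
        by apply: cconv_ge0 => // s _; exact: expR_ge0.
      apply: le_trans (_ : p i * (kappa (alpha i) * (L i * cconv (pker (alpha i)) (fun s => expR (b * s)) t)) <= _).
        by rewrite mulrCA ler_wpM2l// ler_pM2l// ler_peMl.
      apply: le_trans (_ : p i * (om / 2 * expR (b * t)) <= _); first by rewrite ler_wpM2l.
      apply: ler_pM => //; first by rewrite mulr_ge0 ?expR_ge0// divr_ge0// ltW.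
        by rewrite (bigD1 i)//= lerDl sumr_ge0.
      by rewrite ler_wpM2r ?expR_ge0// ler_pdivrMr// ler_peMr ?(ltW om0)// ler1n.
    have r0 q1 q2 (G : 'M[R]_(q1, q2)) k : rowdot G (fun=> pospart 0) k = 0.
      by rewrite /rowdot big1// => j _; rewrite pospart0 mulr0.
    rewrite !r0 addr0 normr0 mul1r mulr_ge0 ?expR_ge0//; exact: sumr_ge0.
  - move=> Y Z e gY gZ YZ.
    have e0 (k : 'I_d + 'I_n) : 0 <= e.
      have h := le_trans (normr_ge0 _) (YZ k 0).
      rewrite -(pmulr_lge0 _ (_ : 0 < W k 0))//.
      by case: k {h} => i; apply: mulr_gt0 => //; exact: expR_gt0.
    have Px j s t : s <= t -> `|pospart (Y (inl j) s) - pospart (Z (inl j) s)| <= e * om * expR (b * t).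
      move=> st; apply: le_trans (pospart_lipschitz _ _) _; apply: le_trans (YZ _ _) _; rewrite /W mulrA.
      apply: ler_wpM2l; first by apply: mulr_ge0 (ltW om0); exact: (e0 (inl j)).
      by rewrite ler_expR ler_pM2l.
    have Py j s t : s <= t -> `|pospart (Y (inr j) s) - pospart (Z (inr j) s)| <= e * expR (b * t).
      move=> st; apply: le_trans (pospart_lipschitz _ _) _; apply: le_trans (YZ _ _) _; rewrite /W mul1r.
      apply: ler_wpM2l; first exact: (e0 (inr j)).
      by rewrite ler_expR ler_pM2l.
    have Px' j s t : s <= t -> `|pospart (Y (inl j) s) - pospart (Z (inl j) s)| <= e * expR (b * t).
      move=> /(Px j s) h; apply: le_trans h _; rewrite ler_wpM2r ?expR_ge0//.
      by rewrite ler_piMr//; exact: (e0 (inl j)).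
    case=> i t; rewrite /T /W.
      have e0i := e0 (inl i).
      rewrite -mulrBr normrM (ger0_norm (ltW (kap i))).
      rewrite -cconvB; [|exact: ka|exact: cG|exact: cG].
      apply: le_trans (_ : kappa (alpha i) * (e * L i * cconv (pker (alpha i)) (fun s => expR (b * s)) t) <= _).
        rewrite ler_pM2l// -cconvZ//; apply: cconv_norm_le => //.
        - by move=> s; apply: cvgB; exact: cG.
        - exact: continuous_cmul.
        move=> s _.
        have h1 : `|rowdot Am (fun j => pospart (Y (inl j) s)) i - rowdot Am (fun j => pospart (Z (inl j) s)) i| <=
            (\sum_j `|Am i j|) * (e * expR (b * s)) by apply: rowdot_lipschitz => j; exact: Px'.
        have h2 : `|rowdot B (fun j => pospart (Y (inl j) (s - t1 s))) i - rowdot B (fun j => pospart (Z (inl j) (s - t1 s))) i| <=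
            (\sum_j `|B i j|) * (e * expR (b * s)).
          by apply: rowdot_lipschitz => j; apply: Px'; rewrite gerBl.
        have h3 : `|rowdot E (fun j => pospart (Y (inr j) (s - t2 s))) i - rowdot E (fun j => pospart (Z (inr j) (s - t2 s))) i| <=
            (\sum_j `|E i j|) * (e * expR (b * s)).
          by apply: rowdot_lipschitz => j; apply: Py; rewrite gerBl.
        have h4 : `|m * (Z (inl i) s - Y (inl i) s)| <= m * (e * expR (b * s)).
          rewrite normrM (ger0_norm (ltW m0)) ler_pM2l// distrC.
          apply: le_trans (YZ (inl i) s) _; rewrite /W ler_wpM2l//.
          by rewrite ler_piMl ?expR_ge0.
        rewrite (_ : e * L i * expR (b * s) =
          (\sum_j `|Am i j|) * (e * expR (b * s)) + (\sum_j `|B i j|) * (e * expR (b * s)) +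
          (\sum_j `|E i j|) * (e * expR (b * s)) + m * (e * expR (b * s))); last by rewrite /L; ring.
        rewrite /F /rhs.
        move: h1 h2 h3 h4.
        set a1 := rowdot Am _ i; set a2 := rowdot Am _ i; set a3 := rowdot B _ i; set a4 := rowdot B _ i.
        set a5 := rowdot E _ i; set a6 := rowdot E _ i => h1 h2 h3 h4.
        rewrite [X in `|X|](_ : _ = (a1 - a2) + (a3 - a4) + (a5 - a6) + m * (Z (inl i) s - Y (inl i) s)); last by ring.
        apply: le_trans (ler_normD _ _) _; apply: lerD => //.
        apply: le_trans (ler_normD _ _) _; apply: lerD => //.
        apply: le_trans (ler_normD _ _) _; exact: lerD.
      apply: le_trans (_ : e * (om / 2 * expR (b * t)) <= _).
        by rewrite -mulrA mulrCA ler_wpM2l.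
      rewrite (mulrC th) -[leRHS]mulrA (mulrA th) (mulrC th).
      by rewrite ler_wpM2l// ler_wpM2r ?expR_ge0// ler_pM2l.
    have e0i := e0 (inr i).
    apply: le_trans (_ : (\sum_k `|C i k|) * (e * om * expR (b * t)) + (\sum_j `|D i j|) * (e * expR (b * t)) <= _).
      rewrite opprD addrACA; apply: le_trans (ler_normD _ _) _; apply: lerD.
        by apply: rowdot_lipschitz => j; exact: Px.
      by apply: rowdot_lipschitz => j; apply: Py; rewrite gerBl.
    have dmi : \sum_j `|D i j| <= dm by exact: (@le_bigmax _ _ _ _ (fun i => \sum_j `|D i j|)).
    rewrite mul1r (_ : _ + _ = ((\sum_k `|C i k|) * om + \sum_j `|D i j|) * (e * expR (b * t))); last by ring.
    rewrite -[leRHS]mulrA ler_wpM2r ?mulr_ge0 ?expR_ge0//.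
    rewrite (_ : th = om + dm); last by rewrite /th /om; field.
    by apply: lerD => //; rewrite ler_piMl ?(ltW om0)// ltW.
have u0 i t : 0 <= t -> 0 <= X (inl i) t.
  move=> t0; have [s cs sE] := resolvent_exists (kappa (alpha i) * m) (a01 i).
  have Xi0 : X (inl i) 0 = 0 by rewrite (gX _).2.
  have := @volterra_ge R (alpha i) (kappa (alpha i)) m t (X (inl i)) (F X i) s (a01 i)
    (kap i) m0 (gX (inl i)).1 (cF X i gX) cs sE.
  rewrite Xi0 => /(_ (lexx 0)) h.
  have := h _ _ t; rewrite mul0r => {}h; apply: h; last by rewrite t0 lexx.
  - move=> y _; rewrite addr_ge0// !addr_ge0//; apply: rowdot_ge0 => // j; exact: pospart_ge0.
  - by move=> y _; rewrite add0r {1}XE.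
have z0 i t : 0 <= X (inr i) t.
  by rewrite XE /T addr_ge0//; apply: rowdot_ge0 => // j; exact: pospart_ge0.
have u0' i t : pospart (X (inl i) t) = X (inl i) t.
  by apply: pospart_id; have [/u0//|t0] := leP 0 t; rewrite (gX _).2// ltW.
exists (fun i => X (inl i)), (fun i => X (inr i)); split => //.
- by split => i; exact: (gX _).1.
- by split => i; exact: (gX _).2.
- move=> i t _; rewrite {1}XE /T; congr (_ * _); apply: eq_cconv => // s _.
  rewrite /F /rhs Aml u0' -!addrA.
  rewrite /rowdot; under eq_bigr do rewrite u0'.
  under [X in _ + (m * _ + (X + _)) = _]eq_bigr do rewrite u0'.
  under [X in _ + (m * _ + (_ + (X + _))) = _]eq_bigr do rewrite pospart_id//.
  ring.
- move=> i t _; rewrite {1}XE /T /rowdot; under eq_bigr do rewrite u0'.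
  by congr (_ + _); apply: eq_bigr => j _; rewrite pospart_id.
Qed.

End Existence.

(** * The closed-loop matrix and clamped data *)

Section Final.
Context {R : realType}.

Lemma rowdot_mulmx m n (A : 'M[R]_(m, n)) (v : 'cV[R]_n) i :
  rowdot A (fun j => v j 0) i = (A *m v) i 0.
Proof. by rewrite mxE. Qed.

(** The vector with all entries 1 is sent to positive values by 1 - D. *)
Lemma one_sub_inverse_nonneg n (D : 'M[R]_n) : nonneg_mx D -> (forall i, \sum_j `|D i j| < 1) ->
  1%:M - D \in unitmx /\
  forall c : 'cV[R]_n, (forall i, 0 <= c i 0) -> forall i, 0 <= (invmx (1%:M - D) *m c) i 0.
Proof.
move=> D0 Ds.
have Z i j : i != j -> (1%:M - D) i j <= 0.
  by move=> ij; rewrite !mxE (negbTE ij) mulr0n sub0r oppr_le0.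
have v0 (i : 'I_n) : 0 < (const_mx 1 : 'cV[R]_n) i 0 by rewrite mxE.
have Nv i : 0 < ((1%:M - D) *m (const_mx 1 : 'cV[R]_n)) i 0.
  rewrite mulmxBl mul1mx mxE [X in X + _]mxE [X in _ + X]mxE subr_gt0 mxE.
  by under eq_bigr => j _ do rewrite mxE mulr1 -(ger0_norm (D0 i j)).
have U := zmatrix_unit Z v0 Nv; split => // c c0.
by apply: (zmatrix_mono Z v0 Nv) => i; rewrite mulmxA mulmxV// mul1mx.
Qed.

Lemma metzler_closed_loop d n (A B : 'M[R]_d) (E : 'M[R]_(d, n)) (C : 'M[R]_(n, d)) (D : 'M[R]_n) :
  metzler A -> nonneg_mx B -> nonneg_mx C -> nonneg_mx D -> nonneg_mx E ->
  (forall i, \sum_j `|D i j| < 1) -> metzler (A + B + E *m invmx (1%:M - D) *m C).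
Proof.
move=> hA hB hC hD hE hs i j ij; have [U I0] := one_sub_inverse_nonneg hD hs.
rewrite mxE addr_ge0//; first by rewrite mxE addr_ge0// hA.
rewrite -mulmxA mxE; apply: sumr_ge0 => k _; rewrite mulr_ge0//.
have -> : (invmx (1%:M - D) *m C) k j = (invmx (1%:M - D) *m col j C) k 0.
  by rewrite mxE [RHS]mxE; apply: eq_bigr => l _; rewrite [in RHS]mxE.
by apply: I0 => l; rewrite mxE.
Qed.

(** Start from v > 0 with M v < 0 and solve w = C v + D w + e. The extra e > 0 makes the inequality for w strict and is chosen small enough to keep the one for v. *)
Lemma hurwitz_supersolution d n (A B : 'M[R]_d) (E : 'M[R]_(d, n)) (C : 'M[R]_(n, d)) (D : 'M[R]_n) :
  metzler A -> nonneg_mx B -> nonneg_mx C -> nonneg_mx D -> nonneg_mx E ->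
  (forall i, \sum_j `|D i j| < 1) -> hurwitz (A + B + E *m invmx (1%:M - D) *m C) ->
  exists v w, supersolution A B E C D v w.
Proof.
move=> hA hB hC hD hE hs hM; have [U I0] := one_sub_inverse_nonneg hD hs.
have [v [v0 Mv]] := metzler_hurwitz (metzler_closed_loop hA hB hC hD hE hs) hM.
set M := A + B + _ in Mv.
pose g := E *m (invmx (1%:M - D) *m (const_mx 1 : 'cV[R]_n)).
have g0 i : 0 <= g i 0.
  rewrite mxE; apply: sumr_ge0 => j _; rewrite mulr_ge0//.
  by apply: I0 => k; rewrite mxE.
have gp i : 0 < g i 0 + 1 by rewrite ltr_wpDl.
(* g i 0 + 1 instead of g i 0 keeps the denominator positive. *)
pose e := \big[Num.min/1]_i (- (M *m v) i 0 / (g i 0 + 1)).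
have e0 : 0 < e by apply: lt_bigmin => // i _; rewrite divr_gt0// oppr_gt0.
have eg i : e * g i 0 < - (M *m v) i 0.
  apply: lt_le_trans (_ : e * (g i 0 + 1) <= _); first by rewrite ltr_pM2l// ltrDl.
  by rewrite -ler_pdivlMr//; exact: (@bigmin_le _ _ _ _ i (fun i => - (M *m v) i 0 / (g i 0 + 1))).
pose w : 'cV[R]_n := invmx (1%:M - D) *m (C *m v + e *: const_mx 1).
have wE i : w i 0 = (C *m v) i 0 + e + (D *m w) i 0.
  have /colP/(_ i) : (1%:M - D) *m w = C *m v + e *: const_mx 1.
    by rewrite /w mulmxA mulmxV// mul1mx.
  rewrite mulmxBl mul1mx mxE [X in _ + X]mxE [RHS]mxE [X in _ = _ + X]mxE [X in _ = _ + _ * X]mxE mulr1.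
  by move=> <-; rewrite subrK.
have Cv0 i : 0 <= (C *m v) i 0.
  by rewrite mxE; apply: sumr_ge0 => j _; rewrite mulr_ge0// ltW.
have w0' i : 0 <= w i 0.
  apply: I0 => j; rewrite mxE [X in _ + X]mxE [X in _ * X]mxE mulr1.
  by rewrite addr_ge0// ltW.
have Dw0 i : 0 <= (D *m w) i 0 by rewrite mxE; apply: sumr_ge0 => j _; rewrite mulr_ge0.
exists (fun i => v i 0), (fun i => w i 0); split => //.
- by move=> i; rewrite wE -addrA ltr_wpDl// ltr_wpDr.
- move=> i; rewrite !rowdot_mulmx.
  have : (E *m w) i 0 = (E *m invmx (1%:M - D) *m C *m v) i 0 + e * g i 0.
    rewrite /w !mulmxDr -!scalemxAr mxE [X in _ + X]mxE; congr (_ + _).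
    by rewrite !mulmxA.
  have ME : (M *m v) i 0 =
      (A *m v) i 0 + (B *m v) i 0 + (E *m invmx (1%:M - D) *m C *m v) i 0.
    by rewrite /M !mulmxDl [LHS]mxE; congr (_ + _); rewrite [LHS]mxE.
  move=> ->; have := eg i; rewrite ME.
  move: ((A *m v) i 0) ((B *m v) i 0) (e * g i 0) (_ i 0) => a1 a2 a3 a4; lra.
- move=> i; rewrite !rowdot_mulmx wE; lra.
Qed.

Lemma clamp_continuous (T : topologicalType) (f : R -> T) (a : R) :
  {within `[a, +oo[, continuous f} -> continuous (fun t => f (Num.max t a)).
Proof.
move=> /subspace_continuousP cf t.
have At s : `[a, +oo[%classic (Num.max s a) by rewrite /= in_itv /= le_max lexx orbT.
apply: (cvg_comp _ _ _ (cf _ (At t))) => P /= wP.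
have H : \forall s \near t, `[a, +oo[%classic (Num.max s a) -> P (Num.max s a).
  exact: (@max_cst_continuous _ a t _ wP).
move: H.
by apply: filterS => s /(_ (At s)).
Qed.

(** The Caputo derivative at t > 0 only sees the values on [0, +oo[, whereas solutions are constrained on [-r, +oo[ only. *)
Lemma caputo_local (a t : R) (u u' : R -> R) : 0 < t -> (forall s, 0 <= s -> u s = u' s) ->
  (caputo_derivable a u t -> caputo_derivable a u' t) /\ caputo a u t = caputo a u' t.
Proof.
move=> t0 uu.
have P s : 0 <= s -> caputo_primitive a u s = caputo_primitive a u' s.
  move=> s0; rewrite /caputo_primitive /frac_int; case: ifP => _; first by rewrite !uu.
  congr (_ * _); apply: eq_Rintegral => z; rewrite mem_setE in_itv /= => /andP[z0 _].
  by rewrite !uu.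
have ne : {near t, caputo_primitive a u =1 caputo_primitive a u'}.
  near=> s; apply/P/ltW; near: s; exact: lt_nbhsr.
split; first exact: near_eq_derivable ne.
by rewrite /caputo !derive1E; exact: near_eq_derive.
Unshelve. all: by end_near. Qed.

Lemma entry_le_norm m n (M : 'M[R]_(m, n)) i j : `|M i j| <= `|M|.
Proof.
rewrite [leRHS]mx_normrE; exact: (@le_bigmax _ _ _ 0 (fun ij => `|M ij.1 ij.2|) (i, j)).
Qed.

Lemma norm_le_entry m n (M : 'M[R]_(m, n)) (e : R) : 0 <= e ->
  (forall i j, `|M i j| <= e) -> `|M| <= e.
Proof. by move=> e0 H; rewrite [leLHS]mx_normrE; apply: bigmax_le. Qed.

Lemma col_continuous m (f : 'I_m -> R -> R) : (forall i, continuous (f i)) ->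
  continuous (fun t => \col_i f i t : 'cV[R]_m).
Proof.
move=> cf t; apply/cvgrPdist_le => /= e e0.
have : \forall s \near t, forall i, `|f i t - f i s| <= e.
  apply: (@filter_forall _ _ (fun i s => `|f i t - f i s| <= e) (nbhs t)) => i.
  by have /cvgrPdist_le /(_ e e0) := cf i t.
apply: filterS => s H; apply: norm_le_entry; first exact: ltW.
by move=> i j; rewrite !mxE.
Qed.

Lemma delay_clamp (r : R) tau : delay r tau ->
  [/\ continuous (fun t : R => tau (Num.max t 0)), forall t : R, 0 <= tau (Num.max t 0) &
      forall M : R, exists T : R, forall t, T <= t -> M <= t - tau (Num.max t 0)].
Proof.
case=> ct t0 _ tinf; split.
- exact: clamp_continuous.
- by move=> t; apply: t0; rewrite le_max lexx orbT.
- move=> M; have /cvgryPge /(_ M)[T [_ HT]] := tinf.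
  exists (Num.max (T + 1) 0) => t; rewrite ge_max => /andP[Tt t00].
  rewrite (max_idPl t00); apply: HT; apply: lt_le_trans Tt.
  by rewrite ltrDl.
Qed.

End Final.

(** * The two implications *)

Section Directions.
Context {R : realType}.

Lemma supersolutionZ d n (A B : 'M[R]_d) (E : 'M[R]_(d, n)) (C : 'M[R]_(n, d)) (D : 'M[R]_n) v w (N : R) :
  0 < N -> supersolution A B E C D v w ->
  supersolution A B E C D (fun i => N * v i) (fun i => N * w i).
Proof.
move=> N0 [v0 w0 Hv Hw]; split => [i|i|i|i]; rewrite ?mulr_gt0// !rowdotZ -!mulrDr.
  by rewrite pmulr_rlt0.
by rewrite ltr_pM2l.
Qed.

(** Freezing x and y below -r, and the delays below 0, changes no value that enters the equations, because t - tau t >= - r. *)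
Lemma solution_trajectory d n (r : R) (alpha : 'I_d -> R) (A B : 'M[R]_d) (E : 'M[R]_(d, n))
    (C : 'M[R]_(n, d)) (D : 'M[R]_n) tau1 tau2 tau3 psi phi x y :
  0 < r -> (forall i, 0 < alpha i <= 1) -> delay r tau1 -> delay r tau2 -> delay r tau3 ->
  is_solution r alpha A B E C D tau1 tau2 tau3 psi phi x y ->
  trajectory alpha A B E C D (fun t => tau1 (Num.max t 0)) (fun t => tau2 (Num.max t 0))
    (fun t => tau3 (Num.max t 0)) (fun i t => x (Num.max t (- r)) i 0)
    (fun i t => y (Num.max t (- r)) i 0).
Proof.
move=> r0 a01 d1 d2 d3 [[cx cy] xE yE _].
have rt t : 0 <= t -> - r <= t by apply: le_trans; rewrite oppr_le0 ltW.
have ccx i : continuous (fun t => x (Num.max t (- r)) i 0).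
  move=> t; apply: (continuous_comp (f := fun t => x (Num.max t (- r))) (g := fun M : 'cV[R]_d => M i 0)).
    exact: clamp_continuous.
  exact: coord_continuous.
have ccy i : continuous (fun t => y (Num.max t (- r)) i 0).
  move=> t; apply: (continuous_comp (f := fun t => y (Num.max t (- r))) (g := fun M : 'cV[R]_n => M i 0)).
    exact: clamp_continuous.
  exact: coord_continuous.
have [ct1 _ _] := delay_clamp d1; have [ct2 _ _] := delay_clamp d2.
have [_ _ dr1 _] := d1; have [_ _ dr2 _] := d2; have [_ _ dr3 _] := d3.
split => // i t t0; last first.
  rewrite (max_idPl (rt t t0)) (max_idPl t0) (max_idPl (dr3 t t0)) yE// mxE.
  by rewrite -!rowdot_mulmx.
move: t t0; apply/(caputo_volterra (a01 i) (ccx i)).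
  by apply: rhs_continuous.
move=> t t0; have [dx ex] := xE t t0.
have [h1 h2] := @caputo_local R (alpha i) t (fun s => x s i 0) (fun s => x (Num.max s (- r)) i 0) t0
  (fun s s0 => congr1 (fun z => x z i 0) (esym (max_idPl (rt s s0)))).
split; first by apply: h1; exact: dx.
rewrite -h2; have /colP/(_ i) := ex; rewrite mxE => ->.
rewrite /rhs (max_idPl (ltW t0)) (max_idPl (rt t (ltW t0))).
rewrite (max_idPl (dr1 t (ltW t0))) (max_idPl (dr2 t (ltW t0))).
by rewrite mxE [X in X + _]mxE -!rowdot_mulmx.
Qed.

(** Continuity on [-r, 0] bounds the initial data by a multiple of (v, w), to which [trajectory_decay] applies. *)
Lemma hurwitz_attractive d n (r : R) (alpha : 'I_d -> R) (A B : 'M[R]_d) (E : 'M[R]_(d, n))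
    (C : 'M[R]_(n, d)) (D : 'M[R]_n) tau1 tau2 tau3 :
  0 < r -> (forall i, 0 < alpha i <= 1) -> delay r tau1 -> delay r tau2 -> delay r tau3 ->
  metzler A -> nonneg_mx B -> nonneg_mx C -> nonneg_mx D -> nonneg_mx E ->
  (forall i, \sum_(j < n) `|D i j| < 1) ->
  hurwitz (A + B + E *m invmx (1%:M - D) *m C) ->
  globally_attractive r alpha A B E C D tau1 tau2 tau3.
Proof.
move=> r0 a01 d1 d2 d3 hA hB hC hD hE hs hM psi phi _ _ _ _ x y sol.
have tr := solution_trajectory r0 a01 d1 d2 d3 sol.
have [v [w sub]] := hurwitz_supersolution hA hB hC hD hE hs hM.
have [v0 w0 _ _] := sub.
have [ct1 t10 i1] := delay_clamp d1; have [ct2 t20 i2] := delay_clamp d2.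
have [ct3 t30 i3] := delay_clamp d3.
pose xx i t := x (Num.max t (- r)) i 0; pose yy i t := y (Num.max t (- r)) i 0.
have [cx cy _ _] := tr.
have bd k (f : 'I_k -> R -> R) (g : R -> 'cV[R]_k) (c : 'I_k -> R) :
    (forall i t, f i t = g (Num.max t (- r)) i 0) ->
    (forall i, continuous (f i)) -> (forall i, 0 < c i) ->
    exists2 N, 0 <= N & forall i s, s <= 0 -> `|f i s| <= N * c i.
  move=> fg cf c0.
  have H i : exists M, 0 <= M /\ forall s, - r <= s <= 0 -> `|f i s| <= M.
    by have [M M0 HM] := continuous_itv_bounded (- r) 0 (cf i); exists M.
  have /choice[z zP] := H.
  have zc i : 0 <= z i / c i by rewrite divr_ge0 ?(ltW (c0 _))//; case: (zP i).
  exists (\sum_i z i / c i); first exact: sumr_ge0.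
  move=> i s s0; have [_ zi] := zP i.
  have -> : f i s = f i (Num.max s (- r)) by rewrite !fg -maxA maxxx.
  apply: le_trans (zi _ _) _.
    by rewrite le_max lexx orbT /= ge_max s0 oppr_le0 ltW.
  by rewrite -ler_pdivrMr// (bigD1 i)//= lerDl sumr_ge0.
have [N1 N10 H1] := bd d xx x v (fun _ _ => erefl) cx v0.
have [N2 N20 H2] := bd n yy y w (fun _ _ => erefl) cy w0.
pose N := N1 + N2 + 1.
have N0 : 0 < N by rewrite ltr_wpDl// addr_ge0.
have sub' := supersolutionZ N0 sub.
have dec := trajectory_decay a01 hA hB hC hD hE ct1 ct2 t10 t20 t30 sub' tr.
have {}dec : forall e : R, 0 < e -> exists T, forall t, T <= t ->
    (forall i, `|xx i t| <= e * (N * v i)) /\ (forall i, `|yy i t| <= e * (N * w i)).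
  apply: dec.
  - move=> M; have [T1 HT1] := i1 M; have [T2 HT2] := i2 M; have [T3 HT3] := i3 M.
    exists (Num.max T1 (Num.max T2 T3)) => t; rewrite !ge_max => /and3P[h1 h2 h3].
    by split; [exact: HT1|exact: HT2|exact: HT3].
  - move=> i s s0; apply: le_lt_trans (H1 i s s0) _; rewrite ltr_pM2r// /N; lra.
  - move=> i s s0; apply: le_lt_trans (H2 i s s0) _; rewrite ltr_pM2r// /N; lra.
apply/cvgrPdist_le => /= e e0.
pose S := N * (\sum_i v i + \sum_i w i) + 1.
have Sv : 0 <= \sum_i v i by apply: sumr_ge0 => i _; exact: ltW.
have Sw : 0 <= \sum_i w i by apply: sumr_ge0 => i _; exact: ltW.
have S0 : 0 < S by rewrite /S ltr_wpDl// mulr_ge0 ?addr_ge0// ltW.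
have [T HT] := dec (e / S) (divr_gt0 e0 S0).
have small c : 0 <= c -> c <= \sum_i v i + \sum_i w i -> e / S * (N * c) <= e.
  move=> c0 cS; rewrite mulrAC ler_pdivrMr// ler_pM2l// /S.
  by apply: ler_wpDr => //; rewrite ler_pM2l.
near=> t.
have tT : T <= t by near: t; apply: nbhs_pinfty_ge; exact: num_real.
have t0 : 0 <= t by near: t; apply: nbhs_pinfty_ge; exact: num_real.
have tr' : Num.max t (- r) = t by apply/max_idPl; rewrite (le_trans _ t0)// oppr_le0 ltW.
have [hx hy] := HT t tT.
rewrite sub0r normrN normr_id; apply: norm_le_entry => [|i j]; first exact: ltW.
rewrite (ord1 j) mxE; case: splitP => k _.
- have := hx k; rewrite /xx tr' => h; apply: le_trans h _; apply: small; first exact: ltW.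
  by rewrite (bigD1 k)//= -addrA lerDl addr_ge0// sumr_ge0// => l _; exact: ltW.
- have := hy k; rewrite /yy tr' => h; apply: le_trans h _; apply: small; first exact: ltW.
  by rewrite [in leRHS](bigD1 k)//= addrCA lerDl addr_ge0// sumr_ge0// => l _; exact: ltW.
Unshelve. all: by end_near. Qed.

(** The solution v + u, w + z has a component that stays above some v k > 0. *)
Lemma attractive_hurwitz d n (r : R) (alpha : 'I_d -> R) (A B : 'M[R]_d) (E : 'M[R]_(d, n))
    (C : 'M[R]_(n, d)) (D : 'M[R]_n) tau1 tau2 tau3 :
  0 < r -> (forall i, 0 < alpha i <= 1) -> delay r tau1 -> delay r tau2 -> delay r tau3 ->
  metzler A -> nonneg_mx B -> nonneg_mx C -> nonneg_mx D -> nonneg_mx E ->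
  (forall i, \sum_(k < d) `|C i k| < 1) -> (forall i, \sum_(j < n) `|D i j| < 1) ->
  globally_attractive r alpha A B E C D tau1 tau2 tau3 ->
  hurwitz (A + B + E *m invmx (1%:M - D) *m C).
Proof.
move=> r0 a01 d1 d2 d3 hA hB hC hD hE hCs hs GA; apply: contrapT => nH.
have [U I0] := one_sub_inverse_nonneg hD hs.
have [v [v0 [k vk] Mv]] := metzler_not_hurwitz (metzler_closed_loop hA hB hC hD hE hs) nH.
have [ct1 t10 _] := delay_clamp d1; have [ct2 t20 _] := delay_clamp d2.
have [ct3 t30 _] := delay_clamp d3.
pose w : 'cV[R]_n := invmx (1%:M - D) *m (C *m v).
have wE : w = C *m v + D *m w.
  have : (1%:M - D) *m w = C *m v by rewrite /w mulmxA mulmxV// mul1mx.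
  by rewrite mulmxBl mul1mx => <-; rewrite subrK.
have w0 i : 0 <= w i 0.
  by apply: I0 => j; rewrite mxE; apply: sumr_ge0 => l _; rewrite mulr_ge0.
pose p i := rowdot A (fun j => v j 0) i + rowdot B (fun j => v j 0) i + rowdot E (fun j => w j 0) i.
have p0 i : 0 <= p i.
  have := Mv i; rewrite !mulmxDl mxE [X in X + _]mxE /p !rowdot_mulmx.
  by rewrite -!mulmxA.
have [u [z [[cu cz] [u0 z0] upos uE zE]]] := positive_solution a01 hA hB hC hD hE hCs hs
  ct1 ct2 ct3 t10 t20 t30 p0.
pose x t : 'cV[R]_d := \col_i (v i 0 + u i t).
pose y t : 'cV[R]_n := \col_i (w i 0 + z i t).
have cvu i : continuous (fun t => v i 0 + u i t).
  by move=> t; apply: cvgD; [exact: cvg_cst|exact: cu].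
have cwz i : continuous (fun t => w i 0 + z i t).
  by move=> t; apply: cvgD; [exact: cvg_cst|exact: cz].
have xneg t : t <= 0 -> x t = v.
  by move=> t0; apply/colP => i; rewrite mxE u0// addr0.
have yneg t : t <= 0 -> y t = w.
  by move=> t0; apply/colP => i; rewrite mxE z0// addr0.
have rdx m (G : 'M[R]_(m, d)) s i : (G *m x s) i 0 = rowdot G (fun j => v j 0) i + rowdot G (u^~ s) i.
  by rewrite mxE /rowdot -big_split; apply: eq_bigr => j _; rewrite mxE mulrDr.
have rdy m (G : 'M[R]_(m, n)) s i : (G *m y s) i 0 = rowdot G (fun j => w j 0) i + rowdot G (z^~ s) i.
  by rewrite mxE /rowdot -big_split; apply: eq_bigr => j _; rewrite mxE mulrDr.
have sol : is_solution r alpha A B E C D tau1 tau2 tau3 (fun=> v) (fun=> w) x y.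
  split.
  - by split; apply: continuous_subspaceT; apply: col_continuous.
  - move=> t t0.
    have H i : caputo_derivable (alpha i) (fun s => x s i 0) t /\
       caputo (alpha i) (fun s => x s i 0) t =
         rhs A B E (fun t => tau1 (Num.max t 0)) (fun t => tau2 (Num.max t 0)) u z i t + p i.
      have xi : (fun s => x s i 0) = (fun t => v i 0 + u i t) by apply/funext => s; rewrite mxE.
      rewrite xi; move: t t0.
      apply/(caputo_volterra (f := fun t => rhs A B E (fun t => tau1 (Num.max t 0))
        (fun t => tau2 (Num.max t 0)) u z i t + p i) (a01 i) (cvu i)).
        by move=> t; apply: cvgD; [exact: rhs_continuous|exact: cvg_cst].
      by move=> t t0; rewrite (u0 _ 0)// addr0 uE.
    split; first by move=> i; exact: (H i).1.
    apply/colP => i; rewrite mxE (H i).2 mxE [X in _ = X + _]mxE !rdx rdy /rhs /p.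
    by rewrite (max_idPl (ltW t0)); ring.
  - move=> t t0; apply/colP => i; rewrite mxE [RHS]mxE rdx rdy zE// (max_idPl t0).
    by rewrite {1}wE mxE -!rowdot_mulmx; ring.
  - by move=> t /andP[_ t0]; rewrite xneg// yneg.
have cst m (c : 'cV[R]_m) : {within `[- r, 0], continuous (fun=> c : 'cV[R]_m)}.
  by apply: continuous_subspaceT; exact: cst_continuous.
have comp0 : C *m v + D *m w = w by rewrite -wE.
have nn t : - r <= t <= 0 -> nonneg_mx v /\ nonneg_mx w.
  by move=> _; split => i j; rewrite (ord1 j).
have := GA (fun=> v) (fun=> w) (cst _ v) (cst _ w) nn comp0 x y sol.
move=> /cvgrPdist_lt /(_ _ vk)[T [_ HT]].
pose t := Num.max (T + 1) 0.
have Tt : T < t by rewrite /t lt_max ltrDl ltr01.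
have t0 : 0 <= t by rewrite /t le_max lexx orbT.
have := HT t Tt; rewrite /= sub0r normrN normr_id ltNge => /negP; apply.
apply: le_trans (entry_le_norm _ (lshift n k) 0).
rewrite col_mxEu mxE ger0_norm; first by rewrite lerDl upos.
by rewrite addr_ge0// upos.
Qed.

End Directions.

Theorem theorem5p5 (R : realType) (d n : nat) (r : R) (alpha : 'I_d -> R)
    (A B : 'M[R]_d) (E : 'M[R]_(d, n)) (C : 'M[R]_(n, d)) (D : 'M[R]_n)
    (tau1 tau2 tau3 : R -> R)
    (r_gt0 : 0 < r)
    (alpha01 : forall i, 0 < alpha i <= 1)
    (htau1 : delay r tau1) (htau2 : delay r tau2) (htau3 : delay r tau3)
    (hA : metzler A)
    (hB : nonneg_mx B) (hC : nonneg_mx C) (hD : nonneg_mx D) (hE : nonneg_mx E)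
    (hCsum : forall i, \sum_(k < d) `|C i k| < 1)
    (hDsum : forall i, \sum_(j < n) `|D i j| < 1) :
  globally_attractive r alpha A B E C D tau1 tau2 tau3 <->
  hurwitz (A + B + E *m invmx (1%:M - D) *m C).
Proof.
split; first exact: attractive_hurwitz.
exact: hurwitz_attractive.
Qed.
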